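(* Let $\mathrm{Dia}'\subset\mathrm{Dia}$ be two diagram categories, let $N:\mathrm{Dia}\to\mathrm{Dia}'$ with $\pi:N\Rightarrow\mathrm{id}$ be a functor satisfying (N1), (N2), (N3), (N4 left), (N5 left), and let $\widetilde{N}:\mathrm{Dia}\to\mathrm{Dia}'$ with $\widetilde{\pi}:\widetilde{N}\Rightarrow\mathrm{id}$ be a functor satisfying (N1), (N2), (N3), (N4 right), (N5 right). Suppose, in addition, that for each $I\in\mathrm{Dia}$ the comma category $N(I)\times_{/I}\widetilde{N}(I)$ is in $\mathrm{Dia}'$ as well. Let $\mathbb{D}\to\mathbb{S}$ be a left and right fibered multiderivator with domain $\mathrm{Dia}'$ such that $\mathbb{S}$ extends to all of $\mathrm{Dia}$. Then for $I\in\mathrm{Dia}$ and $S\in\mathbb{S}(I)$ we have an equivalence of categories $$\mathbb{D}(N(I))^{\pi_I\text{-}\mathrm{cart}}_{\pi_I^*S}\cong\mathbb{D}(\widetilde{N}(I))^{\widetilde{\pi}_I\text{-}\mathrm{cart}}_{\widetilde{\pi}_I^*S}$$ compatible with pull-back along functors $\alpha:I\to J$ in $\mathrm{Dia}$ and, for all morphisms $f$ in $\mathbb{S}(I)$, intertwining push-forward along $\pi_I^*f$ with that along $\widetilde{\pi}_I^*f$.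
   Context: Diagrams. $\mathrm{Cat}$ is the 2-category of small categories; $\cdot$ is the terminal category. A diagram category is a full sub-2-category of $\mathrm{Cat}$ containing $\emptyset$, $\cdot$ and $\Delta_1=(0\to1)$ and closed under finite coproducts, fibre products and comma categories. For $\alpha:I\to J$, $\beta:K\to J$ the comma category $I\times_{/J}K$ has objects $(i,k,\alpha(i)\to\beta(k))$; an object $j\in J$ is identified with the functor $\cdot\to J$, giving $I\times_{/J}j$ and $j\times_{/J}I$. Opfibration means Grothendieck opfibration. Multicategories. A multicategory has $n$-ary morphisms for all $n\ge 0$. For a functor of multicategories $p:\mathcal{D}\to\mathcal{S}$, $\mathrm{Hom}_f$ denotes morphisms lying over $f$, and $\mathcal{D}_S$ the fiber category (objects over $S$, unary morphisms over $\mathrm{id}_S$). A morphism $\xi\in\mathrm{Hom}_f(E_1,\dots,E_n;F)$ is coCartesian if for every $g$ having $p(F)$ as one of its sources, composition with $\xi$ in that slot gives a bijection $\mathrm{Hom}_g(\dots,F,\dots;G)\to\mathrm{Hom}_{g\circ f}(\dots,E_1,\dots,E_n,\dots;G)$. It is Cartesian w.r.t. the $i$-th slot if for every $g$ with target $p(E_i)$, composition gives a bijection $\mathrm{Hom}_g(G_1,\dots,G_m;E_i)\to\mathrm{Hom}_{f\circ_i g}(E_1,\dots,E_{i-1},G_1,\dots,G_m,E_{i+1},\dots,E_n;F)$. $p$ is opfibered if for each $f\in\mathrm{Hom}(S_1,\dots,S_n;T)$ and objects $E_k$ over $S_k$ there is a coCartesian morphism over $f$ with sources $E_1,\dots,E_n$;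 fibered if for each $f$ ($n\ge1$), each $i$, objects $E_k$ over $S_k$ ($k\ne i$) and $F$ over $T$ there is a morphism over $f$ with these remaining sources and target $F$ that is Cartesian w.r.t. the $i$-th slot. Choices give push-forward functors $f_\bullet:\prod_k\mathcal{D}_{S_k}\to\mathcal{D}_T$ and pull-back functors $f^{\bullet,i}:\prod_{k\neq i}\mathcal{D}_{S_k}^{\mathrm{op}}\times\mathcal{D}_T\to\mathcal{D}_{S_i}$ (written $f^\bullet$ if $n=1$). Pre-multiderivators. A pre-derivator (resp. pre-multiderivator) with domain $\mathrm{Dia}$ is a strict 2-functor $\mathbb{D}$ from $\mathrm{Dia}^{1\text{-}\mathrm{op}}$ to the 2-category of categories (resp. multicategories); $\alpha^*:=\mathbb{D}(\alpha)$, and $\mu:\alpha\Rightarrow\beta$ induces $\mathbb{D}(\mu):\alpha^*\to\beta^*$. (Der1): $\mathbb{D}(I\coprod J)\to\mathbb{D}(I)\times\mathbb{D}(J)$ is an equivalence for all $I,J$, and $\mathbb{D}(\emptyset)$ is not empty. (Der2): the underlying diagram functor $\mathbb{D}(I)\to\mathrm{Fun}(I,\mathbb{D}(\cdot))$ is conservative. $\mathbb{S}$ is a pre-multiderivator with domain $\mathrm{Dia}$ satisfying (Der1) and (Der2); ''$\mathbb{D}\to\mathbb{S}$ with domain $\mathrm{Dia}'$'' means $\mathbb{D}\to\mathbb{S}|_{\mathrm{Dia}'}$. Fibered multiderivators. Let $p:\mathbb{D}\to\mathbb{S}$ be a morphism of pre-multiderivators; $\mathbb{D}(I)_S$ is the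 fiber over $S\in\mathbb{S}(I)$. It is a left fibered multiderivator if $\mathbb{D},\mathbb{S}$ satisfy (Der1), (Der2) and: (FDer0 left) each $\mathbb{D}(I)\to\mathbb{S}(I)$ is an opfibered multicategory and each $\alpha^*$ maps coCartesian morphisms to coCartesian morphisms. (FDer3 left) for $\alpha:I\to J$ and $S\in\mathbb{S}(J)$, $\alpha^*:\mathbb{D}(J)_S\to\mathbb{D}(I)_{\alpha^*S}$ has a left adjoint $\alpha_!$. (FDer4 left) for $\alpha:I\to J$, $j\in J$, with projections $\iota:I\times_{/J}j\to I$, $q:I\times_{/J}j\to\cdot$ and canonical $\mu:\alpha\iota\Rightarrow jq$, the natural map $q_!\,\mathbb{S}(\mu)_\bullet\,\iota^*\to j^*\alpha_!$ is an isomorphism. (FDer5 left) for every opfibration $\alpha:I\to J$, every $f\in\mathrm{Hom}(S_1,\dots,S_n;T)$ in $\mathbb{S}(J)$, $n\ge1$, and every slot, the natural map $\alpha_!(\alpha^*f)_\bullet(\alpha^*-,\dots,-,\dots,\alpha^*-)\to f_\bullet(-,\dots,\alpha_!-,\dots,-)$ is an isomorphism. It is a right fibered multiderivator if $\mathbb{D},\mathbb{S}$ satisfy (Der1), (Der2) and: (FDer0 right) each $\mathbb{D}(I)\to\mathbb{S}(I)$ is a fibered multicategory and for each opfibration $\alpha$, $\alpha^*$ maps morphisms that are Cartesian w.r.t. the $i$-th slot to such morphisms. (FDer3 right) $\alpha^*:\mathbb{D}(J)_S\to\mathbb{D}(I)_{\alpha^*S}$ has a right adjoint $\alpha_*$.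 (FDer4 right) with $\iota:j\times_{/J}I\to I$, $q:j\times_{/J}I\to\cdot$, $\mu:jq\Rightarrow\alpha\iota$, the natural map $j^*\alpha_*\to q_*\,\mathbb{S}(\mu)^\bullet\,\iota^*$ is an isomorphism. (FDer5 right) for every functor $\alpha:I\to J$, every $f\in\mathrm{Hom}(S_1,\dots,S_n;T)$ in $\mathbb{S}(J)$, $n\ge1$, and every $i\in\{1,\dots,n\}$, the natural map $f^{\bullet,i}(-,\dots,-;\alpha_*-)\to\alpha_*(\alpha^*f)^{\bullet,i}(\alpha^*-,\dots,\alpha^*-;-)$ is an isomorphism. Cartesian objects. For a functor $\pi:K\to E$ with $K\in\mathrm{Dia}'$, an object $X\in\mathbb{D}(K)$ is $\pi$-Cartesian if for every $\mu:k\to k'$ in $K$ with $\pi(\mu)$ an identity, $k^*X\to k'^*X$ is Cartesian (for $X$ over an object of the form $\pi^*S$: an isomorphism). With $E=\cdot$ one speaks of (absolutely) Cartesian objects. The superscript $\pi$-cart denotes the full subcategory of $\pi$-Cartesian objects. Axioms on $(N,\pi)$ ($N$ is a functor of 1-categories, $\pi_I:N(I)\to I$): (N1) $N(I)\times_{/I}N(I)$ (formed w.r.t. $\pi_I$) is in $\mathrm{Dia}'$ for all $I\in\mathrm{Dia}$. (N2) $N(I\coprod J)=N(I)\coprod N(J)$, $N(\emptyset)=\emptyset$. (N3) each $\pi_I$ is surjective on objects and morphisms and has connected fibers. (N4 left) for $\alpha:I\to J$ in $\mathrm{Dia}$ and $j\in J$, the canonical functor $N(I\times_{/J}j)\to N(I)\times_{/J}j$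 (comma category w.r.t. $\alpha\circ\pi_I$) is an isomorphism. (N5 left) for any pre-derivator $\mathbb{D}$ with domain $\mathrm{Dia}'$ satisfying (Der1), (Der2), and any $I\in\mathrm{Dia}$ with final object $i$, the functors $n^*:\mathbb{D}(N(I))^{\pi_I\text{-}\mathrm{cart}}\to\mathbb{D}(\cdot)$ and $p^*$ in the other direction form an adjunction with $n^*$ left adjoint, where $n$ is some object with $\pi_I(n)=i$ and $p:N(I)\to\cdot$; the counit is the natural isomorphism $n^*p^*=\mathrm{id}$ and the unit is an isomorphism on absolutely Cartesian objects. (N4 right) for $\alpha:I\to J$ in $\mathrm{Dia}$ and $j\in J$, the canonical functor $N(j\times_{/J}I)\to j\times_{/J}N(I)$ (comma category w.r.t. $\alpha\circ\pi_I$) is an isomorphism. (N5 right) for any pre-derivator $\mathbb{D}$ with domain $\mathrm{Dia}'$ satisfying (Der1), (Der2), and any $I\in\mathrm{Dia}$ with initial object $i$, the functors $n^*:\mathbb{D}(N(I))^{\pi_I\text{-}\mathrm{cart}}\to\mathbb{D}(\cdot)$ and $p^*$ in the other direction form an adjunction with $n^*$ right adjoint, where $n$ is some object with $\pi_I(n)=i$ and $p:N(I)\to\cdot$; the unit is the natural isomorphism $\mathrm{id}=n^*p^*$ and the counit is an isomorphism on absolutely Cartesian objects. *)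

(* Defs.v *)
From Stdlib Require Import List Relations ProofIrrelevance FunctionalExtensionality.
From Stdlib Require Import ssreflect.
Import ListNotations.

Set Implicit Arguments.
Unset Strict Implicit.
Unset Printing Implicit Defensive.

(* A single universe serves both for the small categories of a diagram category
   and for the values of pre-(multi)derivators.  A diagram category is an
   arbitrary predicate on [Category] with closure properties, so it can be taken
   to consist of the categories isomorphic to one from a lower universe. *)
Record Category := {
  Ob :> Type;
  Hom : Ob -> Ob -> Type;
  idc : forall x, Hom x x;
  comp : forall x y z, Hom y z -> Hom x y -> Hom x z;
  comp_idl : forall x y (f : Hom x y), comp (idc y) f = f;
  comp_idr : forall x y (f : Hom x y), comp f (idc x) = f;
  comp_assoc : forall w x y z (h : Hom y z) (g : Hom x y) (f : Hom w x),
    comp h (comp g f) = comp (comp h g) f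
}.
Arguments Hom {c}.
Arguments idc {c}.
Arguments comp {c x y z}.

Declare Scope cat_scope.
Open Scope cat_scope.
Notation "g ∘ f" := (comp g f) (at level 40, left associativity) : cat_scope.

(* [Arrow f = Arrow g] is equality of morphisms whose sources and targets are
   only propositionally equal. *)
Record arrow (C : Category) := Arrow { asrc : C; atgt : C; ahom : Hom asrc atgt }.
Arguments Arrow {C asrc atgt}.

Definition eqhom (C : Category) (x y : C) (e : x = y) : Hom x y :=
  match e with eq_refl => idc x end.

Definition is_identity (C : Category) (x y : C) (f : Hom x y) : Prop :=
  exists z : C, Arrow f = Arrow (idc z).

Definition is_iso (C : Category) (x y : C) (f : Hom x y) : Prop :=
  exists g : Hom y x, g ∘ f = idc x /\ f ∘ g = idc y.

Definition is_final (C : Category) (x : C) : Prop :=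
  forall y : C, exists! f : Hom y x, True.
Definition is_initial (C : Category) (x : C) : Prop :=
  forall y : C, exists! f : Hom x y, True.

Lemma arrow_elim (C : Category) (x y : C) (f : Hom x y)
    (P : forall x' y', Hom x' y' -> Prop) :
  P x y f -> forall x' y' (g : Hom x' y'), Arrow f = Arrow g -> P x' y' g.
Proof.
move=> H x' y' g e.
exact: (match e in _ = a return P (asrc a) (atgt a) (ahom a)
        with eq_refl => H end).
Qed.

Lemma arrow_inj (C : Category) (x y : C) (f g : Hom x y) :
  Arrow f = Arrow g -> f = g.
Proof.
move=> e.
have H := @arrow_elim C x y f (fun x' y' g => forall (ex : x' = x) (ey : y' = y),
  f = eq_rect x' (fun t => Hom t y) (eq_rect y' (Hom x') g y ey) x ex) _ x y g e
  eq_refl eq_refl.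
apply: H => ex ey.
by rewrite (proof_irrelevance _ ex eq_refl) (proof_irrelevance _ ey eq_refl).
Qed.

Lemma arrow_comp (C : Category) (x y z x' y' z' : C)
    (f : Hom x y) (g : Hom y z) (f' : Hom x' y') (g' : Hom y' z') :
  Arrow f = Arrow f' -> Arrow g = Arrow g' -> Arrow (g ∘ f) = Arrow (g' ∘ f').
Proof.
move=> ef.
move: x' y' f' ef z' g'.
apply: arrow_elim => z' g' eg.
have H := @arrow_elim C y z g (fun y' z' g' => forall e : y' = y,
  Arrow (g ∘ f) = Arrow (eq_rect y' (fun t => Hom t z') g' y e ∘ f)) _ y z' g' eg
  eq_refl.
apply: H => e.
by rewrite (proof_irrelevance _ e eq_refl).
Qed.

Lemma is_iso_arrow (C : Category) (x y x' y' : C) (f : Hom x y) (f' : Hom x' y') :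
  Arrow f = Arrow f' -> is_iso f -> is_iso f'.
Proof. by move=> e Hf; move: x' y' f' e; apply: arrow_elim. Qed.

Record Functor (C D : Category) := {
  fobj :> C -> D;
  fmap : forall x y, Hom x y -> Hom (fobj x) (fobj y);
  fmap_id : forall x, fmap (idc x) = idc (fobj x);
  fmap_comp : forall x y z (g : Hom y z) (f : Hom x y),
    fmap (g ∘ f) = fmap g ∘ fmap f
}.
Arguments fmap {C D} _ {x y}.

Lemma functor_eq (C D : Category) (F G : Functor C D)
    (Hob : forall x, F x = G x) :
  (forall x y (f : Hom x y), Arrow (fmap F f) = Arrow (fmap G f)) -> F = G.
Proof.
case: F Hob => Fo Fm Fi Fc; case: G => Go Gm Gi Gc /= Hob.
have e : Fo = Go by apply: functional_extensionality.
subst Go => H.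
have e : Fm = Gm.
  apply: functional_extensionality_dep => x.
  apply: functional_extensionality_dep => y.
  apply: functional_extensionality => f.
  exact: arrow_inj (H x y f).
subst Gm.
by rewrite (proof_irrelevance _ Fi Gi) (proof_irrelevance _ Fc Gc).
Qed.

Definition idF (C : Category) : Functor C C.
Proof. by refine {| fobj := fun x => x; fmap := fun _ _ f => f |}. Defined.

Definition compF (C D E : Category) (G : Functor D E) (F : Functor C D) :
  Functor C E.
Proof.
refine {| fobj := fun x => G (F x); fmap := fun _ _ f => fmap G (fmap F f) |}.
- by move=> x; rewrite !fmap_id.
- by move=> x y z g f; rewrite !fmap_comp.
Defined.
Notation "G ⊙ F" := (compF G F) (at level 40, left associativity) : cat_scope.

Record NatTrans (C D : Category) (F G : Functor C D) := {
  ntc :> forall x, Hom (F x) (G x);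
  nt_nat : forall x y (f : Hom x y), ntc y ∘ fmap F f = fmap G f ∘ ntc x
}.

Lemma nt_eq (C D : Category) (F G : Functor C D) (s t : NatTrans F G) :
  (forall x, s x = t x) -> s = t.
Proof.
case: s => s Hs; case: t => t Ht /= e.
have E : s = t by apply: functional_extensionality_dep.
by subst t; rewrite (proof_irrelevance _ Hs Ht).
Qed.

Definition idNT (C D : Category) (F : Functor C D) : NatTrans F F.
Proof.
refine {| ntc := fun x => idc (F x) |}.
by move=> x y f; rewrite comp_idl comp_idr.
Defined.

Definition vcomp (C D : Category) (F G H : Functor C D)
  (t : NatTrans G H) (s : NatTrans F G) : NatTrans F H.
Proof.
refine {| ntc := fun x => t x ∘ s x |}.
by move=> x y f; rewrite -comp_assoc nt_nat !comp_assoc nt_nat.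
Defined.

Definition whiskL (C D E : Category) (K : Functor D E) (F G : Functor C D)
  (s : NatTrans F G) : NatTrans (K ⊙ F) (K ⊙ G).
Proof.
refine (@Build_NatTrans C E (K ⊙ F) (K ⊙ G) (fun x => fmap K (s x)) _).
by move=> x y f /=; rewrite -!fmap_comp nt_nat.
Defined.

Definition whiskR (B C D : Category) (F G : Functor C D) (s : NatTrans F G)
  (K : Functor B C) : NatTrans (F ⊙ K) (G ⊙ K).
Proof.
refine (@Build_NatTrans B D (F ⊙ K) (G ⊙ K) (fun x => s (K x)) _).
by move=> x y f /=; rewrite nt_nat.
Defined.

Definition nat_iso (C D : Category) (F G : Functor C D) : Prop :=
  exists t : NatTrans F G, forall x, is_iso (t x).

Definition is_equivalence (C D : Category) (F : Functor C D) : Prop :=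
  exists G : Functor D C, nat_iso (G ⊙ F) (idF C) /\ nat_iso (F ⊙ G) (idF D).

Definition is_isoF (C D : Category) (F : Functor C D) : Prop :=
  exists G : Functor D C, G ⊙ F = idF C /\ F ⊙ G = idF D.

Record Adjunction (C D : Category) (L : Functor C D) (R : Functor D C) := {
  adj_unit : NatTrans (idF C) (R ⊙ L);
  adj_counit : NatTrans (L ⊙ R) (idF D);
  adj_tri1 : forall x, adj_counit (L x) ∘ fmap L (adj_unit x) = idc (L x);
  adj_tri2 : forall y, fmap R (adj_counit y) ∘ adj_unit (R y) = idc (R y)
}.

Definition FunCat (C D : Category) : Category.
Proof.
refine {| Ob := Functor C D; Hom := @NatTrans C D; idc := @idNT C D;
          comp := @vcomp C D |}.
- by move=> F G s; apply: nt_eq => x /=; rewrite comp_idl.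
- by move=> F G s; apply: nt_eq => x /=; rewrite comp_idr.
- by move=> F G H K u t s; apply: nt_eq => x /=; rewrite comp_assoc.
Defined.

Definition conservative (C D : Category) (F : Functor C D) : Prop :=
  forall (x y : C) (f : Hom x y), is_iso (fmap F f) -> is_iso f.

Definition connected (C : Category) : Prop :=
  inhabited C /\
  forall x y : C, clos_refl_sym_trans C (fun a b => inhabited (Hom a b)) x y.

Section Opfibration.
Context (C B : Category) (F : Functor C B).

Definition cocartesian_arrow (x y : C) (u : Hom x y) : Prop :=
  forall (z : C) (w : Hom x z) (g : Hom (F y) (F z)),
    fmap F w = g ∘ fmap F u ->
    exists! v : Hom y z, fmap F v = g /\ v ∘ u = w.

Definition opfibration : Prop :=
  forall (x : C) (b : B) (f : Hom (F x) b),
    exists (y : C) (u : Hom x y),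
      Arrow (fmap F u) = Arrow f /\ cocartesian_arrow u.
End Opfibration.

Definition EmptyCat : Category.
Proof.
refine {| Ob := Empty_set; Hom := fun _ _ => unit; idc := fun _ => tt;
          comp := fun _ _ _ _ _ => tt |}; by move=> [].
Defined.

Definition PtCat : Category.
Proof.
refine {| Ob := unit; Hom := fun _ _ => unit; idc := fun _ => tt;
          comp := fun _ _ _ _ _ => tt |}; by move=> ? ? [].
Defined.

Definition ArrowCat : Category.
Proof.
unshelve refine {| Ob := bool; Hom := fun x y => is_true (implb x y) |}.
- by case.
- by case; case; case.
- by move=> x y f; apply: proof_irrelevance.
- by move=> x y f; apply: proof_irrelevance.
- by move=> w x y z h g f; apply: proof_irrelevance.
Defined.

Definition SumCat (A B : Category) : Category.
Proof.
refine {| Ob := (A + B)%type;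
          Hom := fun x y => match x, y with
                 | inl a, inl a' => Hom a a'
                 | inr b, inr b' => Hom b b'
                 | _, _ => Empty_set
                 end;
          idc := fun x => match x with inl a => idc a | inr b => idc b end;
          comp := fun x y z => match x, y, z with
                  | inl a, inl b, inl c => fun g f => g ∘ f
                  | inr a, inr b, inr c => fun g f => g ∘ f
                  | inl _, inl _, inr _ => fun g _ => match g with end
                  | inr _, inr _, inl _ => fun g _ => match g with end
                  | inl _, inr _, _ => fun _ f => match f with end
                  | inr _, inl _, _ => fun _ f => match f with end
                  end |}.
- by move=> [a|a] [b|b] f //=; rewrite comp_idl.
- by move=> [a|a] [b|b] f //=; rewrite comp_idr.
- by move=> [a|a] [b|b] [c|c] [d|d] h g f //=; rewrite comp_assoc.
Defined.

Definition inlF (A B : Category) : Functor A (SumCat A B).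
Proof.
by refine (@Build_Functor A (SumCat A B) (@inl A B) (fun _ _ f => f) _ _).
Defined.
Definition inrF (A B : Category) : Functor B (SumCat A B).
Proof.
by refine (@Build_Functor B (SumCat A B) (@inr A B) (fun _ _ f => f) _ _).
Defined.

Definition copairF (A B C : Category) (F : Functor A C) (G : Functor B C) :
  Functor (SumCat A B) C.
Proof.
refine (@Build_Functor (SumCat A B) C
  (fun x => match x with inl a => F a | inr b => G b end)
  (fun x y => match x, y with
     | inl _, inl _ => fun f => fmap F f
     | inr _, inr _ => fun f => fmap G f
     | inl _, inr _ => fun f => match f with end
     | inr _, inl _ => fun f => match f with end
     end) _ _).
- by case=> a /=; rewrite fmap_id.
- by move=> [a|a] [b|b] [c|c] g f //=; rewrite fmap_comp.
Defined.

Definition ProdCat (A B : Category) : Category.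
Proof.
refine {| Ob := (A * B)%type;
          Hom := fun x y => (Hom (fst x) (fst y) * Hom (snd x) (snd y))%type;
          idc := fun x => (idc (fst x), idc (snd x));
          comp := fun x y z g f => (fst g ∘ fst f, snd g ∘ snd f) |}.
- by move=> x y [f1 f2] /=; rewrite !comp_idl.
- by move=> x y [f1 f2] /=; rewrite !comp_idr.
- by move=> w x y z h g f /=; rewrite !comp_assoc.
Defined.

Definition pairF (C A B : Category) (F : Functor C A) (G : Functor C B) :
  Functor C (ProdCat A B).
Proof.
refine (@Build_Functor C (ProdCat A B) (fun x => (F x, G x))
          (fun x y f => (fmap F f, fmap G f)) _ _).
- by move=> x; rewrite !fmap_id.
- by move=> x y z g f; rewrite !fmap_comp.
Defined.

Definition bangE (C : Category) : Functor EmptyCat C.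
Proof.
by refine (@Build_Functor EmptyCat C (fun x => match x with end)
          (fun x _ _ => match x with end) _ _); case.
Defined.

Definition bang (C : Category) : Functor C PtCat.
Proof.
by refine (@Build_Functor C PtCat (fun _ => tt) (fun _ _ _ => tt) _ _).
Defined.

Definition pointF (C : Category) (x : C) : Functor PtCat C.
Proof.
refine (@Build_Functor PtCat C (fun _ => x) (fun _ _ _ => idc x) _ _) => //.
by move=> *; rewrite comp_idl.
Defined.

Definition pointNT (C : Category) (x y : C) (f : Hom x y) :
  NatTrans (pointF x) (pointF y).
Proof.
refine (@Build_NatTrans PtCat C (pointF x) (pointF y) (fun _ => f) _).
by move=> ? ? ? /=; rewrite comp_idl comp_idr.
Defined.

Definition FullSub (C : Category) (P : C -> Prop) : Category.
Proof.
refine {| Ob := {x : C | P x};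
          Hom := fun x y => Hom (proj1_sig x) (proj1_sig y);
          idc := fun x => idc (proj1_sig x);
          comp := fun x y z g f => g ∘ f |}.
- by move=> x y f; rewrite comp_idl.
- by move=> x y f; rewrite comp_idr.
- by move=> w x y z h g f; rewrite comp_assoc.
Defined.

Definition inclF (C : Category) (P : C -> Prop) : Functor (FullSub P) C.
Proof.
by refine (@Build_Functor (FullSub P) C (fun x => proj1_sig x)
          (fun _ _ f => f) _ _).
Defined.

Definition corestrict (B C : Category) (P : C -> Prop) (F : Functor B C)
  (H : forall x, P (F x)) : Functor B (FullSub P).
Proof.
refine (@Build_Functor B (FullSub P) (fun x => exist _ (F x) (H x))
          (fun _ _ f => fmap F f) _ _).
- by move=> x; exact: fmap_id.
- by move=> *; exact: fmap_comp.
Defined.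

Section Comma.
Context (A B C : Category) (F : Functor A C) (G : Functor B C).

Record comma_ob := CommaOb {
  com_l : A; com_r : B; com_arr : Hom (F com_l) (G com_r)
}.

Definition comma_hom (x y : comma_ob) : Type :=
  {u : Hom (com_l x) (com_l y) * Hom (com_r x) (com_r y)
     | com_arr y ∘ fmap F (fst u) = fmap G (snd u) ∘ com_arr x}.

Lemma comma_hom_eq (x y : comma_ob) (u v : comma_hom x y) :
  proj1_sig u = proj1_sig v -> u = v.
Proof.
case: u v => u Hu [v Hv] /= e; subst v.
by rewrite (proof_irrelevance _ Hu Hv).
Qed.

Definition Comma : Category.
Proof.
unshelve refine {| Ob := comma_ob; Hom := comma_hom |}.
- by move=> x; exists (idc _, idc _); rewrite /= !fmap_id comp_idl comp_idr.
- move=> x y z [v Hv] [u Hu].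
  exists (fst v ∘ fst u, snd v ∘ snd u).
  by rewrite /= !fmap_comp comp_assoc Hv -comp_assoc Hu comp_assoc.
- by move=> x y [[u1 u2] Hu]; apply: comma_hom_eq; rewrite /= !comp_idl.
- by move=> x y [[u1 u2] Hu]; apply: comma_hom_eq; rewrite /= !comp_idr.
- move=> w x y z [u Hu] [v Hv] [t Ht]; apply: comma_hom_eq.
  by rewrite /= !comp_assoc.
Defined.

Definition comma_fst : Functor Comma A.
Proof.
refine (@Build_Functor Comma A com_l (fun _ _ u => fst (proj1_sig u)) _ _) => //.
by move=> x y z [g Hg] [f Hf].
Defined.

Definition comma_snd : Functor Comma B.
Proof.
refine (@Build_Functor Comma B com_r (fun _ _ u => snd (proj1_sig u)) _ _) => //.
by move=> x y z [g Hg] [f Hf].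
Defined.

Definition comma_nt : NatTrans (F ⊙ comma_fst) (G ⊙ comma_snd).
Proof.
refine (@Build_NatTrans Comma C (F ⊙ comma_fst) (G ⊙ comma_snd) com_arr _).
by move=> x y [u Hu].
Defined.

Definition comma_lift (X : Category) (a : Functor X A) (b : Functor X B)
  (t : NatTrans (F ⊙ a) (G ⊙ b)) : Functor X Comma.
Proof.
refine (@Build_Functor X Comma (fun x => CommaOb (t x))
  (fun x y f => exist _ (fmap a f, fmap b f) (nt_nat t f)) _ _).
- by move=> x; apply: comma_hom_eq; rewrite /= !fmap_id.
- by move=> x y z g f; apply: comma_hom_eq; rewrite /= !fmap_comp.
Defined.
End Comma.

Section FibreProduct.
Context (A B C : Category) (F : Functor A C) (G : Functor B C).

Definition fp_ob : Type := {x : A * B | F (fst x) = G (snd x)}.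

Definition fp_hom (x y : fp_ob) : Type :=
  {u : Hom (fst (proj1_sig x)) (fst (proj1_sig y)) *
       Hom (snd (proj1_sig x)) (snd (proj1_sig y))
     | Arrow (fmap F (fst u)) = Arrow (fmap G (snd u))}.

Lemma fp_hom_eq (x y : fp_ob) (u v : fp_hom x y) :
  proj1_sig u = proj1_sig v -> u = v.
Proof.
case: u v => u Hu [v Hv] /= e; subst v.
by rewrite (proof_irrelevance _ Hu Hv).
Qed.

Definition FibProd : Category.
Proof.
unshelve refine {| Ob := fp_ob; Hom := fp_hom |}.
- by move=> [x e]; exists (idc _, idc _); rewrite /= !fmap_id e.
- move=> x y z [v Hv] [u Hu].
  exists (fst v ∘ fst u, snd v ∘ snd u).
  by rewrite /= !fmap_comp; apply: arrow_comp.
- by move=> [x ex] [y ey] [[u1 u2] Hu]; apply: fp_hom_eq; rewrite /= !comp_idl.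
- by move=> [x ex] [y ey] [[u1 u2] Hu]; apply: fp_hom_eq; rewrite /= !comp_idr.
- move=> w x y z [u Hu] [v Hv] [t Ht]; apply: fp_hom_eq.
  by rewrite /= !comp_assoc.
Defined.
End FibreProduct.

Section FibreCategory.
Context (C B : Category) (F : Functor C B).

Definition fc_hom (b : B) (x y : {x : C | F x = b}) : Type :=
  {u : Hom (proj1_sig x) (proj1_sig y) | Arrow (fmap F u) = Arrow (idc b)}.

Lemma fc_hom_eq (b : B) (x y : {x : C | F x = b}) (u v : fc_hom x y) :
  proj1_sig u = proj1_sig v -> u = v.
Proof.
case: u v => u Hu [v Hv] /= e; subst v.
by rewrite (proof_irrelevance _ Hu Hv).
Qed.

Definition FibCat (b : B) : Category.
Proof.
unshelve refine {| Ob := {x : C | F x = b}; Hom := @fc_hom b |}.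
- by move=> [x e]; exists (idc _); rewrite /= fmap_id e.
- move=> x y z [v Hv] [u Hu]; exists (v ∘ u).
  rewrite fmap_comp -(comp_idl (idc b)); exact: arrow_comp.
- by move=> [x ex] [y ey] [u Hu]; apply: fc_hom_eq; rewrite /= comp_idl.
- by move=> [x ex] [y ey] [u Hu]; apply: fc_hom_eq; rewrite /= comp_idr.
- move=> w x y z [u Hu] [v Hv] [t Ht]; apply: fc_hom_eq.
  by rewrite /= !comp_assoc.
Defined.
End FibreCategory.

Lemma arrow_fmap (C D : Category) (F : Functor C D) (x y x' y' : C)
    (f : Hom x y) (f' : Hom x' y') :
  Arrow f = Arrow f' -> Arrow (fmap F f) = Arrow (fmap F f').
Proof. by move=> e; move: x' y' f' e; apply: arrow_elim. Qed.

Lemma fmap_arrow_eq (C D : Category) (F G : Functor C D) (x y : C) (f : Hom x y) :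
  F = G -> Arrow (fmap F f) = Arrow (fmap G f).
Proof. by move=> ->. Qed.

Section FibreMap.
Context (C B C' B' : Category) (F : Functor C B) (F' : Functor C' B').
Context (G : Functor C C') (H : Functor B B') (sq : F' ⊙ G = H ⊙ F).
Context (b : B) (b' : B') (e : H b = b').

Definition fib_map : Functor (FibCat F b) (FibCat F' b').
Proof.
unshelve refine (@Build_Functor (FibCat F b) (FibCat F' b')
  (fun x => exist _ (G (proj1_sig x)) _)
  (fun x y u => exist _ (fmap G (proj1_sig u)) _) _ _).
- have := f_equal (fun K : Functor C B' => K (proj1_sig x)) sq.
  by rewrite /= (proj2_sig x) e.
- change (Arrow (fmap (F' ⊙ G) (proj1_sig u)) = Arrow (idc b')).
  rewrite (fmap_arrow_eq (proj1_sig u) sq) /= (arrow_fmap H (proj2_sig u)).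
  by rewrite fmap_id e.
- by move=> [x ex]; apply: fc_hom_eq; rewrite /= fmap_id.
- by move=> x y z [g Hg] [f Hf]; apply: fc_hom_eq; rewrite /= fmap_comp.
Defined.
End FibreMap.

Definition fstF (A B : Category) : Functor (ProdCat A B) A.
Proof.
by refine (@Build_Functor (ProdCat A B) A fst (fun _ _ u => fst u) _ _).
Defined.
Definition sndF (A B : Category) : Functor (ProdCat A B) B.
Proof.
by refine (@Build_Functor (ProdCat A B) B snd (fun _ _ u => snd u) _ _).
Defined.

Fixpoint ProdFam (T : Type) (A : T -> Category) (l : list T) : Category :=
  match l with
  | nil => PtCat
  | t :: l' => ProdCat (A t) (ProdFam A l')
  end.

Fixpoint prodF (T : Type) (A B : T -> Category)
  (F : forall t, Functor (A t) (B t)) (l : list T) :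
  Functor (ProdFam A l) (ProdFam B l) :=
  match l return Functor (ProdFam A l) (ProdFam B l) with
  | nil => idF PtCat
  | t :: l' => pairF (F t ⊙ fstF _ _) (prodF F l' ⊙ sndF _ _)
  end.

Fixpoint prodF_along (T T' : Type) (h : T -> T') (A : T -> Category)
  (B : T' -> Category) (F : forall t, Functor (A t) (B (h t))) (l : list T) :
  Functor (ProdFam A l) (ProdFam B (map h l)) :=
  match l return Functor (ProdFam A l) (ProdFam B (map h l)) with
  | nil => idF PtCat
  | t :: l' => pairF (F t ⊙ fstF _ _) (prodF_along F l' ⊙ sndF _ _)
  end.

(* [mcomp Γ1 Γ2 _ _ g f] plugs [f] into the slot of [g] between Γ1 and Γ2.  The
   two source lists involved are given up to propositional equality, so that
   the laws hold without transports along associativity of [++]. *)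
Unset Implicit Arguments.
Record Multicategory := {
  mob :> Type;
  mhom : list mob -> mob -> Type;
  mid : forall x, mhom [x] x;
  mcomp : forall (Γ1 Γ2 : list mob) {Γ Δ Γ' : list mob} {y z : mob},
    Γ = Γ1 ++ y :: Γ2 -> Γ' = Γ1 ++ Δ ++ Γ2 ->
    mhom Γ z -> mhom Δ y -> mhom Γ' z;
  mcomp_idl : forall (Δ : list mob) (y : mob) (f : mhom Δ y)
    (e : [y] = [] ++ y :: []) (e' : Δ = [] ++ Δ ++ []),
    mcomp [] [] e e' (mid y) f = f;
  mcomp_idr : forall (Γ1 Γ2 Γ : list mob) (y z : mob) (g : mhom Γ z)
    (e : Γ = Γ1 ++ y :: Γ2) (e' : Γ = Γ1 ++ [y] ++ Γ2),
    mcomp Γ1 Γ2 e e' g (mid y) = g;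
  mcomp_assoc : forall (Γ1 Γ2 Γ Δ1 Δ2 Δ Θ Γ' Δ' Γ'' : list mob) (x y z : mob)
    (h : mhom Γ z) (g : mhom Δ y) (f : mhom Θ x)
    (e1 : Γ = Γ1 ++ y :: Γ2) (e2 : Γ' = Γ1 ++ Δ ++ Γ2)
    (e3 : Γ' = (Γ1 ++ Δ1) ++ x :: (Δ2 ++ Γ2))
    (e4 : Γ'' = (Γ1 ++ Δ1) ++ Θ ++ (Δ2 ++ Γ2))
    (e5 : Δ = Δ1 ++ x :: Δ2) (e6 : Δ' = Δ1 ++ Θ ++ Δ2)
    (e7 : Γ = Γ1 ++ y :: Γ2) (e8 : Γ'' = Γ1 ++ Δ' ++ Γ2),
    mcomp (Γ1 ++ Δ1) (Δ2 ++ Γ2) e3 e4 (mcomp Γ1 Γ2 e1 e2 h g) f =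
    mcomp Γ1 Γ2 e7 e8 h (mcomp Δ1 Δ2 e5 e6 g f);
  mcomp_swap : forall (Γ1 Γ2 Γ3 Γ Δ Θ Γ' Γ'' Γ''' : list mob) (x y z : mob)
    (h : mhom Γ z) (f : mhom Δ x) (g : mhom Θ y)
    (e1 : Γ = Γ1 ++ x :: (Γ2 ++ y :: Γ3))
    (e2 : Γ' = Γ1 ++ Δ ++ (Γ2 ++ y :: Γ3))
    (e3 : Γ' = (Γ1 ++ Δ ++ Γ2) ++ y :: Γ3)
    (e4 : Γ''' = (Γ1 ++ Δ ++ Γ2) ++ Θ ++ Γ3)
    (e5 : Γ = (Γ1 ++ x :: Γ2) ++ y :: Γ3)
    (e6 : Γ'' = (Γ1 ++ x :: Γ2) ++ Θ ++ Γ3)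
    (e7 : Γ'' = Γ1 ++ x :: (Γ2 ++ Θ ++ Γ3))
    (e8 : Γ''' = Γ1 ++ Δ ++ (Γ2 ++ Θ ++ Γ3)),
    mcomp (Γ1 ++ Δ ++ Γ2) Γ3 e3 e4 (mcomp Γ1 (Γ2 ++ y :: Γ3) e1 e2 h f) g =
    mcomp Γ1 (Γ2 ++ Θ ++ Γ3) e7 e8 (mcomp (Γ1 ++ x :: Γ2) Γ3 e5 e6 h g) f
}.
Set Implicit Arguments.
Arguments mhom {m}.
Arguments mid {m}.
Arguments mcomp {m} Γ1 Γ2 {Γ Δ Γ' y z}.

Record marrow (C : Multicategory) :=
  MArrow { msrc : list C; mtgt : C; marr : mhom msrc mtgt }.
Arguments MArrow {C msrc mtgt}.

Definition mcast (C : Multicategory) (Γ Γ' : list C) (z : C) (e : Γ = Γ') :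
  mhom Γ z -> mhom Γ' z :=
  match e in _ = Γ' return mhom Γ z -> mhom Γ' z with eq_refl => fun f => f end.

Definition mpost (C : Multicategory) (Γ : list C) (y z : C)
  (g : mhom [y] z) (f : mhom Γ y) : mhom Γ z :=
  mcomp [] [] eq_refl (eq_sym (app_nil_r Γ)) g f.

Fixpoint mhoms (C : Multicategory) (xs ys : list C) : Type :=
  match xs, ys with
  | nil, nil => unit
  | x :: xs', y :: ys' => (mhom [x] y * mhoms xs' ys')%type
  | _, _ => Empty_set
  end.

Fixpoint mpre_aux (C : Multicategory) (z : C) (xs ys : list C) :
  mhoms xs ys -> forall Γ0 Γ Γ' : list C, Γ = Γ0 ++ ys -> Γ' = Γ0 ++ xs ->
  mhom Γ z -> mhom Γ' z :=
  match xs, ys return mhoms xs ys -> forall Γ0 Γ Γ' : list C,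
    Γ = Γ0 ++ ys -> Γ' = Γ0 ++ xs -> mhom Γ z -> mhom Γ' z with
  | nil, nil => fun _ Γ0 Γ Γ' e e' => mcast (eq_trans e (eq_sym e'))
  | x :: xs', y :: ys' => fun us Γ0 Γ Γ' e e' f =>
      @mpre_aux C z xs' ys' (snd us) (Γ0 ++ [x]) _ _
        (app_assoc Γ0 [x] ys') (eq_trans e' (app_assoc Γ0 [x] xs'))
        (mcomp Γ0 ys' e eq_refl f (fst us))
  | nil, _ :: _ => fun us => match us with end
  | _ :: _, nil => fun us => match us with end
  end.

(* f ∘ (u_1, ..., u_n) for unary u_k *)
Definition mpre (C : Multicategory) (xs ys : list C) (z : C)
  (f : mhom ys z) (us : mhoms xs ys) : mhom xs z :=
  @mpre_aux C z xs ys us [] ys xs eq_refl eq_refl f.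

Definition und (C : Multicategory) : Category.
Proof.
refine {| Ob := C; Hom := fun x y => mhom [x] y; idc := @mid C;
  comp := fun x y z g f => @mcomp C [] [] [y] [x] [x] y z eq_refl eq_refl g f |}.
- by move=> x y f; apply: mcomp_idl.
- by move=> x y f; apply: mcomp_idr.
- by move=> w x y z h g f; symmetry; apply: (@mcomp_assoc C [] [] [y] [] []).
Defined.

Record MFunctor (C D : Multicategory) := {
  mfob :> C -> D;
  mfmap : forall (Γ : list C) (z : C), mhom Γ z -> mhom (map mfob Γ) (mfob z);
  mfmap_id : forall x, mfmap (mid x) = mid (mfob x);
  mfmap_comp : forall (Γ1 Γ2 Γ Δ Γ' : list C) (y z : C)
    (e : Γ = Γ1 ++ y :: Γ2) (e' : Γ' = Γ1 ++ Δ ++ Γ2)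
    (me : map mfob Γ = map mfob Γ1 ++ mfob y :: map mfob Γ2)
    (me' : map mfob Γ' = map mfob Γ1 ++ map mfob Δ ++ map mfob Γ2)
    (g : mhom Γ z) (f : mhom Δ y),
    mfmap (mcomp Γ1 Γ2 e e' g f) =
    mcomp (map mfob Γ1) (map mfob Γ2) me me' (mfmap g) (mfmap f)
}.
Arguments mfmap {C D} _ {Γ z}.

Lemma marrow_elim (C : Multicategory) (Γ : list C) (z : C) (f : mhom Γ z)
    (P : forall Γ' z', mhom Γ' z' -> Prop) :
  P Γ z f -> forall Γ' z' (g : mhom Γ' z'), MArrow f = MArrow g -> P Γ' z' g.
Proof.
move=> H Γ' z' g e.
exact: (match e in _ = a return P (msrc a) (mtgt a) (marr a)
        with eq_refl => H end).
Qed.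

Lemma marrow_inj (C : Multicategory) (Γ : list C) (z : C) (f g : mhom Γ z) :
  MArrow f = MArrow g -> f = g.
Proof.
move=> e.
have H := @marrow_elim C Γ z f (fun Γ' z' g => forall (ex : Γ' = Γ) (ey : z' = z),
  f = eq_rect Γ' (fun t => mhom t z) (eq_rect z' (mhom Γ') g z ey) Γ ex) _ Γ z g e
  eq_refl eq_refl.
apply: H => ex ey.
by rewrite (proof_irrelevance _ ex eq_refl) (proof_irrelevance _ ey eq_refl).
Qed.

Lemma mcast_arrow (C : Multicategory) (Γ Γ' : list C) (z : C) (e : Γ = Γ')
    (f : mhom Γ z) : MArrow (mcast e f) = MArrow f.
Proof. by case: Γ' / e. Qed.

Lemma mcomp_cast (C : Multicategory) (Γ1 Γ2 Γ Δ Γ' Γ1' Γ2' Γc Δc Γc' : list C)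
    (y z : C) (e : Γ = Γ1 ++ y :: Γ2) (e' : Γ' = Γ1 ++ Δ ++ Γ2)
    (g : mhom Γ z) (f : mhom Δ y) (h1 : Γ1 = Γ1') (h2 : Γ2 = Γ2') (h : Γ = Γc)
    (hd : Δ = Δc) (h' : Γ' = Γc')
    (ec : Γc = Γ1' ++ y :: Γ2') (ec' : Γc' = Γ1' ++ Δc ++ Γ2') :
  mcast h' (mcomp Γ1 Γ2 e e' g f) = mcomp Γ1' Γ2' ec ec' (mcast h g) (mcast hd f).
Proof.
subst => /=.
by rewrite (proof_irrelevance _ ec eq_refl) (proof_irrelevance _ ec' eq_refl).
Qed.

Lemma mfunctor_eq (C D : Multicategory) (F G : MFunctor C D)
    (Hob : forall x, F x = G x) :
  (forall Γ z (f : mhom Γ z), MArrow (mfmap F f) = MArrow (mfmap G f)) -> F = G.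
Proof.
case: F Hob => Fo Fm Fi Fc; case: G => Go Gm Gi Gc /= Hob.
have e : Fo = Go by apply: functional_extensionality.
subst Go => H.
have e : Fm = Gm.
  apply: functional_extensionality_dep => Γ.
  apply: functional_extensionality_dep => z.
  apply: functional_extensionality => f.
  exact: marrow_inj (H Γ z f).
subst Gm.
by rewrite (proof_irrelevance _ Fi Gi) (proof_irrelevance _ Fc Gc).
Qed.

Definition idM (C : Multicategory) : MFunctor C C.
Proof.
refine {| mfob := fun x : C => x;
          mfmap := fun Γ z f => mcast (eq_sym (map_id Γ)) f |}.
- by move=> x; apply: marrow_inj; rewrite mcast_arrow.
- by move=> *; apply: mcomp_cast; symmetry; apply: map_id.
Defined.

Definition compM (C D E : Multicategory) (G : MFunctor D E) (F : MFunctor C D) :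
  MFunctor C E.
Proof.
refine {| mfob := fun x : C => G (F x);
          mfmap := fun Γ z f => mcast (map_map F G Γ) (mfmap G (mfmap F f)) |}.
- move=> x; apply: marrow_inj.
  by rewrite mcast_arrow mfmap_id (mfmap_id G (F x)).
- move=> Γ1 Γ2 Γ Δ Γ' y z e e' me me' g f.
  have a1 : map F Γ = map F Γ1 ++ F y :: map F Γ2 by rewrite e map_app.
  have a2 : map F Γ' = map F Γ1 ++ map F Δ ++ map F Γ2
    by rewrite e' !map_app.
  rewrite (mfmap_comp e e' a1 a2).
  have b1 : map G (map F Γ) = map G (map F Γ1) ++ G (F y) :: map G (map F Γ2)
    by rewrite a1 map_app.
  have b2 : map G (map F Γ') =
      map G (map F Γ1) ++ map G (map F Δ) ++ map G (map F Γ2)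
    by rewrite a2 !map_app.
  rewrite (mfmap_comp a1 a2 b1 b2).
  by apply: mcomp_cast; apply: map_map.
Defined.
Notation "G ⊚ F" := (compM G F) (at level 40, left associativity) : cat_scope.

Definition undF (C D : Multicategory) (F : MFunctor C D) :
  Functor (und C) (und D).
Proof.
refine (@Build_Functor (und C) (und D) F (fun x y f => @mfmap C D F [x] y f) _ _).
- by move=> x; apply: mfmap_id.
- move=> x y z g f.
  exact: (@mfmap_comp C D F [] [] [y] [x] [x] y z eq_refl eq_refl eq_refl eq_refl
            g f).
Defined.

Lemma marrow_arrow (C : Multicategory) (x y x' y' : C) (f : mhom [x] y)
    (f' : mhom [x'] y') :
  MArrow f = MArrow f' -> @Arrow (und C) x y f = @Arrow (und C) x' y' f'.
Proof.
move=> e.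
pose P Γ z (g : @mhom C Γ z) := forall e : Γ = [hd x Γ],
  @Arrow (und C) x y f = @Arrow (und C) (hd x Γ) z (mcast e g).
have := @marrow_elim C [x] y f P _ [x'] y' f' e eq_refl; apply => e0 /=.
by rewrite (proof_irrelevance _ e0 eq_refl).
Qed.

Lemma arrow_marrow (C : Multicategory) (x y x' y' : C) (f : mhom [x] y)
    (f' : mhom [x'] y') :
  @Arrow (und C) x y f = @Arrow (und C) x' y' f' -> MArrow f = MArrow f'.
Proof.
move=> e.
exact: (@arrow_elim (und C) x y f (fun x' y' f' => MArrow f = MArrow f') _ x' y' f' e).
Qed.

Lemma undF_id (C : Multicategory) : undF (idM C) = idF (und C).
Proof.
apply: functor_eq => // x y f /=.
by apply: marrow_arrow; apply: mcast_arrow.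
Qed.

Lemma undF_comp (C D E : Multicategory) (G : MFunctor D E) (F : MFunctor C D) :
  undF (G ⊚ F) = undF G ⊙ undF F.
Proof.
apply: functor_eq => // x y f /=.
by apply: marrow_arrow; rewrite mcast_arrow.
Qed.

(* The components of a natural transformation of multifunctors are unary. *)
Fixpoint mcomponents (C D : Multicategory) (F G : C -> D)
  (t : forall x, mhom [F x] (G x)) (Γ : list C) : mhoms (map F Γ) (map G Γ) :=
  match Γ return mhoms (map F Γ) (map G Γ) with
  | nil => tt
  | x :: Γ' => (t x, mcomponents t Γ')
  end.

Record MNatTrans (C D : Multicategory) (F G : MFunctor C D) := {
  mntc :> forall x, mhom [F x] (G x);
  mnt_nat : forall (Γ : list C) (z : C) (f : mhom Γ z),
    mpost (mntc z) (mfmap F f) = mpre (mfmap G f) (mcomponents mntc Γ)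
}.

Definition m_nat_iso (C D : Multicategory) (F G : MFunctor C D) : Prop :=
  exists t : MNatTrans F G, forall x, @is_iso (und D) (F x) (G x) (t x).

Definition is_mequivalence (C D : Multicategory) (F : MFunctor C D) : Prop :=
  exists G : MFunctor D C, m_nat_iso (G ⊚ F) (idM C) /\ m_nat_iso (F ⊚ G) (idM D).

Lemma map_slot (A B : Type) (h : A -> B) (Γ1 Γ2 Γ : list A) (y : A) :
  Γ = Γ1 ++ y :: Γ2 -> map h Γ = map h Γ1 ++ h y :: map h Γ2.
Proof. by move=> ->; rewrite map_app. Qed.

Lemma map_plug (A B : Type) (h : A -> B) (Γ1 Δ Γ2 Γ : list A) :
  Γ = Γ1 ++ Δ ++ Γ2 -> map h Γ = map h Γ1 ++ map h Δ ++ map h Γ2.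
Proof. by move=> ->; rewrite !map_app. Qed.

Lemma mcomp_cast' (C : Multicategory) (Γ1 Γ2 Γ Δ Γ' Γ1' Γ2' : list C)
    (y z : C) (e : Γ = Γ1 ++ y :: Γ2) (e' : Γ' = Γ1 ++ Δ ++ Γ2)
    (g : mhom Γ z) (f : mhom Δ y) (h1 : Γ1 = Γ1') (h2 : Γ2 = Γ2')
    (ec : Γ = Γ1' ++ y :: Γ2') (ec' : Γ' = Γ1' ++ Δ ++ Γ2') :
  mcomp Γ1 Γ2 e e' g f = mcomp Γ1' Γ2' ec ec' g f.
Proof. exact: (mcomp_cast e e' g f h1 h2 eq_refl eq_refl eq_refl ec ec'). Qed.

Lemma mproj_assoc (A : Type) (C : Multicategory) (h : A -> C)
  (Γ1 Γ2 Γ Δ1 Δ2 Δ Θ Γ' Δ' Γ'' : list A) (x y : A) (z : C)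
  (k : mhom (map h Γ) z) (g : mhom (map h Δ) (h y)) (f : mhom (map h Θ) (h x))
  (e1 : Γ = Γ1 ++ y :: Γ2) (e2 : Γ' = Γ1 ++ Δ ++ Γ2)
  (e3 : Γ' = (Γ1 ++ Δ1) ++ x :: (Δ2 ++ Γ2))
  (e4 : Γ'' = (Γ1 ++ Δ1) ++ Θ ++ (Δ2 ++ Γ2))
  (e5 : Δ = Δ1 ++ x :: Δ2) (e6 : Δ' = Δ1 ++ Θ ++ Δ2)
  (e7 : Γ = Γ1 ++ y :: Γ2) (e8 : Γ'' = Γ1 ++ Δ' ++ Γ2) :
  mcomp (map h (Γ1 ++ Δ1)) (map h (Δ2 ++ Γ2)) (map_slot h e3) (map_plug h e4)
    (mcomp (map h Γ1) (map h Γ2) (map_slot h e1) (map_plug h e2) k g) f =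
  mcomp (map h Γ1) (map h Γ2) (map_slot h e7) (map_plug h e8) k
    (mcomp (map h Δ1) (map h Δ2) (map_slot h e5) (map_plug h e6) g f).
Proof.
have a3 : map h Γ' = (map h Γ1 ++ map h Δ1) ++ h x :: (map h Δ2 ++ map h Γ2)
  by rewrite e3 !map_app /= !map_app.
have a4 : map h Γ'' = (map h Γ1 ++ map h Δ1) ++ map h Θ ++ (map h Δ2 ++ map h Γ2)
  by rewrite e4 !map_app.
rewrite (mcomp_cast' (map_slot h e3) (map_plug h e4) _ f (map_app h Γ1 Δ1)
  (map_app h Δ2 Γ2) a3 a4).
exact: mcomp_assoc.
Qed.

Lemma mproj_swap (A : Type) (C : Multicategory) (h : A -> C)
  (Γ1 Γ2 Γ3 Γ Δ Θ Γ' Γ'' Γ''' : list A) (x y : A) (z : C)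
  (k : mhom (map h Γ) z) (f : mhom (map h Δ) (h x)) (g : mhom (map h Θ) (h y))
  (e1 : Γ = Γ1 ++ x :: (Γ2 ++ y :: Γ3))
  (e2 : Γ' = Γ1 ++ Δ ++ (Γ2 ++ y :: Γ3))
  (e3 : Γ' = (Γ1 ++ Δ ++ Γ2) ++ y :: Γ3)
  (e4 : Γ''' = (Γ1 ++ Δ ++ Γ2) ++ Θ ++ Γ3)
  (e5 : Γ = (Γ1 ++ x :: Γ2) ++ y :: Γ3)
  (e6 : Γ'' = (Γ1 ++ x :: Γ2) ++ Θ ++ Γ3)
  (e7 : Γ'' = Γ1 ++ x :: (Γ2 ++ Θ ++ Γ3))
  (e8 : Γ''' = Γ1 ++ Δ ++ (Γ2 ++ Θ ++ Γ3)) :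
  mcomp (map h (Γ1 ++ Δ ++ Γ2)) (map h Γ3) (map_slot h e3) (map_plug h e4)
    (mcomp (map h Γ1) (map h (Γ2 ++ y :: Γ3)) (map_slot h e1) (map_plug h e2) k f)
    g =
  mcomp (map h Γ1) (map h (Γ2 ++ Θ ++ Γ3)) (map_slot h e7) (map_plug h e8)
    (mcomp (map h (Γ1 ++ x :: Γ2)) (map h Γ3) (map_slot h e5) (map_plug h e6) k g)
    f.
Proof.
have m1 : map h (Γ1 ++ Δ ++ Γ2) = map h Γ1 ++ map h Δ ++ map h Γ2
  by rewrite !map_app.
have m2 : map h (Γ2 ++ y :: Γ3) = map h Γ2 ++ h y :: map h Γ3 by rewrite map_app.
have m3 : map h (Γ2 ++ Θ ++ Γ3) = map h Γ2 ++ map h Θ ++ map h Γ3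
  by rewrite !map_app.
have m4 : map h (Γ1 ++ x :: Γ2) = map h Γ1 ++ h x :: map h Γ2 by rewrite map_app.
have a1 := map_slot h e1; rewrite m2 in a1.
have a2 := map_plug h e2; rewrite m2 in a2.
have a3 := map_slot h e3; rewrite m1 in a3.
have a4 := map_plug h e4; rewrite m1 in a4.
have a5 := map_slot h e5; rewrite m4 in a5.
have a6 := map_plug h e6; rewrite m4 in a6.
have a7 := map_slot h e7; rewrite m3 in a7.
have a8 := map_plug h e8; rewrite m3 in a8.
rewrite (mcomp_cast' (map_slot h e3) (map_plug h e4) _ g m1 eq_refl a3 a4).
rewrite (mcomp_cast' (map_slot h e1) (map_plug h e2) k f eq_refl m2 a1 a2).
rewrite (mcomp_cast' (map_slot h e7) (map_plug h e8) _ f eq_refl m3 a7 a8).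
rewrite (mcomp_cast' (map_slot h e5) (map_plug h e6) k g m4 eq_refl a5 a6).
exact: mcomp_swap.
Qed.

Definition ProdM (A B : Multicategory) : Multicategory.
Proof.
refine {| mob := (A * B)%type;
  mhom := fun Γ z =>
    (mhom (map fst Γ) (fst z) * mhom (map snd Γ) (snd z))%type;
  mid := fun x => (mid (fst x), mid (snd x));
  mcomp := fun Γ1 Γ2 Γ Δ Γ' y z e e' g f =>
    (mcomp (map fst Γ1) (map fst Γ2) (map_slot fst e) (map_plug fst e')
       (fst g) (fst f),
     mcomp (map snd Γ1) (map snd Γ2) (map_slot snd e) (map_plug snd e')
       (snd g) (snd f)) |}.
- move=> Δ y [f1 f2] e e' /=; congr pair; exact: mcomp_idl.
- move=> Γ1 Γ2 Γ y z [g1 g2] e e' /=; congr pair; exact: mcomp_idr.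
- by move=> *; congr pair; apply: mproj_assoc.
- by move=> *; congr pair; apply: mproj_swap.
Defined.

Definition pairM (C A B : Multicategory) (F : MFunctor C A) (G : MFunctor C B) :
  MFunctor C (ProdM A B).
Proof.
refine (@Build_MFunctor C (ProdM A B) (fun x => (F x, G x)) (fun Γ z f =>
  (mcast (eq_sym (map_map (fun x => (F x, G x)) fst Γ)) (mfmap F f),
   mcast (eq_sym (map_map (fun x => (F x, G x)) snd Γ)) (mfmap G f))) _ _).
- move=> x; congr pair; apply: marrow_inj;
    by rewrite mcast_arrow mfmap_id.
- move=> Γ1 Γ2 Γ Δ Γ' y z e e' me me' g f; congr pair.
  + rewrite (mfmap_comp (m := F) e e' (map_slot F e) (map_plug F e')).
    by apply: mcomp_cast; symmetry; apply: map_map.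
  + rewrite (mfmap_comp (m := G) e e' (map_slot G e) (map_plug G e')).
    by apply: mcomp_cast; symmetry; apply: map_map.
Defined.

Notation "⌊ X ⌋" := (proj1_sig X) (format "⌊ X ⌋") : cat_scope.

Section Fibered.
Context (C D : Multicategory) (p : MFunctor C D).

Definition cocartesian (Es : list C) (F : C) (xi : mhom Es F) : Prop :=
  forall (G1 G2 : list C) (G : C)
    (g : mhom (map p G1 ++ p F :: map p G2) (p G))
    (h : mhom (G1 ++ Es ++ G2) G),
  mfmap p h =
    mcomp (map p G1) (map p G2) eq_refl (map_plug p eq_refl) g (mfmap p xi) ->
  exists! h' : mhom (G1 ++ F :: G2) G,
    mfmap p h' = mcast (eq_sym (map_slot p eq_refl)) g /\
    mcomp G1 G2 eq_refl eq_refl h' xi = h.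

(* Cartesian with respect to the slot between E1 and E2 *)
Definition cartesian (E1 : list C) (E : C) (E2 : list C) (F : C)
  (xi : mhom (E1 ++ E :: E2) F) : Prop :=
  forall (Gs : list C) (g : mhom (map p Gs) (p E)) (h : mhom (E1 ++ Gs ++ E2) F),
  mfmap p h =
    mcomp (map p E1) (map p E2) (map_slot p eq_refl) (map_plug p eq_refl)
      (mfmap p xi) g ->
  exists! h' : mhom Gs E,
    mfmap p h' = g /\ mcomp E1 E2 eq_refl eq_refl xi h' = h.

Definition Fibre (s : D) : Category := FibCat (undF p) s.

(* A value of the push-forward f_•(Es) *)
Record PushOb (Ss : list D) (T : D) (f : mhom Ss T) (Es : list C) := {
  po_ob : Fibre T;
  po_arr : mhom Es ⌊po_ob⌋;
  po_over : MArrow (mfmap p po_arr) = MArrow f;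
  po_cocart : cocartesian po_arr
}.

Definition opfibered : Prop :=
  forall (Ss : list D) (T : D) (f : mhom Ss T) (Es : list C),
    map p Es = Ss -> inhabited (PushOb f Es).

(* A value of the pull-back f^{•,i}(E1, E2; F) *)
Record PullOb (S1 : list D) (s : D) (S2 : list D) (T : D)
    (f : mhom (S1 ++ s :: S2) T) (E1 E2 : list C) (F : Fibre T) := {
  pb_ob : Fibre s;
  pb_arr : mhom (E1 ++ ⌊pb_ob⌋ :: E2) ⌊F⌋;
  pb_over : MArrow (mfmap p pb_arr) = MArrow f;
  pb_cart : cartesian pb_arr
}.

Definition fibered : Prop :=
  forall (S1 : list D) (s : D) (S2 : list D) (T : D)
    (f : mhom (S1 ++ s :: S2) T) (E1 E2 : list C) (F : Fibre T),
    map p E1 = S1 -> map p E2 = S2 -> inhabited (PullOb f E1 E2 F).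

Fixpoint fib_obs (Ss : list D) : ProdFam Fibre Ss -> list C :=
  match Ss return ProdFam Fibre Ss -> list C with
  | nil => fun _ => nil
  | s :: Ss' => fun X => ⌊fst X⌋ :: fib_obs (snd X)
  end.

Fixpoint fib_homs (Ss : list D) :
  forall X Y : ProdFam Fibre Ss, Hom X Y -> mhoms (fib_obs X) (fib_obs Y) :=
  match Ss return forall X Y : ProdFam Fibre Ss,
    Hom X Y -> mhoms (fib_obs X) (fib_obs Y) with
  | nil => fun _ _ _ => tt
  | s :: Ss' => fun X Y u => (⌊fst u⌋, fib_homs (snd u))
  end.

(* A push-forward functor f_• : a choice of coCartesian morphisms over [f] with
   the functoriality it induces *)
Record PushFun (Ss : list D) (T : D) (f : mhom Ss T) := {
  pf_fun :> Functor (ProdFam Fibre Ss) (Fibre T);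
  pf_arr : forall X, mhom (fib_obs X) ⌊pf_fun X⌋;
  pf_over : forall X, MArrow (mfmap p (pf_arr X)) = MArrow f;
  pf_cocart : forall X, cocartesian (pf_arr X);
  pf_nat : forall (X Y : ProdFam Fibre Ss) (u : Hom X Y),
    mpost ⌊fmap pf_fun u⌋ (pf_arr X) = mpre (pf_arr Y) (fib_homs u)
}.
End Fibered.

Record DiagramCategory := {
  dia :> Category -> Prop;
  dia_empty : dia EmptyCat;
  dia_pt : dia PtCat;
  dia_arrow : dia ArrowCat;
  dia_sum : forall A B : Category, dia A -> dia B -> dia (SumCat A B);
  dia_fibprod : forall (A B C : Category) (F : Functor A C) (G : Functor B C),
    dia A -> dia B -> dia C -> dia (FibProd F G);
  dia_comma : forall (A B C : Category) (F : Functor A C) (G : Functor B C),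
    dia A -> dia B -> dia C -> dia (Comma F G)
}.

Record DiaOb (Dia : DiagramCategory) := {
  dcat :> Category;
  dcat_in : Dia dcat
}.

Section DiaConstructions.
Context {Dia : DiagramCategory}.

Definition dempty : DiaOb Dia := {| dcat_in := dia_empty Dia |}.
Definition dpt : DiaOb Dia := {| dcat_in := dia_pt Dia |}.
Definition dsum (I J : DiaOb Dia) : DiaOb Dia :=
  {| dcat_in := dia_sum (dcat_in I) (dcat_in J) |}.
Definition dcomma (I K J : DiaOb Dia) (a : Functor I J) (b : Functor K J) :
  DiaOb Dia :=
  {| dcat_in := dia_comma a b (dcat_in I) (dcat_in K) (dcat_in J) |}.
Definition dover (I J : DiaOb Dia) (a : Functor I J) (j : J) : DiaOb Dia :=
  @dcomma I dpt J a (pointF j).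
Definition dunder (I J : DiaOb Dia) (a : Functor I J) (j : J) : DiaOb Dia :=
  @dcomma dpt I J (pointF j) a.
End DiaConstructions.

(* Strict 2-functors, contravariant on functors and covariant on natural
   transformations; compatibility with horizontal composition is stated through
   the two whiskerings. *)
Record PreDerivator (Dia : DiagramCategory) := {
  pd_ob :> DiaOb Dia -> Category;
  pd_map : forall I J : DiaOb Dia, Functor I J -> Functor (pd_ob J) (pd_ob I);
  pd_2 : forall (I J : DiaOb Dia) (a b : Functor I J),
    NatTrans a b -> NatTrans (pd_map a) (pd_map b);
  pd_id : forall I : DiaOb Dia, pd_map (idF I) = idF (pd_ob I);
  pd_comp : forall (I J K : DiaOb Dia) (b : Functor J K) (a : Functor I J),
    @pd_map I K (b ⊙ a) = pd_map a ⊙ pd_map b;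
  pd_2_id : forall (I J : DiaOb Dia) (a : Functor I J) (X : pd_ob J),
    pd_2 (idNT a) X = idc (pd_map a X);
  pd_2_comp : forall (I J : DiaOb Dia) (a b c : Functor I J)
    (t : NatTrans b c) (s : NatTrans a b) (X : pd_ob J),
    pd_2 (vcomp t s) X = pd_2 t X ∘ pd_2 s X;
  pd_whiskL : forall (I J K : DiaOb Dia) (c : Functor J K) (a b : Functor I J)
    (s : NatTrans a b) (X : pd_ob K),
    Arrow (@pd_2 I K (c ⊙ a) (c ⊙ b) (whiskL c s) X) =
    Arrow (pd_2 s (pd_map c X));
  pd_whiskR : forall (H I J : DiaOb Dia) (a b : Functor I J) (s : NatTrans a b)
    (c : Functor H I) (X : pd_ob J),
    Arrow (@pd_2 H J (a ⊙ c) (b ⊙ c) (whiskR s c) X) =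
    Arrow (fmap (pd_map c) (pd_2 s X))
}.
Arguments pd_map {Dia} _ {I J}.
Arguments pd_2 {Dia} _ {I J a b}.

Lemma pointNT_id (C : Category) (x : C) : pointNT (idc x) = idNT (pointF x).
Proof. exact: nt_eq. Qed.

Lemma pointNT_comp (C : Category) (x y z : C) (g : Hom y z) (f : Hom x y) :
  pointNT (g ∘ f) = vcomp (pointNT g) (pointNT f).
Proof. exact: nt_eq. Qed.

Section PreDerivatorAxioms.
Context {Dia : DiagramCategory} (E : PreDerivator Dia).

Definition diagram (I : DiaOb Dia) (X : E I) : Functor I (E dpt).
Proof.
refine (@Build_Functor I (E dpt) (fun i => @pd_map Dia E dpt I (pointF i) X)
  (fun i j f => @pd_2 Dia E dpt I _ _ (pointNT f) X) _ _).
- by move=> i; rewrite pointNT_id pd_2_id.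
- by move=> i j k g f; rewrite pointNT_comp pd_2_comp.
Defined.

Definition diagramF (I : DiaOb Dia) : Functor (E I) (FunCat I (E dpt)).
Proof.
unshelve refine (@Build_Functor (E I) (FunCat I (E dpt)) (@diagram I)
  (fun X Y u => @Build_NatTrans _ _ (diagram X) (diagram Y)
     (fun i => fmap (@pd_map Dia E dpt I (pointF i)) u) _) _ _).
- by move=> i j f /=; rewrite nt_nat.
- by move=> X; apply: nt_eq => i /=; rewrite fmap_id.
- by move=> X Y Z v u; apply: nt_eq => i /=; rewrite fmap_comp.
Defined.

Definition pd_der1 : Prop :=
  (forall I J : DiaOb Dia, is_equivalence
     (pairF (@pd_map Dia E I (dsum I J) (inlF I J))
            (@pd_map Dia E J (dsum I J) (inrF I J)))) /\
  inhabited (E dempty).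

Definition pd_der2 : Prop := forall I : DiaOb Dia, conservative (diagramF I).

(* There is no base here, so Cartesian means invertible. *)
Definition pd_cart (K : DiaOb Dia) (B : Category) (pi : Functor K B) (X : E K) :
  Prop :=
  forall (k k' : K) (m : Hom k k'), is_identity (fmap pi m) ->
    is_iso (@pd_2 Dia E dpt K _ _ (pointNT m) X).

Lemma pd_cart_const (K : DiaOb Dia) (B : Category) (pi : Functor K B)
    (Y : E dpt) : pd_cart pi (@pd_map Dia E K dpt (bang K) Y).
Proof.
move=> k k' m _.
apply: is_iso_arrow
  (@pd_whiskL Dia E dpt K dpt (bang K) _ _ (pointNT m) Y) _.
pose s := whiskL (bang K) (pointNT m).
pose s' := @Build_NatTrans PtCat PtCat (bang K ⊙ pointF k') (bang K ⊙ pointF k)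
             (fun _ => tt) (fun _ _ _ => eq_refl).
have e1 : vcomp s' s = idNT _ by apply: nt_eq.
have e2 : vcomp s s' = idNT _ by apply: nt_eq.
exists (@pd_2 Dia E dpt dpt _ _ s' Y).
have c1 := @pd_2_comp Dia E dpt dpt _ _ _ s' s Y.
have c2 := @pd_2_comp Dia E dpt dpt _ _ _ s s' Y.
rewrite e1 pd_2_id in c1; rewrite e2 pd_2_id in c2.
by split; symmetry.
Qed.

Definition eval_at (K : DiaOb Dia) (B : Category) (pi : Functor K B) (n : K) :
  Functor (FullSub (pd_cart pi)) (E dpt) :=
  @pd_map Dia E dpt K (pointF n) ⊙ inclF (pd_cart pi).

Definition const_diag (K : DiaOb Dia) (B : Category) (pi : Functor K B) :
  Functor (E dpt) (FullSub (pd_cart pi)) :=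
  corestrict (F := @pd_map Dia E K dpt (bang K))
    (@pd_cart_const K B pi).
End PreDerivatorAxioms.

Record PreMultiDerivator (Dia : DiagramCategory) := {
  md_ob :> DiaOb Dia -> Multicategory;
  md_map : forall I J : DiaOb Dia, Functor I J -> MFunctor (md_ob J) (md_ob I);
  md_2 : forall (I J : DiaOb Dia) (a b : Functor I J),
    NatTrans a b -> MNatTrans (md_map a) (md_map b);
  md_id : forall I : DiaOb Dia, md_map (idF I) = idM (md_ob I);
  md_comp : forall (I J K : DiaOb Dia) (b : Functor J K) (a : Functor I J),
    @md_map I K (b ⊙ a) = md_map a ⊚ md_map b;
  md_2_id : forall (I J : DiaOb Dia) (a : Functor I J) (X : md_ob J),
    md_2 (idNT a) X = mid (md_map a X);
  md_2_comp : forall (I J : DiaOb Dia) (a b c : Functor I J)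
    (t : NatTrans b c) (s : NatTrans a b) (X : md_ob J),
    md_2 (vcomp t s) X = mpost (md_2 t X) (md_2 s X);
  md_whiskL : forall (I J K : DiaOb Dia) (c : Functor J K) (a b : Functor I J)
    (s : NatTrans a b) (X : md_ob K),
    MArrow (@md_2 I K (c ⊙ a) (c ⊙ b) (whiskL c s) X) =
    MArrow (md_2 s (md_map c X));
  md_whiskR : forall (H I J : DiaOb Dia) (a b : Functor I J) (s : NatTrans a b)
    (c : Functor H I) (X : md_ob J),
    MArrow (@md_2 H J (a ⊙ c) (b ⊙ c) (whiskR s c) X) =
    MArrow (mfmap (md_map c) (md_2 s X))
}.
Arguments md_map {Dia} _ {I J}.
Arguments md_2 {Dia} _ {I J a b}.

Lemma mpost_und (C : Multicategory) (x y z : C) (g : mhom [y] z) (f : mhom [x] y) :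
  mpost g f = @comp (und C) x y z g f.
Proof. exact: mcomp_cast'. Qed.

Definition undNT (C D : Multicategory) (F G : MFunctor C D) (t : MNatTrans F G) :
  NatTrans (undF F) (undF G).
Proof.
refine (@Build_NatTrans (und C) (und D) (undF F) (undF G) (fun x => t x) _).
move=> x y f /=.
have := mnt_nat t f; rewrite mpost_und /= => ->.
rewrite /mpre /= /mcast.
set e := eq_trans _ _; rewrite (proof_irrelevance _ e eq_refl).
exact: mcomp_cast'.
Defined.

Lemma arrow_undF (C D : Multicategory) (F : MFunctor C D) (x y : C)
    (f : mhom [x] y) (x' y' : D) (g : mhom [x'] y') :
  MArrow g = MArrow (mfmap F f) ->
  @Arrow (und D) x' y' g = Arrow (@fmap (und C) (und D) (undF F) x y f).
Proof. exact: marrow_arrow. Qed.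

Definition underlying (Dia : DiagramCategory) (D : PreMultiDerivator Dia) :
  PreDerivator Dia.
Proof.
refine {| pd_ob := fun I => und (D I);
          pd_map := fun I J a => undF (md_map D a);
          pd_2 := fun I J a b s => undNT (md_2 D s) |}.
- by move=> I; rewrite md_id undF_id.
- by move=> I J K b a; rewrite md_comp undF_comp.
- by move=> I J a X /=; rewrite md_2_id.
- by move=> I J a b c t s X /=; rewrite md_2_comp mpost_und.
- by move=> I J K c a b s X /=; apply: marrow_arrow; apply: md_whiskL.
- by move=> H I J a b s c X /=; apply: marrow_arrow; apply: md_whiskR.
Defined.

Definition der1 (Dia : DiagramCategory) (D : PreMultiDerivator Dia) : Prop :=
  (forall I J : DiaOb Dia, is_mequivalence
     (pairM (@md_map Dia D I (dsum I J) (inlF I J))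
            (@md_map Dia D J (dsum I J) (inrF I J)))) /\
  inhabited (D dempty).

Definition der2 (Dia : DiagramCategory) (D : PreMultiDerivator Dia) : Prop :=
  pd_der2 (underlying D).

Definition sub_dia (Dia' Dia : DiagramCategory) : Prop :=
  forall I : Category, Dia' I -> Dia I.

Definition dincl (Dia' Dia : DiagramCategory) (H : sub_dia Dia' Dia)
  (I : DiaOb Dia') : DiaOb Dia := {| dcat := I; dcat_in := H I (dcat_in I) |}.

Definition md_restrict (Dia' Dia : DiagramCategory) (H : sub_dia Dia' Dia)
  (S : PreMultiDerivator Dia) : PreMultiDerivator Dia'.
Proof.
refine {| md_ob := fun I => S (dincl H I);
  md_map := fun I J a => @md_map Dia S (dincl H I) (dincl H J) a;
  md_2 := fun I J a b s => @md_2 Dia S (dincl H I) (dincl H J) a b s |}.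
- by move=> I; apply: (md_id S (dincl H I)).
- by move=> I J K b a; apply: (@md_comp Dia S (dincl H I) (dincl H J) (dincl H K)).
- by move=> I J a X; apply: (@md_2_id Dia S (dincl H I) (dincl H J)).
- by move=> I J a b c t s X; apply: (@md_2_comp Dia S (dincl H I) (dincl H J)).
- move=> I J K c a b s X.
  exact: (@md_whiskL Dia S (dincl H I) (dincl H J) (dincl H K)).
- move=> L I J a b s c X.
  exact: (@md_whiskR Dia S (dincl H L) (dincl H I) (dincl H J)).
Defined.

Lemma md_comp_ob (Dia : DiagramCategory) (D : PreMultiDerivator Dia)
    (I J K : DiaOb Dia) (b : Functor J K) (a : Functor I J) (X : D K) :
  @md_map Dia D I K (b ⊙ a) X = md_map D a (md_map D b X).
Proof. by rewrite md_comp. Qed.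

Record MDMor (Dia : DiagramCategory) (D S : PreMultiDerivator Dia) := {
  mm :> forall I : DiaOb Dia, MFunctor (D I) (S I);
  mm_nat : forall (I J : DiaOb Dia) (a : Functor I J),
    mm I ⊚ md_map D a = md_map S a ⊚ mm J;
  mm_2 : forall (I J : DiaOb Dia) (a b : Functor I J) (s : NatTrans a b) (X : D J),
    MArrow (mfmap (mm I) (md_2 D s X)) = MArrow (md_2 S s (mm J X))
}.

Section FiberedMultiderivator.
Context {Dia : DiagramCategory} {D S : PreMultiDerivator Dia} (p : MDMor D S).

Definition Fib (I : DiaOb Dia) (s : S I) : Category := Fibre (p I) s.

Lemma mm_sq (I J : DiaOb Dia) (a : Functor I J) :
  undF (p I) ⊙ undF (md_map D a) = undF (md_map S a) ⊙ undF (p J).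
Proof. by rewrite -!undF_comp mm_nat. Qed.

(* α^* : D(J)_s -> D(I)_{α^* s}; [s'] is α^* s up to propositional equality. *)
Definition pull (I J : DiaOb Dia) (a : Functor I J) (s : S J) (s' : S I)
  (e : md_map S a s = s') : Functor (Fib s) (Fib s') := fib_map (mm_sq a) e.

Definition pull0 (I J : DiaOb Dia) (a : Functor I J) (s : S J) :
  Functor (Fib s) (Fib (md_map S a s)) := pull (a := a) eq_refl.

Definition ueq (I : DiaOb Dia) (X Y : D I) (e : X = Y) : @Hom (und (D I)) X Y :=
  @eqhom (und (D I)) X Y e.
Definition u2 (I J : DiaOb Dia) (a b : Functor I J) (t : NatTrans a b) (X : D J) :
  @Hom (und (D I)) (md_map D a X) (md_map D b X) := md_2 D t X.
Definition umap (I J : DiaOb Dia) (a : Functor I J) (X Y : D J)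
  (f : @Hom (und (D J)) X Y) :
  @Hom (und (D I)) (md_map D a X) (md_map D a Y) := fmap (undF (md_map D a)) f.

Definition fder0_left : Prop :=
  (forall I : DiaOb Dia, opfibered (p I)) /\
  (forall (I J : DiaOb Dia) (a : Functor I J) (Es : list (D J)) (F : D J)
     (xi : mhom Es F),
     cocartesian (p J) xi -> cocartesian (p I) (mfmap (md_map D a) xi)).

Definition fder3_left : Prop :=
  forall (I J : DiaOb Dia) (a : Functor I J) (s : S J),
  exists L : Functor (Fib (md_map S a s)) (Fib s),
    inhabited (Adjunction L (pull0 a s)).

(* In [fder4_*] and [fder5_*], "the natural map is an isomorphism" is expressed
   objectwise, for all choices of the adjoints, push-forwards and pull-backs
   involved: the morphism [phi] determined by the displayed equation, which
   unfolds the universal properties of these choices, is an isomorphism. *)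
Definition fder4_left : Prop :=
  forall (I J : DiaOb Dia) (a : Functor I J) (j : J) (s : S J),
  let K := dover a j in
  let iota : Functor K I := comma_fst a (pointF j) in
  let q : Functor K dpt := comma_snd a (pointF j) in
  let mu : NatTrans (a ⊙ iota) (pointF j ⊙ q) := comma_nt a (pointF j) in
  let jD : Functor dpt J := pointF j in
  let ajD : Functor K J := a ⊙ iota in
  let jqD : Functor K J := pointF j ⊙ q in
  forall (aL : Functor (Fib (md_map S a s)) (Fib s))
    (aA : Adjunction aL (pull0 a s))
    (qL : Functor (Fib (md_map S jqD s)) (Fib (md_map S jD s)))
    (qA : Adjunction qL
            (pull (a := q) (eq_sym (@md_comp_ob _ S K dpt J jD q s))))
    (X : Fib (md_map S a s))
    (W : PushOb (p K) (@md_2 _ S K J ajD jqD mu s) [md_map D iota ⌊X⌋]),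
  exists phi : Hom (qL (po_ob W)) (pull0 jD s (aL X)),
    umap q ⌊phi⌋ ∘ ⌊adj_unit qA (po_ob W)⌋ ∘ po_arr W
    = ueq (@md_comp_ob _ D K dpt J jD q ⌊aL X⌋) ∘ @u2 K J ajD jqD mu ⌊aL X⌋
      ∘ ueq (eq_sym (@md_comp_ob _ D K I J a iota ⌊aL X⌋))
      ∘ umap iota ⌊adj_unit aA X⌋
    /\ is_iso phi.

Definition fder5_left : Prop :=
  forall (I J : DiaOb Dia) (a : Functor I J), opfibration a ->
  forall (S1 : list (S J)) (s : S J) (S2 : list (S J)) (T : S J)
    (f : mhom (S1 ++ s :: S2) T)
    (sL : Functor (Fib (md_map S a s)) (Fib s)) (sA : Adjunction sL (pull0 a s))
    (TL : Functor (Fib (md_map S a T)) (Fib T)) (TA : Adjunction TL (pull0 a T))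
    (E1 E2 : list (D J)) (Y : Fib (md_map S a s)),
  map (p J) E1 = S1 -> map (p J) E2 = S2 ->
  forall (W : PushOb (p I) (mfmap (md_map S a) f)
                (map (md_map D a) E1 ++ ⌊Y⌋ :: map (md_map D a) E2))
    (Z : PushOb (p J) f (E1 ++ ⌊sL Y⌋ :: E2)),
  exists phi : Hom (TL (po_ob W)) (po_ob Z),
    mpost (umap a ⌊phi⌋ ∘ ⌊adj_unit TA (po_ob W)⌋) (po_arr W)
    = mcomp (map (md_map D a) E1) (map (md_map D a) E2)
        (map_slot _ eq_refl) eq_refl
        (mfmap (md_map D a) (po_arr Z)) ⌊adj_unit sA Y⌋
    /\ is_iso phi.

Record left_fibered_multiderivator : Prop := {
  lf_der1D : der1 D;
  lf_der2D : der2 D;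
  lf_der1S : der1 S;
  lf_der2S : der2 S;
  lf_fder0 : fder0_left;
  lf_fder3 : fder3_left;
  lf_fder4 : fder4_left;
  lf_fder5 : fder5_left
}.

Definition fder0_right : Prop :=
  (forall I : DiaOb Dia, fibered (p I)) /\
  (forall (I J : DiaOb Dia) (a : Functor I J), opfibration a ->
   forall (E1 : list (D J)) (E : D J) (E2 : list (D J)) (F : D J)
     (xi : mhom (E1 ++ E :: E2) F),
     cartesian (p J) xi ->
     cartesian (p I) (mcast (map_slot _ eq_refl) (mfmap (md_map D a) xi))).

Definition fder3_right : Prop :=
  forall (I J : DiaOb Dia) (a : Functor I J) (s : S J),
  exists R : Functor (Fib (md_map S a s)) (Fib s),
    inhabited (Adjunction (pull0 a s) R).

Definition fder4_right : Prop :=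
  forall (I J : DiaOb Dia) (a : Functor I J) (j : J) (s : S J),
  let K := dunder a j in
  let iota : Functor K I := comma_snd (pointF j) a in
  let q : Functor K dpt := comma_fst (pointF j) a in
  let mu : NatTrans (pointF j ⊙ q) (a ⊙ iota) := comma_nt (pointF j) a in
  let jD : Functor dpt J := pointF j in
  let ajD : Functor K J := a ⊙ iota in
  let jqD : Functor K J := pointF j ⊙ q in
  forall (aR : Functor (Fib (md_map S a s)) (Fib s))
    (aA : Adjunction (pull0 a s) aR)
    (qR : Functor (Fib (md_map S jqD s)) (Fib (md_map S jD s)))
    (qA : Adjunction
            (pull (a := q) (eq_sym (@md_comp_ob _ S K dpt J jD q s))) qR)
    (X : Fib (md_map S a s))
    (W : @PullOb _ _ (p K) [] _ [] _ (@md_2 _ S K J jqD ajD mu s) [] []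
           (pull (a := iota) (eq_sym (@md_comp_ob _ S K I J a iota s)) X)),
  exists phi : Hom (pull0 jD s (aR X)) (qR (pb_ob W)),
    (pb_arr W : @Hom (und (D K)) ⌊pb_ob W⌋ (md_map D iota ⌊X⌋))
      ∘ ⌊adj_counit qA (pb_ob W)⌋ ∘ umap q ⌊phi⌋
    = umap iota ⌊adj_counit aA X⌋
      ∘ ueq (@md_comp_ob _ D K I J a iota ⌊aR X⌋) ∘ @u2 K J jqD ajD mu ⌊aR X⌋
      ∘ ueq (eq_sym (@md_comp_ob _ D K dpt J jD q ⌊aR X⌋))
    /\ is_iso phi.

Definition fder5_right : Prop :=
  forall (I J : DiaOb Dia) (a : Functor I J)
    (S1 : list (S J)) (s : S J) (S2 : list (S J)) (T : S J)
    (f : mhom (S1 ++ s :: S2) T)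
    (sR : Functor (Fib (md_map S a s)) (Fib s)) (sA : Adjunction (pull0 a s) sR)
    (TR : Functor (Fib (md_map S a T)) (Fib T)) (TA : Adjunction (pull0 a T) TR)
    (E1 E2 : list (D J)) (Y : Fib (md_map S a T)),
  map (p J) E1 = S1 -> map (p J) E2 = S2 ->
  forall (V : PullOb f E1 E2 (TR Y))
    (W : PullOb (mcast (map_slot (md_map S a) eq_refl) (mfmap (md_map S a) f))
           (map (md_map D a) E1) (map (md_map D a) E2) Y),
  exists phi : Hom (pb_ob V) (sR (pb_ob W)),
    mcomp (map (md_map D a) E1) (map (md_map D a) E2)
      eq_refl (map_plug (Δ := [⌊pb_ob V⌋]) (md_map D a) eq_refl)
      (pb_arr W) (⌊adj_counit sA (pb_ob W)⌋ ∘ umap a ⌊phi⌋)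
    = mpost ⌊adj_counit TA Y⌋ (mfmap (md_map D a) (pb_arr V))
    /\ is_iso phi.

Record right_fibered_multiderivator : Prop := {
  rf_der1D : der1 D;
  rf_der2D : der2 D;
  rf_der1S : der1 S;
  rf_der2S : der2 S;
  rf_fder0 : fder0_right;
  rf_fder3 : fder3_right;
  rf_fder4 : fder4_right;
  rf_fder5 : fder5_right
}.

(* The transition morphisms are required to be Cartesian for D(·) -> S(·); over
   objects of the form π^* s they lie over identities. *)
Definition is_cart (K : DiaOb Dia) (B : Category) (pi : Functor K B) (X : D K) :
  Prop :=
  forall (k k' : K) (m : Hom k k'), is_identity (fmap pi m) ->
    @cartesian _ _ (p dpt) [] _ [] _ (@md_2 _ D dpt K _ _ (pointNT m) X).

Definition CartFib (K : DiaOb Dia) (B : Category) (pi : Functor K B) (s : S K) :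
  Category := FullSub (fun X : Fib s => is_cart pi ⌊X⌋).

Lemma md_2_arrow (I J : DiaOb Dia) (a b a' b' : Functor I J)
    (s : NatTrans a b) (s' : NatTrans a' b') (X : D J) :
  a = a' -> b = b' -> (forall i, Arrow (s i) = Arrow (s' i)) ->
  MArrow (md_2 D s X) = MArrow (md_2 D s' X).
Proof.
move=> ea eb; subst a' b' => H.
have -> // : s = s'.
by apply: nt_eq => i; apply: arrow_inj; apply: H.
Qed.

Lemma cartesian_arrow (I : DiaOb Dia) (X Y X' Y' : D I) (f : mhom [X] Y)
    (f' : mhom [X'] Y') :
  MArrow f = MArrow f' -> @cartesian _ _ (p I) [] X [] Y f ->
  @cartesian _ _ (p I) [] X' [] Y' f'.
Proof.
move=> /marrow_arrow e H.
exact: (@arrow_elim (und (D I)) X Y f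
  (fun X' Y' f' => @cartesian _ _ (p I) [] X' [] Y' f') H X' Y' f' e).
Qed.

Lemma is_cart_pull (K L : DiaOb Dia) (B B' : Category) (pi : Functor K B)
    (pi' : Functor L B') (a : Functor K L) (b : Functor B B') (X : D L) :
  pi' ⊙ a = b ⊙ pi -> is_cart pi' X -> is_cart pi (md_map D a X).
Proof.
move=> e H k k' m [z Hz].
have Hm : is_identity (fmap pi' (fmap a m)).
  exists (b z).
  have := fmap_arrow_eq m e; rewrite /= => ->.
  by rewrite (arrow_fmap b Hz) fmap_id.
apply: cartesian_arrow (H _ _ _ Hm).
rewrite -(@md_whiskL _ D dpt K L a _ _ (pointNT m) X).
have pe x : pointF (a x) = a ⊙ pointF x.
  by apply: functor_eq => // ? ? ? /=; rewrite fmap_id.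
by apply: (@md_2_arrow dpt L); rewrite ?pe.
Qed.

Definition cart_pull (K L : DiaOb Dia) (B B' : Category) (pi : Functor K B)
  (pi' : Functor L B') (a : Functor K L) (b : Functor B B')
  (sq : pi' ⊙ a = b ⊙ pi) (s : S L) (s' : S K) (e : md_map S a s = s') :
  Functor (CartFib pi' s) (CartFib pi s') :=
  @corestrict (CartFib pi' s) (Fib s') _ (pull e ⊙ inclF _)
    (fun X => is_cart_pull sq (proj2_sig X)).
End FiberedMultiderivator.

Record EnlFunctor (Dia Dia' : DiagramCategory) := {
  enl :> DiaOb Dia -> DiaOb Dia';
  enl_map : forall I J : DiaOb Dia, Functor I J -> Functor (enl I) (enl J);
  enl_id : forall I : DiaOb Dia, enl_map (idF I) = idF (enl I);
  enl_comp : forall (I J K : DiaOb Dia) (b : Functor J K) (a : Functor I J),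
    @enl_map I K (b ⊙ a) = enl_map b ⊙ enl_map a;
  enl_pi : forall I : DiaOb Dia, Functor (enl I) I;
  enl_pi_nat : forall (I J : DiaOb Dia) (a : Functor I J),
    enl_pi J ⊙ enl_map a = a ⊙ enl_pi I
}.
Arguments enl_map {Dia Dia'} _ {I J}.

Lemma eqhom_fmap (C D : Category) (F G : Functor C D) (e : F = G) (x y : C)
    (f : Hom x y) (ex : F x = G x) (ey : F y = G y) :
  eqhom ey ∘ fmap F f = fmap G f ∘ eqhom ex.
Proof.
move: ex ey; subst G => ex ey.
rewrite (proof_irrelevance _ ex eq_refl) (proof_irrelevance _ ey eq_refl) /=.
by rewrite comp_idl comp_idr.
Qed.

Section EnlAxioms.
Context {Dia Dia' : DiagramCategory} (N : EnlFunctor Dia Dia').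

Definition N1 : Prop := forall I : DiaOb Dia, Dia' (Comma (enl_pi N I) (enl_pi N I)).

(* The equalities N(I + J) = N(I) + N(J) and N(0) = 0 are read as: the
   canonical comparison functors are isomorphisms of categories. *)
Definition N2 : Prop :=
  (forall I J : DiaOb Dia, is_isoF
     (copairF (@enl_map _ _ N I (dsum I J) (inlF I J))
              (@enl_map _ _ N J (dsum I J) (inrF I J)))) /\
  is_isoF (bangE (N dempty)).

Definition N3 : Prop :=
  forall I : DiaOb Dia,
    (forall i : I, exists n : N I, enl_pi N I n = i) /\
    (forall (i i' : I) (f : Hom i i'), exists (n n' : N I) (g : Hom n n'),
       Arrow (fmap (enl_pi N I) g) = Arrow f) /\
    (forall i : I, connected (FibCat (enl_pi N I) i)).

Lemma enl_pi_ob (I J : DiaOb Dia) (a : Functor I J) (n : N I) :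
  enl_pi N J (enl_map N a n) = a (enl_pi N I n).
Proof. exact: (f_equal (fun F : Functor (N I) J => F n) (enl_pi_nat N a)). Qed.

Section N4Left.
Context (I J : DiaOb Dia) (a : Functor I J) (j : J).
Let K : DiaOb Dia := dover a j.
Let iota : Functor K I := comma_fst a (pointF j).

Definition N4_left_nt :
  NatTrans ((a ⊙ enl_pi N I) ⊙ enl_map N iota) (pointF j ⊙ bang (N K)).
Proof.
refine (@Build_NatTrans _ _
  ((a ⊙ enl_pi N I) ⊙ enl_map N iota) (pointF j ⊙ bang (N K))
  (fun n => com_arr (enl_pi N K n) ∘ fmap a (eqhom (enl_pi_ob iota n))) _).
move=> n n' f /=.
have H := eqhom_fmap (enl_pi_nat N iota) f (enl_pi_ob iota n) (enl_pi_ob iota n').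
rewrite -comp_assoc -fmap_comp.
rewrite [X in fmap a X]H fmap_comp /= comp_assoc.
by rewrite (proj2_sig (fmap (enl_pi N K) f)) /= comp_assoc.
Defined.

Definition N4_left_functor :
  Functor (N (dover a j)) (Comma (a ⊙ enl_pi N I) (pointF j)) :=
  comma_lift N4_left_nt.
End N4Left.

Definition N4_left : Prop :=
  forall (I J : DiaOb Dia) (a : Functor I J) (j : J),
    is_isoF (N4_left_functor a j).

Section N4Right.
Context (I J : DiaOb Dia) (a : Functor I J) (j : J).
Let K : DiaOb Dia := dunder a j.
Let iota : Functor K I := comma_snd (pointF j) a.

Definition N4_right_nt :
  NatTrans (pointF j ⊙ bang (N K)) ((a ⊙ enl_pi N I) ⊙ enl_map N iota).
Proof.
refine (@Build_NatTrans _ _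
  (pointF j ⊙ bang (N K)) ((a ⊙ enl_pi N I) ⊙ enl_map N iota)
  (fun n => fmap a (eqhom (eq_sym (enl_pi_ob iota n))) ∘ com_arr (enl_pi N K n)) _).
move=> n n' f /=.
have H := eqhom_fmap (eq_sym (enl_pi_nat N iota)) f
  (eq_sym (enl_pi_ob iota n)) (eq_sym (enl_pi_ob iota n')).
rewrite /= in H; rewrite comp_assoc -fmap_comp -H fmap_comp -!comp_assoc.
by rewrite -(proj2_sig (fmap (enl_pi N K) f)) /=.
Defined.

Definition N4_right_functor :
  Functor (N (dunder a j)) (Comma (pointF j) (a ⊙ enl_pi N I)) :=
  comma_lift N4_right_nt.
End N4Right.

Definition N4_right : Prop :=
  forall (I J : DiaOb Dia) (a : Functor I J) (j : J),
    is_isoF (N4_right_functor a j).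

(* [Arrow (adj_counit A Y) = Arrow (idc Y)] says that the counit is the
   equality n^* p^* Y = Y given by strict functoriality. *)
Definition N5_left : Prop :=
  forall E : PreDerivator Dia', pd_der1 E -> pd_der2 E ->
  forall (I : DiaOb Dia) (i : I), is_final i ->
  exists n : N I, enl_pi N I n = i /\
  exists A : Adjunction (eval_at E (enl_pi N I) n) (const_diag E (enl_pi N I)),
    (forall Y : E dpt, Arrow (adj_counit A Y) = Arrow (idc Y)) /\
    (forall X : FullSub (pd_cart (E := E) (enl_pi N I)),
       pd_cart (bang (N I)) ⌊X⌋ -> is_iso (adj_unit A X)).

Definition N5_right : Prop :=
  forall E : PreDerivator Dia', pd_der1 E -> pd_der2 E ->
  forall (I : DiaOb Dia) (i : I), is_initial i ->
  exists n : N I, enl_pi N I n = i /\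
  exists A : Adjunction (const_diag E (enl_pi N I)) (eval_at E (enl_pi N I) n),
    (forall Y : E dpt, Arrow (adj_unit A Y) = Arrow (idc Y)) /\
    (forall X : FullSub (pd_cart (E := E) (enl_pi N I)),
       pd_cart (bang (N I)) ⌊X⌋ -> is_iso (adj_counit A X)).
End EnlAxioms.

Section Enlargement.
Context {Dia' Dia : DiagramCategory} (H : sub_dia Dia' Dia).
Context (N : EnlFunctor Dia Dia').
Context (S : PreMultiDerivator Dia) (D : PreMultiDerivator Dia').
Context (p : MDMor D (md_restrict H S)).

Definition pi_star (I : DiaOb Dia) : MFunctor (S I) (md_restrict H S (N I)) :=
  @md_map Dia S (dincl H (N I)) I (enl_pi N I).

(* D(N(I))^{π_I-cart}_{π_I^* s} *)
Definition EnlFib (I : DiaOb Dia) (s : S I) : Category :=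
  CartFib p (enl_pi N I) (pi_star I s).

Lemma pi_star_map (I J : DiaOb Dia) (a : Functor I J) (s : S J) :
  md_map (md_restrict H S) (enl_map N a) (pi_star J s) =
  pi_star I (md_map S a s).
Proof.
rewrite /pi_star /=.
have := @md_comp_ob _ S (dincl H (N I)) (dincl H (N J)) J (enl_pi N J)
  (enl_map N a) s.
have := @md_comp_ob _ S (dincl H (N I)) I J a (enl_pi N I) s.
by move=> <- <-; congr (mfob (md_map S _) s); apply: enl_pi_nat.
Qed.

Definition enl_pull (I J : DiaOb Dia) (a : Functor I J) (s : S J) :
  Functor (EnlFib s) (EnlFib (md_map S a s)) :=
  cart_pull p (enl_pi_nat N a) (pi_star_map a s).

Definition enl_incl (I : DiaOb Dia) (ss : list (S I)) :
  Functor (ProdFam (@EnlFib I) ss)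
          (ProdFam (Fibre (p (N I))) (map (pi_star I) ss)) :=
  prodF_along (h := pi_star I) (B := Fibre (p (N I)))
    (fun s => inclF (fun X : Fib p (pi_star I s) => is_cart p (enl_pi N I) ⌊X⌋)) ss.

Definition push_preserves_cart (I : DiaOb Dia) (ss : list (S I)) (t : S I)
  (f : mhom ss t) (P : PushFun (p (N I)) (mfmap (pi_star I) f)) : Prop :=
  forall X : ProdFam (@EnlFib I) ss,
    is_cart p (enl_pi N I) ⌊P (enl_incl ss X)⌋.

Definition enl_push (I : DiaOb Dia) (ss : list (S I)) (t : S I)
  (f : mhom ss t) (P : PushFun (p (N I)) (mfmap (pi_star I) f))
  (h : push_preserves_cart P) :
  Functor (ProdFam (@EnlFib I) ss) (EnlFib t) :=
  @corestrict _ (Fib p (pi_star I t)) _ (pf_fun P ⊙ enl_incl ss) h.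
End Enlargement.

(* Main.v *)
(* Let Q = N(I) x_{/I} Nt(I), with projections pr1, pr2 and the canonical 2-cell
   mu : pi pr1 => pit pr2.  A Cartesian X over pi^* s and a Cartesian Y over
   pit^* s are made to correspond by the morphisms xi : pr1^* X -> pr2^* Y over
   S(mu) which are invertible at every point of Q where mu is an identity.
   Such a xi is universal in both variables, so that choosing one for each X
   yields an equivalence X |-> Y.

   Given X, the pair is Y = pr2_! S(mu)_. pr1^* X.  By (FDer4 left) its value at n
   is a colimit over Q x_{/Nt(I)} n; this category retracts, compatibly with a
   left adjoint, onto N(I) x_{/I} pit(n), which is N(I x_{/I} pit(n)) by
   (N4 left), and (N5 left), applied to the pre-derivator of fibres over
   constant objects, identifies the colimit with the value at a point over the
   final object.  The connected fibres (N3) spread invertibility from that point.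
   Given Y one argues dually with X = pr1_* S(mu)^. pr2^* Y; here evaluation at k
   preserves Cartesian morphisms since it factors through the opfibration
   k x_{/K} K -> K and the initial object of its source.  By (Der2) every xi as
   above is then universal.

   Pull-back along I -> J takes such a xi to such a xi, and the morphism induced
   on push-forwards by a family of such xi is again of this kind; both
   compatibilities follow by uniqueness. *)

Require Import Defs.
From Stdlib Require Import List ProofIrrelevance.
From Stdlib Require Import IndefiniteDescription.
From Stdlib Require Import ssreflect.
Import ListNotations.

Set Implicit Arguments.
Unset Strict Implicit.
Unset Printing Implicit Defensive.
Open Scope cat_scope.

(** * Isomorphisms and identities *)

(** (N5) concerns pre-derivators without a base and Cartesian objects only. The fibres over a
    constant object must therefore satisfy (Der1) themselves, which requires lifting isomorphisms
    from [S]; and the outcome is merely a bijection on vertical morphisms into, or out of, constant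
    objects, not an adjoint on a whole fibre. It still decides whether the unit or counit of the
    actual Kan extension is invertible at the chosen point: evaluation there retracts the constant
    diagram functor, so the Kan extension and the value at the point represent the same functor.
    Invertibility at the points where [mu] is an identity treats both sides alike and is tested
    pointwise, so it is visibly stable under pull-back and push-forward; universality, which yields
    uniqueness, is not. The Kan extensions produce one [xi] having both properties, with which all
    others are compared. The 2-functors are strict, but their equalities of objects are
    propositional. So morphisms are compared through [Arrow] and [MArrow], end points are changed by
    composing with [eqhom], and a morphism is vertical when its image in [S] is an identity. *)

Section Isomorphisms.
Context (C : Category).

Lemma iso_idc (x : C) : is_iso (idc x).
Proof. by exists (idc x); rewrite comp_idl. Qed.

Lemma iso_comp (x y z : C) (g : Hom y z) (f : Hom x y) :
  is_iso g -> is_iso f -> is_iso (g ∘ f).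
Proof.
move=> [g' [g1 g2]] [f' [f1 f2]]; exists (f' ∘ g'); split.
- by rewrite comp_assoc -(comp_assoc f') g1 comp_idr.
- by rewrite comp_assoc -(comp_assoc g) f2 comp_idr.
Qed.

Lemma iso_mono (x y z : C) (g : Hom y z) (f f' : Hom x y) :
  is_iso g -> g ∘ f = g ∘ f' -> f = f'.
Proof.
by move=> [h [h1 _]] e; rewrite -(comp_idl f) -(comp_idl f') -h1 -!comp_assoc e.
Qed.

Lemma iso_epi (x y z : C) (g g' : Hom y z) (f : Hom x y) :
  is_iso f -> g ∘ f = g' ∘ f -> g = g'.
Proof.
by move=> [h [_ h2]] e; rewrite -(comp_idr g) -(comp_idr g') -h2 !comp_assoc e.
Qed.

Lemma iso_cancel_l (x y z : C) (g : Hom y z) (f : Hom x y) :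
  is_iso g -> is_iso (g ∘ f) -> is_iso f.
Proof.
move=> Hg [h [h1 h2]]; exists (h ∘ g); split; first by rewrite -comp_assoc.
by apply: (iso_mono Hg); rewrite comp_idr !comp_assoc h2 comp_idl.
Qed.

Lemma iso_cancel_r (x y z : C) (g : Hom y z) (f : Hom x y) :
  is_iso f -> is_iso (g ∘ f) -> is_iso g.
Proof.
move=> Hf [h [h1 h2]]; exists (f ∘ h); split; last by rewrite comp_assoc.
by apply: (iso_epi Hf); rewrite comp_idl -!comp_assoc h1 comp_idr.
Qed.

Lemma iso_inv (x y : C) (f : Hom x y) (g : Hom y x) :
  g ∘ f = idc x -> f ∘ g = idc y -> is_iso g.
Proof. by move=> e1 e2; exists f. Qed.

Lemma identity_idc (x : C) : is_identity (idc x).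
Proof. by exists x. Qed.

Lemma identity_eqhom (x y : C) (e : x = y) : is_identity (eqhom e).
Proof. by case: y / e; apply: identity_idc. Qed.

Lemma identity_arrow (x y x' y' : C) (f : Hom x y) (f' : Hom x' y') :
  Arrow f = Arrow f' -> is_identity f -> is_identity f'.
Proof. by move=> e [z Hz]; exists z; rewrite -e. Qed.

Lemma identity_src (x y : C) (f : Hom x y) : is_identity f -> Arrow f = Arrow (idc x).
Proof. by move=> [z Hz]; rewrite Hz (f_equal (@asrc C) Hz : x = z). Qed.

Lemma identity_eq (x y : C) (f : Hom x y) : is_identity f -> x = y.
Proof. by move/identity_src => e; rewrite (f_equal (@atgt C) e : y = x). Qed.

Lemma identity_endo (x : C) (f : Hom x x) : is_identity f -> f = idc x.
Proof. by move/identity_src/arrow_inj. Qed.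

Lemma identity_uniq (x y : C) (f g : Hom x y) :
  is_identity f -> is_identity g -> f = g.
Proof. by move=> /identity_src Hf /identity_src Hg; apply: arrow_inj; rewrite Hf. Qed.

Lemma identity_elim (x y : C) (f : Hom x y) :
  is_identity f -> exists e : x = y, f = eqhom e.
Proof.
move=> Hf; exists (identity_eq Hf).
exact: identity_uniq Hf (identity_eqhom _).
Qed.

Lemma identity_iso (x y : C) (f : Hom x y) : is_identity f -> is_iso f.
Proof.
by move=> /identity_src e; apply: is_iso_arrow (eq_sym e) _; apply: iso_idc.
Qed.

Lemma identity_comp_l (x y z : C) (g : Hom y z) (f : Hom x y) :
  is_identity g -> Arrow (g ∘ f) = Arrow f.
Proof. by move/identity_elim => [e ->]; subst z; rewrite /= comp_idl. Qed.

Lemma identity_comp_r (x y z : C) (g : Hom y z) (f : Hom x y) :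
  is_identity f -> Arrow (g ∘ f) = Arrow g.
Proof.
by move/identity_elim => [e ->]; subst y; rewrite /= comp_idr.
Qed.

Lemma identity_comp (x y z : C) (g : Hom y z) (f : Hom x y) :
  is_identity g -> is_identity f -> is_identity (g ∘ f).
Proof. by move=> Hg; apply: identity_arrow; rewrite identity_comp_l. Qed.

Lemma identity_inv (x y : C) (f : Hom x y) (g : Hom y x) :
  g ∘ f = idc x -> is_identity f -> is_identity g.
Proof.
move=> e Hf; apply: (@identity_arrow _ _ _ _ (g ∘ f)).
- exact: identity_comp_r.
- by rewrite e; apply: identity_idc.
Qed.

(** Transport written as a composite, so that functors and composition act on it by their ordinary
    laws; [hcast_arrow] removes it again. *)
Definition hcast (x y x' y' : C) (ex : x = x') (ey : y = y') (f : Hom x y) :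
  Hom x' y' := eqhom ey ∘ f ∘ eqhom (eq_sym ex).

Lemma hcast_arrow (x y x' y' : C) (ex : x = x') (ey : y = y') (f : Hom x y) :
  Arrow (hcast ex ey f) = Arrow f.
Proof. by subst; rewrite /hcast /= comp_idl comp_idr. Qed.

Lemma arrow_src (x y x' y' : C) (f : Hom x y) (f' : Hom x' y') :
  Arrow f = Arrow f' -> x = x'.
Proof. exact: (f_equal (@asrc C)). Qed.

Lemma arrow_tgt (x y x' y' : C) (f : Hom x y) (f' : Hom x' y') :
  Arrow f = Arrow f' -> y = y'.
Proof. exact: (f_equal (@atgt C)). Qed.
End Isomorphisms.

Section FunctorFacts.
Context (C D : Category) (F : Functor C D).

Lemma iso_fmap (x y : C) (f : Hom x y) : is_iso f -> is_iso (fmap F f).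
Proof.
by move=> [g [e1 e2]]; exists (fmap F g); rewrite -!fmap_comp e1 e2 !fmap_id.
Qed.

Lemma identity_fmap (x y : C) (f : Hom x y) : is_identity f -> is_identity (fmap F f).
Proof.
move=> [z Hz]; exists (F z); rewrite -fmap_id; exact: arrow_fmap.
Qed.
End FunctorFacts.

Lemma functor_arrow_ob (C D : Category) (F G : Functor C D) (x : C) :
  F = G -> F x = G x.
Proof. by move=> ->. Qed.

(** Identity components force equal values on objects, and naturality then forces equal values on
    morphisms. *)
Lemma identity_natural_eq (C D : Category) (F G : Functor C D) (t : NatTrans F G) :
  (forall x, is_identity (t x)) -> F = G.
Proof.
move=> H; apply: functor_eq => [x|x y f]; first exact: identity_eq (H x).
by rewrite -(identity_comp_l (fmap F f) (H y)) nt_nat (identity_comp_r _ (H x)).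
Qed.

(** * Equivalences as fully faithful, essentially surjective functors *)

Definition fully_faithful (C D : Category) (F : Functor C D) : Prop :=
  forall (x y : C) (g : Hom (F x) (F y)), exists! f : Hom x y, fmap F f = g.

Definition essentially_surjective (C D : Category) (F : Functor C D) : Prop :=
  forall y : D, exists (x : C) (f : Hom (F x) y), is_iso f.

Lemma equivalence_fully_faithful (C D : Category) (F : Functor C D) :
  is_equivalence F -> fully_faithful F.
Proof.
move=> [G [[s Hs] [t Ht]]] x y g.
have inj (a b : C) (f f' : Hom a b) : fmap F f = fmap F f' -> f = f'.
  move=> e; apply: (iso_epi (Hs a)).
  by have := nt_nat s f; have := nt_nat s f'; rewrite /= e => <- <-.
have injG (a b : D) (f f' : Hom a b) : fmap G f = fmap G f' -> f = f'.
  move=> e; apply: (iso_epi (Ht a)).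
  by have := nt_nat t f; have := nt_nat t f'; rewrite /= e => <- <-.
have [s' [e1 e2]] := Hs x.
(* Faithfulness of [G] reduces fullness of [F] to an equation after [G], where naturality of [s]
   supplies it. *)
have E : fmap F (s y ∘ fmap G g ∘ s') = g.
  apply: injG; apply: (iso_mono (Hs y)); apply: (iso_epi (f := s')).
    exact: iso_inv e1 e2.
  have := nt_nat s (s y ∘ fmap G g ∘ s'); rewrite /= => ->.
  by rewrite -(comp_assoc _ (s x)) e2 comp_idr.
exists (s y ∘ fmap G g ∘ s'); split=> // f Hf; apply: inj; by rewrite E Hf.
Qed.

Lemma equivalence_essentially_surjective (C D : Category) (F : Functor C D) :
  is_equivalence F -> essentially_surjective F.
Proof. by move=> [G [_ [t Ht]]] y; exists (G y), (t y); apply: Ht. Qed.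

Lemma fully_faithful_iso (C D : Category) (F : Functor C D) (x y : C) (f : Hom x y) :
  fully_faithful F -> is_iso (fmap F f) -> is_iso f.
Proof.
move=> ff [g' [e1 e2]].
have [g [Eg _]] := ff _ _ g'.
have inj (a b : C) (h h' : Hom a b) : fmap F h = fmap F h' -> h = h'.
  by move=> e; have [k [_ U]] := ff _ _ (fmap F h); rewrite -(U h eq_refl) -(U h').
by exists g; split; apply: inj; rewrite fmap_comp fmap_id Eg.
Qed.

(** The quasi-inverse is built by choice: a preimage with a two-sided inverse is picked for each
    [y], and morphisms are conjugated by these before being lifted. *)
Lemma fully_faithful_equivalence (C D : Category) (F : Functor C D) :
  fully_faithful F -> essentially_surjective F -> is_equivalence F.
Proof.
move=> ff es.
have inj (a b : C) (h h' : Hom a b) : fmap F h = fmap F h' -> h = h'.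
  by move=> e; have [k [_ U]] := ff _ _ (fmap F h); rewrite -(U h eq_refl) -(U h').
have ch (y : D) : {x : C & {f : Hom (F x) y & {g : Hom y (F x) |
    g ∘ f = idc _ /\ f ∘ g = idc _}}}.
  have [x Hx] := constructive_indefinite_description _ (es y).
  have [f Hf] := constructive_indefinite_description _ Hx.
  have [g Hg] := constructive_indefinite_description _ Hf.
  by exists x, f, g.
pose Go y := projT1 (ch y).
pose e y : Hom (F (Go y)) y := projT1 (projT2 (ch y)).
pose e' y : Hom y (F (Go y)) := proj1_sig (projT2 (projT2 (ch y))).
have ee y : e' y ∘ e y = idc _ := proj1 (proj2_sig (projT2 (projT2 (ch y)))).
have ee' y : e y ∘ e' y = idc _ := proj2 (proj2_sig (projT2 (projT2 (ch y)))).
have pre x y (g : Hom (F x) (F y)) : {f : Hom x y | fmap F f = g}.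
  have [f [Hf _]] := constructive_indefinite_description _ (ff x y g).
  by exists f.
pose Gm x y (u : Hom x y) : Hom (Go x) (Go y) :=
  proj1_sig (pre _ _ (e' y ∘ u ∘ e x)).
have GmE x y (u : Hom x y) : fmap F (Gm x y u) = e' y ∘ u ∘ e x :=
  proj2_sig (pre _ _ (e' y ∘ u ∘ e x)).
have Gid x : Gm x x (idc x) = idc _.
  by apply: inj; rewrite GmE fmap_id comp_idr ee.
have Gcomp x y z (g : Hom y z) (f : Hom x y) : Gm _ _ (g ∘ f) = Gm _ _ g ∘ Gm _ _ f.
  apply: inj; rewrite fmap_comp !GmE.
  have E : e' z ∘ (g ∘ f) ∘ e x = e' z ∘ g ∘ (e y ∘ e' y) ∘ (f ∘ e x).
    by rewrite ee' comp_idr !comp_assoc.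
  by rewrite E !comp_assoc.
pose G := Build_Functor Gid Gcomp.
exists G; split.
- pose t x := proj1_sig (pre _ _ (e (F x))).
  have tE x : fmap F (t x) = e (F x) := proj2_sig (pre _ _ (e (F x))).
  unshelve eexists (@Build_NatTrans C C (G ⊙ F) (idF C) t _).
  + move=> x y f; apply: inj; rewrite !fmap_comp !tE /= GmE !comp_assoc.
    have E := ee' (F y); rewrite /G /= in E *; by rewrite E comp_idl.
  + move=> x; apply: (fully_faithful_iso ff); rewrite /= tE.
    by exists (e' (F x)); split; [apply: ee | apply: ee'].
- unshelve eexists (@Build_NatTrans D D (F ⊙ G) (idF D) e _).
  + by move=> x y f /=; rewrite GmE !comp_assoc ee' comp_idl.
  + by move=> x; exists (e' x); split; [apply: ee | apply: ee'].
Qed.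

(** * Cartesian and coCartesian arrows *)

Section CartesianArrows.
Context (C B : Category) (P : Functor C B).

Definition cart_arrow (x y : C) (u : Hom x y) : Prop :=
  forall (z : C) (w : Hom z y) (g : Hom (P z) (P x)),
    fmap P w = fmap P u ∘ g ->
    exists! v : Hom z x, fmap P v = g /\ u ∘ v = w.

Lemma cocartesian_arrow_eq (x y x' y' : C) (u : Hom x y) (u' : Hom x' y') :
  Arrow u = Arrow u' -> cocartesian_arrow P u -> cocartesian_arrow P u'.
Proof. by move=> e Hu; move: x' y' u' e; apply: arrow_elim. Qed.

Lemma cart_arrow_eq (x y x' y' : C) (u : Hom x y) (u' : Hom x' y') :
  Arrow u = Arrow u' -> cart_arrow u -> cart_arrow u'.
Proof. by move=> e Hu; move: x' y' u' e; apply: arrow_elim. Qed.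

Lemma cocartesian_arrow_inj (x y z : C) (u : Hom x y) (v v' : Hom y z) :
  cocartesian_arrow P u -> fmap P v = fmap P v' -> v ∘ u = v' ∘ u -> v = v'.
Proof.
move=> Hu e1 e2.
have [|w [_ U]] := Hu z (v ∘ u) (fmap P v); first by rewrite fmap_comp.
by rewrite -(U v) // -(U v').
Qed.

Lemma cart_arrow_inj (x y z : C) (u : Hom x y) (v v' : Hom z x) :
  cart_arrow u -> fmap P v = fmap P v' -> u ∘ v = u ∘ v' -> v = v'.
Proof.
move=> Hu e1 e2.
have [|w [_ U]] := Hu z (u ∘ v) (fmap P v); first by rewrite fmap_comp.
by rewrite -(U v) // -(U v').
Qed.

Lemma cocartesian_arrow_comp (x y z : C) (u : Hom x y) (v : Hom y z) :
  cocartesian_arrow P u -> cocartesian_arrow P v -> cocartesian_arrow P (v ∘ u).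
Proof.
move=> Hu Hv t w g; rewrite fmap_comp comp_assoc => e.
have [a [[a1 a2] _]] := Hu _ _ _ e.
have [b [[b1 b2] U]] := Hv _ a g a1.
exists b; split; first by rewrite comp_assoc b2.
move=> b' [c1 c2]; apply: U; split=> //.
apply: (cocartesian_arrow_inj Hu); first by rewrite fmap_comp c1 a1.
by rewrite a2 -comp_assoc.
Qed.

Lemma cart_arrow_comp (x y z : C) (u : Hom x y) (v : Hom y z) :
  cart_arrow u -> cart_arrow v -> cart_arrow (v ∘ u).
Proof.
move=> Hu Hv t w g; rewrite fmap_comp -comp_assoc => e.
have [a [[a1 a2] _]] := Hv _ _ _ e.
have [b [[b1 b2] U]] := Hu _ a g a1.
exists b; split; first by rewrite -comp_assoc b2.
move=> b' [c1 c2]; apply: U; split=> //.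
apply: (cart_arrow_inj Hv); first by rewrite fmap_comp c1 a1.
by rewrite a2 comp_assoc.
Qed.

(** The inverse of [v] is the factorization of [u ∘ w'] through [u'] over the inverse of the image
    of [v]. This transfers invertibility of transition morphisms along coCartesian arrows. *)
Lemma cocartesian_arrow_iso (x y x' y' : C) (u : Hom x y) (u' : Hom x' y')
    (v : Hom y y') (w : Hom x x') :
  cocartesian_arrow P u -> cocartesian_arrow P u' -> is_iso w ->
  is_iso (fmap P v) -> v ∘ u = u' ∘ w -> is_iso v.
Proof.
move=> Hu Hu' [w' [w1 w2]] [g [g1 g2]] e.
have E : fmap P (u ∘ w') = g ∘ fmap P u'.
  rewrite -(comp_idr u') -w2 comp_assoc -e !fmap_comp !comp_assoc g1.
  by rewrite comp_idl.
have [v' [[v1 v2] _]] := Hu' _ _ _ E.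
exists v'; split.
- apply: (cocartesian_arrow_inj Hu); first by rewrite fmap_comp v1 g1 fmap_id.
  by rewrite -comp_assoc e comp_assoc v2 -comp_assoc w1 comp_idl comp_idr.
- apply: (cocartesian_arrow_inj Hu'); first by rewrite fmap_comp v1 g2 fmap_id.
  by rewrite -comp_assoc v2 comp_assoc e -comp_assoc w2 comp_idl comp_idr.
Qed.

Lemma cart_arrow_iso (x y x' y' : C) (u : Hom y x) (u' : Hom y' x')
    (v : Hom y' y) (w : Hom x' x) :
  cart_arrow u -> cart_arrow u' -> is_iso w ->
  is_iso (fmap P v) -> u ∘ v = w ∘ u' -> is_iso v.
Proof.
move=> Hu Hu' [w' [w1 w2]] [g [g1 g2]] e.
have E : fmap P (w' ∘ u) = fmap P u' ∘ g.
  rewrite -(comp_idl u') -w1 -comp_assoc -e !fmap_comp -!comp_assoc g2.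
  by rewrite comp_idr.
have [v' [[v1 v2] _]] := Hu' _ _ _ E.
exists v'; split.
- apply: (cart_arrow_inj Hu'); first by rewrite fmap_comp v1 g1 fmap_id.
  by rewrite comp_assoc v2 -comp_assoc e comp_assoc w1 comp_idl comp_idr.
- apply: (cart_arrow_inj Hu); first by rewrite fmap_comp v1 g2 fmap_id.
  by rewrite comp_assoc e -comp_assoc v2 comp_assoc w2 comp_idl comp_idr.
Qed.

Lemma cocartesian_arrow_idc (x : C) : cocartesian_arrow P (idc x).
Proof.
move=> z w g; rewrite fmap_id comp_idr => e; exists w; split.
  by rewrite comp_idr.
by move=> v [_]; rewrite comp_idr.
Qed.

Lemma cart_arrow_idc (x : C) : cart_arrow (idc x).
Proof.
move=> z w g; rewrite fmap_id comp_idl => e; exists w; split.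
  by rewrite comp_idl.
by move=> v [_]; rewrite comp_idl.
Qed.

Lemma cocartesian_arrow_over_iso (x y : C) (u : Hom x y) :
  cocartesian_arrow P u -> is_iso (fmap P u) -> is_iso u.
Proof.
move=> Hu Pu.
exact: cocartesian_arrow_iso (@cocartesian_arrow_idc x) Hu (iso_idc x) Pu eq_refl.
Qed.

Lemma cart_arrow_over_iso (x y : C) (u : Hom x y) :
  cart_arrow u -> is_iso (fmap P u) -> is_iso u.
Proof.
move=> Hu Pu.
exact: cart_arrow_iso (@cart_arrow_idc y) Hu (iso_idc y) Pu eq_refl.
Qed.

Lemma fib_arrow (b : B) (x y x' y' : FibCat P b) (u : Hom x y) (u' : Hom x' y') :
  Arrow ⌊u⌋ = Arrow ⌊u'⌋ -> Arrow u = Arrow u'.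
Proof.
case: x u => x ex; case: y => y ey [u Hu].
case: x' u' => x' ex'; case: y' => y' ey' [u' Hu'] /= e.
pose Q x1 y1 (u1 : @Hom C x1 y1) := forall (e1 : P x1 = b) (e2 : P y1 = b)
  (H1 : Arrow (fmap P u1) = Arrow (idc b)),
  @Arrow (FibCat P b) (exist _ x ex) (exist _ y ey) (exist _ u Hu) =
  @Arrow (FibCat P b) (exist _ x1 e1) (exist _ y1 e2) (exist _ u1 H1).
apply: (@arrow_elim C x y u Q _ _ _ _ e) => e1 e2 H1.
by rewrite (proof_irrelevance _ e1 ex) (proof_irrelevance _ e2 ey)
  (proof_irrelevance _ H1 Hu).
Qed.

Lemma fib_comp (b : B) (x y z : FibCat P b) (g : Hom y z) (f : Hom x y) :
  ⌊g ∘ f⌋ = ⌊g⌋ ∘ ⌊f⌋.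
Proof. by case: g f => g Hg [f Hf]. Qed.

Lemma fib_vertical (b : B) (x y : FibCat P b) (u : Hom x y) :
  is_identity (fmap P ⌊u⌋).
Proof. by exists b; apply: (proj2_sig u). Qed.

Lemma vertical_over (b : B) (x y : C) (u : Hom x y) :
  P x = b -> is_identity (fmap P u) -> Arrow (fmap P u) = Arrow (idc b).
Proof. by move=> <- /identity_src. Qed.

Lemma fib_iso (b : B) (x y : FibCat P b) (u : Hom x y) :
  is_iso ⌊u⌋ <-> is_iso u.
Proof.
split=> [[v [e1 e2]]|[v [e1 e2]]]; last first.
  exists ⌊v⌋; have := f_equal (@proj1_sig _ _) e1.
  have := f_equal (@proj1_sig _ _) e2; rewrite /=.
  by case: x u v {e1 e2} => x ex; case: y => y ey [u Hu] [v Hv].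
have Hv : Arrow (fmap P v) = Arrow (idc b).
  apply: (vertical_over (proj2_sig y)).
  apply: (identity_inv (f := fmap P ⌊u⌋)); last exact: fib_vertical.
  by rewrite -fmap_comp e1 fmap_id.
exists (exist _ v Hv); split; apply: fc_hom_eq.
- by case: x u v e1 e2 Hv => x ex; case: y => y ey [u Hu].
- by case: x u v e1 e2 Hv => x ex; case: y => y ey [u Hu].
Qed.
End CartesianArrows.

(** * Evaluation of pre-derivators at points *)

Lemma bang_comp (A B : Category) (F : Functor A B) : bang B ⊙ F = bang A.
Proof. exact: functor_eq. Qed.

Lemma functor_to_point_eq (A : Category) (F : Functor A PtCat) : F = bang A.
Proof.
apply: functor_eq => [x|x y f] /=; first by case: (F x).
by case: (fmap F f); case: (F x); case: (F y).
Qed.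

Lemma pointF_comp (A B : Category) (F : Functor A B) (x : A) :
  F ⊙ pointF x = pointF (F x).
Proof. by apply: functor_eq => // ? ? ? /=; rewrite fmap_id. Qed.

Lemma pointF_pt (x : PtCat) : pointF x = idF PtCat.
Proof. by rewrite (functor_to_point_eq (pointF x)) (functor_to_point_eq (idF _)). Qed.

Section Evaluation.
Context {Dia : DiagramCategory} (E : PreDerivator Dia).

Definition ev (K : DiaOb Dia) (k : K) : Functor (E K) (E dpt) :=
  @pd_map Dia E dpt K (pointF k).

Definition tr (K : DiaOb Dia) (k k' : K) (m : Hom k k') (X : E K) :
  Hom (ev k X) (ev k' X) := @pd_2 Dia E dpt K _ _ (pointNT m) X.

Lemma tr_nat (K : DiaOb Dia) (k k' : K) (m : Hom k k') (X Y : E K) (u : Hom X Y) :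
  tr m Y ∘ fmap (ev k) u = fmap (ev k') u ∘ tr m X.
Proof. exact: nt_nat. Qed.

Lemma pd_map_comp (I J K : DiaOb Dia) (b : Functor J K) (a : Functor I J)
    (X Y : E K) (u : Hom X Y) :
  Arrow (fmap (pd_map E a) (fmap (pd_map E b) u)) =
  Arrow (fmap (@pd_map Dia E I K (b ⊙ a)) u).
Proof. exact: (fmap_arrow_eq u (eq_sym (pd_comp E b a))). Qed.

Lemma pd_map_comp_ob (I J K : DiaOb Dia) (b : Functor J K) (a : Functor I J)
    (X : E K) :
  pd_map E a (pd_map E b X) = @pd_map Dia E I K (b ⊙ a) X.
Proof. by rewrite pd_comp. Qed.

Lemma pd_map_id (I : DiaOb Dia) (X Y : E I) (u : Hom X Y) :
  Arrow (fmap (@pd_map Dia E I I (idF I)) u) = Arrow u.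
Proof. exact: (fmap_arrow_eq u (pd_id E I)). Qed.

Lemma pd_map_id_ob (I : DiaOb Dia) (X : E I) : @pd_map Dia E I I (idF I) X = X.
Proof. by rewrite pd_id. Qed.

Lemma pd_2_eq (I J : DiaOb Dia) (a b a' b' : Functor I J) (s : NatTrans a b)
    (s' : NatTrans a' b') (X : E J) :
  a = a' -> b = b' -> (forall i, Arrow (s i) = Arrow (s' i)) ->
  Arrow (pd_2 E s X) = Arrow (pd_2 E s' X).
Proof.
move=> ea eb; subst a' b' => H.
have -> // : s = s'.
by apply: nt_eq => i; apply: arrow_inj; apply: H.
Qed.

(** The two functors are then equal, and the claim reduces to the axiom on identity 2-cells. *)
Lemma pd_2_identity (I J : DiaOb Dia) (a b : Functor I J) (s : NatTrans a b)
    (X : E J) :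
  (forall i, is_identity (s i)) -> is_identity (pd_2 E s X).
Proof.
move=> Hs; have e := identity_natural_eq Hs.
exists (pd_map E a X); rewrite -pd_2_id.
apply: pd_2_eq => // i; exact: identity_src (Hs i).
Qed.

Lemma tr_identity (K : DiaOb Dia) (k k' : K) (m : Hom k k') (X : E K) :
  is_identity m -> is_identity (tr m X).
Proof. by move=> Hm; apply: pd_2_identity. Qed.

Lemma ev_map_ob (K L : DiaOb Dia) (a : Functor K L) (k : K) (X : E L) :
  ev k (pd_map E a X) = ev (a k) X.
Proof. by rewrite /ev pd_map_comp_ob pointF_comp. Qed.

Lemma ev_map (K L : DiaOb Dia) (a : Functor K L) (k : K) (X Y : E L) (u : Hom X Y) :
  Arrow (fmap (ev k) (fmap (pd_map E a) u)) = Arrow (fmap (ev (a k)) u).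
Proof.
rewrite pd_map_comp; apply: fmap_arrow_eq; by rewrite pointF_comp.
Qed.

Lemma tr_map (K L : DiaOb Dia) (a : Functor K L) (k k' : K) (m : Hom k k') (X : E L) :
  Arrow (tr m (pd_map E a X)) = Arrow (tr (fmap a m) X).
Proof.
rewrite /tr -pd_whiskL; by apply: pd_2_eq; rewrite ?pointF_comp.
Qed.

Lemma ev_2 (K L : DiaOb Dia) (a b : Functor K L) (t : NatTrans a b) (k : K)
    (X : E L) :
  Arrow (fmap (ev k) (pd_2 E t X)) = Arrow (tr (t k) X).
Proof.
by rewrite /tr -pd_whiskR; apply: pd_2_eq; rewrite ?pointF_comp.
Qed.

Lemma ev_const_ob (K : DiaOb Dia) (q : Functor K (dpt (Dia := Dia))) (k : K)
    (Z : E dpt) :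
  ev k (pd_map E q Z) = Z.
Proof. by rewrite ev_map_ob /ev pointF_pt pd_map_id_ob. Qed.

Lemma ev_const (K : DiaOb Dia) (q : Functor K (dpt (Dia := Dia))) (k : K)
    (Z Z' : E dpt) (u : Hom Z Z') :
  Arrow (fmap (ev k) (fmap (pd_map E q) u)) = Arrow u.
Proof.
rewrite ev_map /ev -[RHS](pd_map_id u); apply: fmap_arrow_eq.
by rewrite pointF_pt.
Qed.

(** Every 2-cell between functors to the terminal category is an identity; this is what makes
    2-cells act trivially on constant objects. *)
Lemma pd_2_point_identity (I : DiaOb Dia) (a b : Functor I (dpt (Dia := Dia)))
    (s : NatTrans a b) (Z : E dpt) : is_identity (pd_2 E s Z).
Proof.
apply: pd_2_identity => i; case: (s i); case: (a i); case: (b i).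
by exists tt.
Qed.
End Evaluation.

(** Pointwise inverses are automatically natural, so they invert the underlying morphism of
    diagrams, and conservativity applies. *)
Lemma der2_iso (Dia : DiagramCategory) (E : PreDerivator Dia) (K : DiaOb Dia)
    (X Y : E K) (u : Hom X Y) :
  pd_der2 E -> (forall k : K, is_iso (fmap (ev E k) u)) -> is_iso u.
Proof.
move=> d2 H; apply: d2.
have ch (k : K) : {g : Hom (ev E k Y) (ev E k X) |
    g ∘ fmap (ev E k) u = idc _ /\ fmap (ev E k) u ∘ g = idc _}.
  exact: constructive_indefinite_description (H k).
unshelve eexists (@Build_NatTrans _ _ (diagram Y) (diagram X)
  (fun k => proj1_sig (ch k)) _).
- move=> k k' m /=; apply: (iso_mono (H k')).
  rewrite !comp_assoc (proj2 (proj2_sig (ch k'))) comp_idl.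
  rewrite -(tr_nat (E := E) m u) -comp_assoc (proj2 (proj2_sig (ch k))).
  by rewrite comp_idr.
- split; apply: nt_eq => k /=.
  + exact: (proj1 (proj2_sig (ch k))).
  + exact: (proj2 (proj2_sig (ch k))).
Qed.

(** * Morphisms of pre-derivators and their fibres *)

(** The unary part of [MDMor]. Corresponding objects are constructed among unary morphisms alone;
    multimorphisms return with push-forward. *)
Record PDMor (Dia : DiagramCategory) (E B : PreDerivator Dia) := {
  pm :> forall I : DiaOb Dia, Functor (E I) (B I);
  pm_nat : forall (I J : DiaOb Dia) (a : Functor I J),
    pm I ⊙ pd_map E a = pd_map B a ⊙ pm J;
  pm_2 : forall (I J : DiaOb Dia) (a b : Functor I J) (s : NatTrans a b) (X : E J),
    Arrow (fmap (pm I) (pd_2 E s X)) = Arrow (pd_2 B s (pm J X))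
}.

Section Morphism.
Context {Dia : DiagramCategory} {E B : PreDerivator Dia} (P : PDMor E B).

Lemma pm_map_ob (I J : DiaOb Dia) (a : Functor I J) (X : E J) :
  P I (pd_map E a X) = pd_map B a (P J X).
Proof. exact: (functor_arrow_ob X (pm_nat P a)). Qed.

Lemma pm_map (I J : DiaOb Dia) (a : Functor I J) (X Y : E J) (u : Hom X Y) :
  Arrow (fmap (P I) (fmap (pd_map E a) u)) =
  Arrow (fmap (pd_map B a) (fmap (P J) u)).
Proof. exact: (fmap_arrow_eq u (pm_nat P a)). Qed.

Lemma vertical_map (I J : DiaOb Dia) (a : Functor I J) (X Y : E J) (u : Hom X Y) :
  is_identity (fmap (P J) u) -> is_identity (fmap (P I) (fmap (pd_map E a) u)).
Proof.
move=> Hu; apply: (identity_arrow (eq_sym (pm_map a u))).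
exact: identity_fmap.
Qed.

Lemma pm_tr (K : DiaOb Dia) (k k' : K) (m : Hom k k') (X : E K) :
  Arrow (fmap (P dpt) (tr (E := E) m X)) = Arrow (tr (E := B) m (P K X)).
Proof. exact: pm_2. Qed.

Context (b : B dpt).

Lemma fibre_pd_ob (I J : DiaOb Dia) (a : Functor I J) :
  pd_map B a (@pd_map _ B J dpt (bang J) b) = @pd_map _ B I dpt (bang I) b.
Proof. by rewrite pd_map_comp_ob bang_comp. Qed.

Definition fibre_pd_map (I J : DiaOb Dia) (a : Functor I J) :
  Functor (FibCat (P J) (@pd_map _ B J dpt (bang J) b))
          (FibCat (P I) (@pd_map _ B I dpt (bang I) b)) :=
  fib_map (pm_nat P a) (fibre_pd_ob a).

(** Composed with the functor to the terminal category, a 2-cell becomes an identity; so it acts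
    vertically on whatever lies over a constant object. *)
Lemma fibre_pd_vertical (I J : DiaOb Dia) (a a' : Functor I J) (s : NatTrans a a')
    (X : FibCat (P J) (@pd_map _ B J dpt (bang J) b)) :
  Arrow (fmap (P I) (pd_2 E s ⌊X⌋)) = Arrow (idc (@pd_map _ B I dpt (bang I) b)).
Proof.
have Hid : is_identity (fmap (P I) (pd_2 E s ⌊X⌋)).
  apply: (identity_arrow (eq_sym (pm_2 P s ⌊X⌋))).
  rewrite (proj2_sig X).
  apply: (identity_arrow (@pd_whiskL _ B I J dpt (bang J) _ _ s b)).
  exact: pd_2_point_identity.
apply: vertical_over Hid.
by rewrite pm_map_ob (proj2_sig X) fibre_pd_ob.
Qed.

Definition fibre_pd_2 (I J : DiaOb Dia) (a a' : Functor I J) (s : NatTrans a a') :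
  NatTrans (fibre_pd_map a) (fibre_pd_map a').
Proof.
unshelve refine (@Build_NatTrans _ _ (fibre_pd_map a) (fibre_pd_map a')
  (fun X => exist _ (pd_2 E s ⌊X⌋) (fibre_pd_vertical s X)) _).
by move=> X Y u; apply: fc_hom_eq; apply: nt_nat.
Defined.

Lemma fib_ob_eq (C D : Category) (F : Functor C D) (d : D) (x y : FibCat F d) :
  ⌊x⌋ = ⌊y⌋ -> x = y.
Proof.
case: x y => x ex [y ey] /= e; subst y.
by rewrite (proof_irrelevance _ ex ey).
Qed.

(** Every functor pulls constant objects back to constant objects with the same value, so the fibres
    over them form a strict 2-functor. *)
Definition fibre_pd : PreDerivator Dia.
Proof.
refine {| pd_ob := fun I => FibCat (P I) (@pd_map _ B I dpt (bang I) b);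
          pd_map := fibre_pd_map; pd_2 := fibre_pd_2 |}.
- move=> I; apply: functor_eq => [X|X Y u].
  + by apply: fib_ob_eq; apply: pd_map_id_ob.
  + by apply: fib_arrow; apply: pd_map_id.
- move=> I J K c a; apply: functor_eq => [X|X Y u].
  + by apply: fib_ob_eq; rewrite /= pd_map_comp_ob.
  + by apply: fib_arrow; rewrite /= pd_map_comp.
- move=> I J a X; apply: fc_hom_eq.
  by rewrite /= pd_2_id; case: X.
- by move=> I J a a' a'' t s X; apply: fc_hom_eq; rewrite /= pd_2_comp.
- by move=> I J K c a a' s X; apply: fib_arrow; apply: pd_whiskL.
- by move=> H I J a a' s c X; apply: fib_arrow; apply: pd_whiskR.
Defined.

Lemma fibre_pd_der2 : pd_der2 E -> pd_der2 fibre_pd.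
Proof.
move=> d2 I X Y u Hu; apply/fib_iso; apply: der2_iso => // k.
have [v [e1 e2]] := Hu.
apply/(fib_iso (P := P dpt) (fmap (@pd_map _ fibre_pd dpt I (pointF k)) u)).
exists (v k); split.
- exact: (f_equal (fun t : NatTrans (diagram X) (diagram X) => t k) e1).
- exact: (f_equal (fun t : NatTrans (diagram Y) (diagram Y) => t k) e2).
Qed.
End Morphism.

Lemma identity_of_comp (C : Category) (x y y' : C) (h : Hom y y') (g : Hom x y)
    (f : Hom x y') : is_iso g -> h ∘ g = f -> Arrow f = Arrow g -> is_identity h.
Proof.
move=> Hg e ea; have ey := arrow_tgt ea; subst y'.
move/arrow_inj: ea => ea; rewrite ea in e.
have -> : h = idc y by apply: (iso_epi Hg); rewrite e comp_idl.
exact: identity_idc.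
Qed.

Lemma prod_iso (A B : Category) (x y : ProdCat A B) (f : Hom x y) :
  is_iso f <-> is_iso (fst f) /\ is_iso (snd f).
Proof.
split.
- move=> [g [e1 e2]]; split; [exists (fst g) | exists (snd g)]; split.
  + exact: (f_equal fst e1).
  + exact: (f_equal fst e2).
  + exact: (f_equal snd e1).
  + exact: (f_equal snd e2).
- move=> [[g1 [a1 a2]] [g2 [b1 b2]]]; exists (g1, g2).
  by rewrite /= a1 a2 b1 b2.
Qed.

(** * (Der1) for the fibres over constant objects *)

Section FibreDer1.
Context {Dia : DiagramCategory} {E B : PreDerivator Dia} (P : PDMor E B).
Context (isofib : forall (K : DiaOb Dia) (X : E K) (s : B K) (f : Hom (P K X) s),
  is_iso f -> exists (Y : E K) (u : Hom X Y),
    is_iso u /\ Arrow (fmap (P K) u) = Arrow f).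
Context (E1 : pd_der1 E) (B1 : pd_der1 B).

(** The two inclusions of the empty category into its sum with itself coincide, so by (Der1) every
    pair [(x, y)] is isomorphic to a pair of restrictions along one and the same functor. *)
Lemma der1_empty_iso (x y : B dempty) : exists f : Hom x y, is_iso f.
Proof.
have [z [f /prod_iso [Hf1 Hf2]]] := equivalence_essentially_surjective
  (proj1 B1 dempty dempty) (x, y).
pose O := @dempty Dia.
pose i1 : Functor O (dsum O O) := inlF O O.
pose i2 : Functor O (dsum O O) := inrF O O.
have e : i2 = i1 by apply: (@functor_eq EmptyCat (SumCat EmptyCat EmptyCat)); case.
have H (G : Functor O (dsum O O)) (t : B O) (g : Hom (pd_map B G z) t) :
    G = i1 -> is_iso g -> exists h : Hom (pd_map B i1 z) t, is_iso h.
  by move=> eG; subst G => Hg; exists g.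
have [h1 [h1' [a1 a2]]] := H i1 _ (fst f) eq_refl Hf1.
have [h2 Hh2] := H i2 _ (snd f) e Hf2.
by exists (h2 ∘ h1'); apply: iso_comp => //; exists h1.
Qed.

Lemma fibre_pd_der1 (b : B dpt) : pd_der1 (fibre_pd P b).
Proof.
split; last first.
  have [X] := proj2 E1.
  have [f Hf] := der1_empty_iso (P _ X) (@pd_map _ B dempty dpt (bang dempty) b).
  have [Y [u [_ e]]] := isofib Hf.
  by constructor; exists Y; apply: (arrow_tgt e).
move=> I J.
pose i1 : Functor I (dsum I J) := inlF I J.
pose i2 : Functor J (dsum I J) := inrF I J.
have ffE := equivalence_fully_faithful (proj1 E1 I J).
have esE := equivalence_essentially_surjective (proj1 E1 I J).
have ffB := equivalence_fully_faithful (proj1 B1 I J).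
apply: fully_faithful_equivalence.
- move=> X Y [g1 g2].
  have [w [Hw U]] := ffE ⌊X⌋ ⌊Y⌋ (⌊g1⌋, ⌊g2⌋).
  (* Joint restriction is faithful on [B], so the image of [w] agrees with the equality [e] as soon
     as both restrictions do. *)
  have Hid : is_identity (fmap (P _) w).
    have e : P _ ⌊X⌋ = P _ ⌊Y⌋ by rewrite (proj2_sig X) (proj2_sig Y).
    have [v [_ V]] := ffB _ _ (fmap (pairF (pd_map B i1)
      (pd_map B i2)) (eqhom e)).
    have L (K : DiaOb Dia) (i : Functor K (dsum I J))
        (g : Hom (pd_map E i ⌊X⌋) (pd_map E i ⌊Y⌋)) :
        fmap (pd_map E i) w = g -> is_identity (fmap (P K) g) ->
        fmap (pd_map B i) (fmap (P _) w) = fmap (pd_map B i) (eqhom e).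
      move=> <- Hg; apply: identity_uniq.
        exact: identity_arrow (pm_map P i w) Hg.
      by apply: identity_fmap; apply: identity_eqhom.
    suff HW : fmap (pairF (pd_map B i1) (pd_map B i2)) (fmap (P _) w) =
        fmap (pairF (pd_map B i1) (pd_map B i2)) (eqhom e).
      rewrite -(V _ HW) (V _ eq_refl); exact: identity_eqhom.
    apply: injective_projections; rewrite /=.
      exact: (L I i1 ⌊g1⌋ (f_equal fst Hw) (fib_vertical g1)).
    exact: (L J i2 ⌊g2⌋ (f_equal snd Hw) (fib_vertical g2)).
  have Hw' := vertical_over (proj2_sig X) Hid.
  exists (exist _ w Hw'); split.
  + apply: injective_projections; apply: fc_hom_eq.
    * exact: (f_equal fst Hw).
    * exact: (f_equal snd Hw).
  + move=> v Hv; apply: fc_hom_eq; apply: U; apply: injective_projections.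
    * exact: (f_equal (fun h => ⌊fst h⌋) Hv).
    * exact: (f_equal (fun h => ⌊snd h⌋) Hv).
- move=> [X Y].
  have [Z [f /prod_iso [Hf1 Hf2]]] := esE (⌊X⌋, ⌊Y⌋).
  pose s := @pd_map _ B (dsum I J) dpt (bang _) b.
  have eX : P I ⌊X⌋ = pd_map B i1 s by rewrite (proj2_sig X) fibre_pd_ob.
  have eY : P J ⌊Y⌋ = pd_map B i2 s by rewrite (proj2_sig Y) fibre_pd_ob.
  (* The images of the two components glue to an isomorphism [sg] onto the constant object. Lifting
     it moves [Z] into the fibre, and dividing the lift out of the components makes them
     vertical. *)
  pose f1 := hcast (pm_map_ob P i1 Z) eX (fmap (P I) (fst f)).
  pose f2 := hcast (pm_map_ob P i2 Z) eY (fmap (P J) (snd f)).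
  have [sg [Hsg _]] := ffB (P _ Z) s (f1, f2).
  have Isg : is_iso sg.
    apply: (fully_faithful_iso ffB); rewrite Hsg; apply/prod_iso; split.
      by apply: is_iso_arrow (eq_sym (hcast_arrow _ _ _)) _; apply: iso_fmap.
    by apply: is_iso_arrow (eq_sym (hcast_arrow _ _ _)) _; apply: iso_fmap.
  have [Z' [c [Hc ec]]] := isofib Isg.
  have L (K : DiaOb Dia) (i : Functor K (dsum I J)) (X' : E K)
      (g : Hom (pd_map E i Z) X') (h : Hom (pd_map B i (P _ Z)) (pd_map B i s)) :
      is_iso g -> Arrow h = Arrow (fmap (P K) g) -> fmap (pd_map B i) sg = h ->
      exists g' : Hom (pd_map E i Z') X',
        is_iso g' /\ is_identity (fmap (P K) g').
    move=> Hg eh esg.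
    have Hic := iso_fmap (pd_map E i) Hc.
    have [d [d1 d2]] := Hic.
    exists (g ∘ d); split; first by apply: iso_comp => //; apply: iso_inv d1 d2.
    apply: (identity_of_comp (g := fmap (P K) (fmap (pd_map E i) c))).
        exact: iso_fmap.
      by rewrite -fmap_comp -comp_assoc d1 comp_idr.
    by rewrite pm_map (arrow_fmap (pd_map B i) ec) esg eh.
  have [g1 [Hg1 V1]] := L _ _ _ _ _ Hf1 (hcast_arrow _ _ _) (f_equal fst Hsg).
  have [g2 [Hg2 V2]] := L _ _ _ _ _ Hf2 (hcast_arrow _ _ _) (f_equal snd Hsg).
  have eZ : P _ Z' = s := arrow_tgt ec.
  have W1 : P I (pd_map E i1 Z') = @pd_map _ B I dpt (bang I) b.
    by rewrite pm_map_ob eZ fibre_pd_ob.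
  have W2 : P J (pd_map E i2 Z') = @pd_map _ B J dpt (bang J) b.
    by rewrite pm_map_ob eZ fibre_pd_ob.
  exists (exist _ Z' eZ).
  exists (exist _ g1 (vertical_over W1 V1), exist _ g2 (vertical_over W2 V2)).
  apply/prod_iso; split; apply/fib_iso; [exact: Hg1 | exact: Hg2].
Qed.
End FibreDer1.

(** * Underlying pre-derivators *)

Lemma mcast_refl (C : Multicategory) (Γ : list C) (z : C) (e : Γ = Γ)
    (f : mhom Γ z) : mcast e f = f.
Proof. by rewrite (proof_irrelevance _ e eq_refl). Qed.

Lemma m_nat_iso_und (C D : Multicategory) (F G : MFunctor C D) :
  m_nat_iso F G -> nat_iso (undF F) (undF G).
Proof. by move=> [t Ht]; exists (undNT t). Qed.

Lemma is_mequivalence_und (C D : Multicategory) (F : MFunctor C D) :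
  is_mequivalence F -> is_equivalence (undF F).
Proof.
move=> [G [/m_nat_iso_und H1 /m_nat_iso_und H2]]; exists (undF G).
by rewrite undF_comp undF_id in H1; rewrite undF_comp undF_id in H2.
Qed.

(** On unary morphisms the product multicategory differs from the product category only by casts,
    and these are trivial on one-element lists. *)
Lemma pairM_equivalence (C A B : Multicategory) (F : MFunctor C A)
    (G : MFunctor C B) :
  is_mequivalence (pairM F G) -> is_equivalence (pairF (undF F) (undF G)).
Proof.
move/is_mequivalence_und => e.
have E (x y : C) (f : mhom [x] y) :
    mfmap (pairM F G) f = (mfmap F f, mfmap G f).
  by rewrite /= !mcast_refl.
apply: fully_faithful_equivalence.
- move=> x y g; have [f [Hf U]] := equivalence_fully_faithful e g.
  exists f; split; first by rewrite -Hf; apply: eq_sym; apply: E.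
  by move=> f' Hf'; apply: U; rewrite -Hf'; apply: E.
- move=> y; have [x [f [g [e1 e2]]]] := equivalence_essentially_surjective e y.
  exists x, f; exists g.
  split.
  + apply: eq_trans e1; apply: injective_projections; exact: mcomp_cast'.
  + apply: eq_trans e2; apply: injective_projections; exact: mcomp_cast'.
Qed.

Lemma der1_underlying (Dia : DiagramCategory) (D : PreMultiDerivator Dia) :
  der1 D -> pd_der1 (underlying D).
Proof.
move=> [H1 H2]; split; last exact: H2.
move=> I J; exact: pairM_equivalence (H1 I J).
Qed.

Definition underlying_mor (Dia : DiagramCategory) (D S : PreMultiDerivator Dia)
  (p : MDMor D S) : PDMor (underlying D) (underlying S).
Proof.
refine (@Build_PDMor Dia (underlying D) (underlying S) (fun I => undF (p I)) _ _).
- by move=> I J a; apply: mm_sq.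
- by move=> I J a b s X; apply: marrow_arrow; apply: mm_2.
Defined.

(** * Reflecting vertical morphisms along evaluation *)

Lemma unique_eq (A : Type) (Q : A -> Prop) (x y : A) :
  (exists! a, Q a) -> Q x -> Q y -> x = y.
Proof. by move=> [a [_ U]] /U <- /U <-. Qed.

Lemma adjunction_left_bijection (C D : Category) (L : Functor C D) (R : Functor D C)
    (A : Adjunction L R) (X : C) (Y : D) (g : Hom (L X) Y) :
  exists! u : Hom X (R Y), adj_counit A Y ∘ fmap L u = g.
Proof.
exists (fmap R g ∘ adj_unit A X); split.
- rewrite fmap_comp comp_assoc.
  have := nt_nat (adj_counit A) g; rewrite /= => ->.
  by rewrite -comp_assoc adj_tri1 comp_idr.
- move=> u <-; rewrite fmap_comp -comp_assoc.
  have := nt_nat (adj_unit A) u; rewrite /= => <-.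
  by rewrite comp_assoc adj_tri2 comp_idl.
Qed.

Lemma adjunction_right_bijection (C D : Category) (L : Functor C D) (R : Functor D C)
    (A : Adjunction L R) (X : C) (Y : D) (g : Hom X (R Y)) :
  exists! u : Hom (L X) Y, fmap R u ∘ adj_unit A X = g.
Proof.
exists (adj_counit A Y ∘ fmap L g); split.
- rewrite fmap_comp -comp_assoc.
  have := nt_nat (adj_unit A) g; rewrite /= => <-.
  by rewrite comp_assoc adj_tri2 comp_idl.
- move=> u <-; rewrite fmap_comp comp_assoc.
  have := nt_nat (adj_counit A) u; rewrite /= => ->.
  by rewrite -comp_assoc adj_tri1 comp_idr.
Qed.

(** Both [L X] and [k X] represent the morphisms from [X] to objects [q Z], the latter because
    [k ⊙ q] is an equivalence and [k] is bijective on these morphisms. That bijectivity is given for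
    the one object [X] only, so the inverse is built by hand instead of from a second adjunction. *)
Lemma unit_iso_of_reflection (A V W : Category) (q : Functor A V) (k : Functor V W)
    (L : Functor V A) (adj : Adjunction L q) (X : V) :
  fully_faithful (k ⊙ q) -> essentially_surjective (k ⊙ q) ->
  (forall Z (g : Hom (k X) (k (q Z))), exists! u : Hom X (q Z), fmap k u = g) ->
  is_iso (fmap k (adj_unit adj X)).
Proof.
move=> ff es det.
have [Z [e [e' [e1 e2]]]] := es (k X).
have [u [Hu _]] := det Z e'.
have [w [Hw _]] := adjunction_right_bijection adj u.
pose r := e ∘ fmap k (fmap q w).
have r1 : r ∘ fmap k (adj_unit adj X) = idc _.
  by rewrite /r -comp_assoc -fmap_comp Hw Hu.
exists r; split=> //.
have [v [Hv _]] := ff _ _ (fmap k (adj_unit adj X) ∘ r).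
have Ev : fmap q v ∘ adj_unit adj X = adj_unit adj X.
  apply: (unique_eq (det _ (fmap k (adj_unit adj X)))) => //.
  by rewrite fmap_comp; rewrite /= in Hv; rewrite Hv -comp_assoc r1 comp_idr.
rewrite -Hv; have -> : v = idc _.
  apply: (unique_eq (adjunction_right_bijection adj (adj_unit adj X))) => //.
  by rewrite fmap_id comp_idl.
by rewrite fmap_id.
Qed.

Lemma counit_iso_of_reflection (A V W : Category) (q : Functor A V) (k : Functor V W)
    (R : Functor V A) (adj : Adjunction q R) (X : V) :
  fully_faithful (k ⊙ q) -> essentially_surjective (k ⊙ q) ->
  (forall Z (g : Hom (k (q Z)) (k X)), exists! u : Hom (q Z) X, fmap k u = g) ->
  is_iso (fmap k (adj_counit adj X)).
Proof.
move=> ff es det.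
have [Z [e [e' [e1 e2]]]] := es (k X).
have [u [Hu _]] := det Z e.
have [w [Hw _]] := adjunction_left_bijection adj u.
pose r := fmap k (fmap q w) ∘ e'.
have r1 : fmap k (adj_counit adj X) ∘ r = idc _.
  by rewrite /r comp_assoc -fmap_comp Hw Hu.
exists r; split=> //.
have [v [Hv _]] := ff _ _ (r ∘ fmap k (adj_counit adj X)).
have Ev : adj_counit adj X ∘ fmap q v = adj_counit adj X.
  apply: (unique_eq (det _ (fmap k (adj_counit adj X)))) => //.
  by rewrite fmap_comp; rewrite /= in Hv; rewrite Hv comp_assoc r1 comp_idl.
rewrite -Hv; have -> : v = idc _.
  apply: (unique_eq (adjunction_left_bijection adj (adj_counit adj X))) => //.
  by rewrite fmap_id comp_idr.
by rewrite fmap_id.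
Qed.

Lemma identity_fmap_hcast (C D : Category) (F : Functor C D) (x y x' y' : C)
    (ex : x = x') (ey : y = y') (f : Hom x y) :
  is_identity (fmap F f) -> is_identity (fmap F (hcast ex ey f)).
Proof. by subst; rewrite /hcast /= comp_idl comp_idr. Qed.

(** * Colimits and limits computed at a point *)

Section Reflection.
Context {Dia : DiagramCategory} {E B : PreDerivator Dia} (P : PDMor E B).

(** No base object is named, so the notion makes sense when source and target lie over objects that
    are equal only by a proof. *)
Definition vertical (K : DiaOb Dia) (X Y : E K) (u : Hom X Y) : Prop :=
  is_identity (fmap (P K) u).

(* For V over q^* b, evaluation at k exhibits k^* V as the colimit (resp. limit)
   of V relative to the fibres over b. *)
Definition colim_at (K : DiaOb Dia) (q : Functor K (dpt (Dia := Dia))) (k : K)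
    (V : E K) (Z : E dpt) : Prop :=
  forall g : Hom (ev E k V) (ev E k (pd_map E q Z)), vertical g ->
  exists! u : Hom V (pd_map E q Z), vertical u /\ fmap (ev E k) u = g.

Definition lim_at (K : DiaOb Dia) (q : Functor K (dpt (Dia := Dia))) (k : K)
    (V : E K) (Z : E dpt) : Prop :=
  forall g : Hom (ev E k (pd_map E q Z)) (ev E k V), vertical g ->
  exists! u : Hom (pd_map E q Z) V, vertical u /\ fmap (ev E k) u = g.

Lemma vertical_arrow (K : DiaOb Dia) (X Y X' Y' : E K) (u : Hom X Y)
    (u' : Hom X' Y') : Arrow u = Arrow u' -> vertical u -> vertical u'.
Proof. by move=> e; apply: identity_arrow; apply: arrow_fmap. Qed.

Lemma vertical_comp (K : DiaOb Dia) (X Y Z : E K) (v : Hom Y Z) (u : Hom X Y) :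
  vertical v -> vertical u -> vertical (v ∘ u).
Proof. by move=> Hv Hu; rewrite /vertical fmap_comp; apply: identity_comp. Qed.

Lemma vertical_2_const (K : DiaOb Dia) (q : Functor K (dpt (Dia := Dia)))
    (b : B dpt) (V : E K) (L : DiaOb Dia) (f g : Functor L K) (t : NatTrans f g) :
  P K V = pd_map B q b -> vertical (pd_2 E t V).
Proof.
move=> e; apply: (identity_arrow (eq_sym (pm_2 P t V))); rewrite e.
apply: (identity_arrow (pd_whiskL q t b)); exact: pd_2_point_identity.
Qed.

Section Retract.
Context (M K : DiaOb Dia) (lam : Functor K M) (rho : Functor M K).
Context (lr : lam ⊙ rho = idF M) (T : Functor K K) (TE : T = rho ⊙ lam).
Context (q : Functor K (dpt (Dia := Dia))) (b : B dpt) (V : E K) (Z : E dpt).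
Context (PV : P K V = pd_map B q b).

Lemma retract_back (X Y : E M) (X' Y' : E K) (v : Hom X Y) (u : Hom X' Y') :
  Arrow u = Arrow (fmap (pd_map E lam) v) ->
  Arrow (fmap (pd_map E rho) u) = Arrow v.
Proof.
move=> e; rewrite (arrow_fmap (pd_map E rho) e) pd_map_comp.
by rewrite (fmap_arrow_eq v (f_equal (@pd_map _ E M M) lr)) pd_map_id.
Qed.

Lemma retract_ob (X : E K) : pd_map E lam (pd_map E rho X) = pd_map E T X.
Proof. by rewrite pd_map_comp_ob TE. Qed.

(** [eta] behaves like the unit of an adjunction with [rho] on the right, along which colimits do
    not change. A morphism from the restriction of [V] to a constant object extends by
    precomposition with [eta]; it is determined by its restriction along [rho] because [eta] acts as
    an identity on constant objects. [T] is kept apart from [rho ⊙ lam] because in the application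
    the two agree only by a proof. *)
Lemma colim_at_retract (eta : NatTrans (idF K) T) (n : M) :
  (forall m, is_identity (eta (rho m))) ->
  colim_at (q ⊙ rho) n (pd_map E rho V) Z -> colim_at q (rho n) V Z.
Proof.
move=> Heta H g Hg.
have e0 : ev E (rho n) V = ev E n (pd_map E rho V) by rewrite ev_map_ob.
have e1 : ev E (rho n) (pd_map E q Z) =
    ev E n (@pd_map _ E M dpt (q ⊙ rho) Z) by rewrite !ev_const_ob.
have eq0 : pd_map E rho (pd_map E q Z) = @pd_map _ E M dpt (q ⊙ rho) Z.
  by rewrite pd_map_comp_ob.
have [u' [[Vu' Hu'] U']] := H (hcast e0 e1 g)
  (vertical_arrow (eq_sym (hcast_arrow _ _ _)) Hg).
have eq1 : pd_map E lam (@pd_map _ E M dpt (q ⊙ rho) Z) = pd_map E q Z.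
  rewrite pd_map_comp_ob; congr (fobj _ Z); congr (pd_map E _).
  by rewrite (functor_to_point_eq q); apply: functor_to_point_eq.
pose c := hcast (pd_map_id_ob V) (eq_sym (retract_ob V)) (pd_2 E eta V).
pose u := hcast eq_refl eq1 (fmap (pd_map E lam) u') ∘ c.
have Vu : vertical u.
  apply: vertical_comp.
    apply: (vertical_arrow (eq_sym (hcast_arrow _ _ _))); exact: vertical_map.
  apply: (vertical_arrow (eq_sym (hcast_arrow _ _ _))).
  exact: vertical_2_const PV.
have Ru : Arrow (fmap (pd_map E rho) u) = Arrow u'.
  rewrite /u fmap_comp identity_comp_r.
    rewrite /c; apply: identity_fmap_hcast.
    apply: (identity_arrow (pd_whiskR eta rho V)).
    by apply: pd_2_identity.
  apply: retract_back; exact: hcast_arrow.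
exists u; split.
  split=> //; apply: arrow_inj; rewrite -ev_map (arrow_fmap (ev E n) Ru) Hu'.
  exact: hcast_arrow.
move=> v [Vv Hv].
have {}U' : u' = hcast eq_refl eq0 (fmap (pd_map E rho) v).
  apply: U'; split.
    apply: (vertical_arrow (eq_sym (hcast_arrow _ _ _))); exact: vertical_map.
  apply: arrow_inj; rewrite (arrow_fmap _ (hcast_arrow _ _ _)) ev_map Hv.
  by rewrite hcast_arrow.
have Rv : fmap (pd_map E rho) u = fmap (pd_map E rho) v.
  by apply: arrow_inj; rewrite Ru U' hcast_arrow.
have Tv : fmap (pd_map E T) u = fmap (pd_map E T) v.
  by apply: arrow_inj; rewrite TE -!pd_map_comp Rv.
have Hq : is_identity (pd_2 E eta (pd_map E q Z)).
  apply: (identity_arrow (pd_whiskL q eta Z)); exact: pd_2_point_identity.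
apply: arrow_inj; rewrite -(pd_map_id u) -(pd_map_id v); congr Arrow.
apply: (iso_mono (identity_iso Hq)); by rewrite !nt_nat Tv.
Qed.

(** Dually, morphisms out of a constant object extend by composition with [eps], which also acts as
    an identity on constant objects. *)
Lemma lim_at_retract (eps : NatTrans T (idF K)) (n : M) :
  (forall m, is_identity (eps (rho m))) ->
  lim_at (q ⊙ rho) n (pd_map E rho V) Z -> lim_at q (rho n) V Z.
Proof.
move=> Heps H g Hg.
have e0 : ev E (rho n) V = ev E n (pd_map E rho V) by rewrite ev_map_ob.
have e1 : ev E (rho n) (pd_map E q Z) =
    ev E n (@pd_map _ E M dpt (q ⊙ rho) Z) by rewrite !ev_const_ob.
have eq0 : pd_map E rho (pd_map E q Z) = @pd_map _ E M dpt (q ⊙ rho) Z.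
  by rewrite pd_map_comp_ob.
have [u' [[Vu' Hu'] U']] := H (hcast e1 e0 g)
  (vertical_arrow (eq_sym (hcast_arrow _ _ _)) Hg).
have eq1 : pd_map E lam (@pd_map _ E M dpt (q ⊙ rho) Z) = pd_map E q Z.
  rewrite pd_map_comp_ob; congr (fobj _ Z); congr (pd_map E _).
  by rewrite (functor_to_point_eq q); apply: functor_to_point_eq.
pose c := hcast (eq_sym (retract_ob V)) (pd_map_id_ob V) (pd_2 E eps V).
pose u := c ∘ hcast eq1 eq_refl (fmap (pd_map E lam) u').
have Vu : vertical u.
  apply: vertical_comp.
    apply: (vertical_arrow (eq_sym (hcast_arrow _ _ _))).
    exact: vertical_2_const PV.
  apply: (vertical_arrow (eq_sym (hcast_arrow _ _ _))); exact: vertical_map.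
have Ru : Arrow (fmap (pd_map E rho) u) = Arrow u'.
  rewrite /u fmap_comp identity_comp_l.
    rewrite /c; apply: identity_fmap_hcast.
    apply: (identity_arrow (pd_whiskR eps rho V)).
    by apply: pd_2_identity.
  apply: retract_back; exact: hcast_arrow.
exists u; split.
  split=> //; apply: arrow_inj; rewrite -ev_map (arrow_fmap (ev E n) Ru) Hu'.
  exact: hcast_arrow.
move=> v [Vv Hv].
have {}U' : u' = hcast eq0 eq_refl (fmap (pd_map E rho) v).
  apply: U'; split.
    apply: (vertical_arrow (eq_sym (hcast_arrow _ _ _))); exact: vertical_map.
  apply: arrow_inj; rewrite (arrow_fmap _ (hcast_arrow _ _ _)) ev_map Hv.
  by rewrite hcast_arrow.
have Rv : fmap (pd_map E rho) u = fmap (pd_map E rho) v.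
  by apply: arrow_inj; rewrite Ru U' hcast_arrow.
have Tv : fmap (pd_map E T) u = fmap (pd_map E T) v.
  by apply: arrow_inj; rewrite TE -!pd_map_comp Rv.
have Hq : is_identity (pd_2 E eps (pd_map E q Z)).
  apply: (identity_arrow (pd_whiskL q eps Z)); exact: pd_2_point_identity.
apply: arrow_inj; rewrite -(pd_map_id u) -(pd_map_id v); congr Arrow.
apply: (iso_epi (identity_iso Hq)); by rewrite -!nt_nat Tv.
Qed.
End Retract.

(** * (N5) as a statement about colimits and limits at a point *)

Section EnlargementReflection.
Context {Dia0 : DiagramCategory} (N : EnlFunctor Dia0 Dia) (b : B dpt).
Context (F1 : pd_der1 (fibre_pd P b)) (F2 : pd_der2 (fibre_pd P b)).

Lemma fibre_pd_cart (I : DiaOb Dia0) (V : E (N I))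
    (PV : P _ V = @pd_map _ B (N I) dpt (bang _) b) :
  pd_cart (enl_pi N I) V ->
  pd_cart (E := fibre_pd P b) (enl_pi N I) (exist _ V PV).
Proof. by move=> H k k' m /H Hm; apply/fib_iso. Qed.

Lemma fibre_pd_point_ob (Z : E dpt) :
  P dpt Z = b -> P dpt Z = @pd_map _ B dpt dpt (bang _) b.
Proof.
by move=> ->; rewrite -(functor_to_point_eq (idF PtCat)) pd_map_id_ob.
Qed.

(** The counit is an identity, so the adjunction bijection of (N5 left), applied to the fibres over
    [b], is nothing but evaluation at [n]. *)
Lemma N5_colim_at (I : DiaOb Dia0) (i : I) : N5_left N -> is_final i ->
  exists n : N I, enl_pi N I n = i /\
  forall (q : Functor (N I) (dpt (Dia := Dia))) (V : E (N I)) (Z : E dpt),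
    P _ V = pd_map B q b -> P _ Z = b -> pd_cart (enl_pi N I) V -> colim_at q n V Z.
Proof.
move=> N5 Hi; have [n [Hn [A [Hc _]]]] := N5 (fibre_pd P b) F1 F2 I i Hi.
exists n; split=> // q V Z; rewrite (functor_to_point_eq q) => PV PZ HV g Hg.
pose V' : FullSub (pd_cart (E := fibre_pd P b) (enl_pi N I)) :=
  exist _ (exist _ V PV) (fibre_pd_cart PV HV).
pose Z' : fibre_pd P b dpt := exist _ Z (fibre_pd_point_ob PZ).
have Hg' : Arrow (fmap (P dpt) g) = Arrow (idc (@pd_map _ B dpt dpt (bang _) b)).
  apply: vertical_over Hg; rewrite pm_map_ob PV pd_map_comp_ob.
  by rewrite bang_comp.
pose g' : Hom (eval_at (fibre_pd P b) (enl_pi N I) n V')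
    (eval_at (fibre_pd P b) (enl_pi N I) n
       (const_diag (fibre_pd P b) (enl_pi N I) Z')) := exist _ g Hg'.
have Ic : is_iso (adj_counit A Z') := is_iso_arrow (eq_sym (Hc Z')) (@iso_idc _ _).
have [u [Hu U]] := adjunction_left_bijection A (adj_counit A Z' ∘ g').
have {}Hu := iso_mono Ic Hu.
exists ⌊u⌋; split.
  split; first by exists (@pd_map _ B (N I) dpt (bang _) b); exact: (proj2_sig u).
  exact: (f_equal (@proj1_sig _ _) Hu).
move=> v [Vv Hv].
have Vv' := vertical_over PV Vv.
pose v' : Hom V' (const_diag (fibre_pd P b) (enl_pi N I) Z') := exist _ v Vv'.
have -> // : u = v'.
apply: U; congr comp; exact: fc_hom_eq.
Qed.

Lemma N5_lim_at (I : DiaOb Dia0) (i : I) : N5_right N -> is_initial i ->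
  exists n : N I, enl_pi N I n = i /\
  forall (q : Functor (N I) (dpt (Dia := Dia))) (V : E (N I)) (Z : E dpt),
    P _ V = pd_map B q b -> P _ Z = b -> pd_cart (enl_pi N I) V -> lim_at q n V Z.
Proof.
move=> N5 Hi; have [n [Hn [A [Hc _]]]] := N5 (fibre_pd P b) F1 F2 I i Hi.
exists n; split=> // q V Z; rewrite (functor_to_point_eq q) => PV PZ HV g Hg.
pose V' : FullSub (pd_cart (E := fibre_pd P b) (enl_pi N I)) :=
  exist _ (exist _ V PV) (fibre_pd_cart PV HV).
pose Z' : fibre_pd P b dpt := exist _ Z (fibre_pd_point_ob PZ).
have PZ' : P _ (@pd_map _ E (N I) dpt (bang _) Z) = @pd_map _ B (N I) dpt (bang _) b.
  by rewrite pm_map_ob PZ.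
have Hg' : Arrow (fmap (P dpt) g) = Arrow (idc (@pd_map _ B dpt dpt (bang _) b)).
  apply: vertical_over Hg; rewrite pm_map_ob PZ' pd_map_comp_ob.
  by rewrite bang_comp.
pose g' : Hom (eval_at (fibre_pd P b) (enl_pi N I) n
       (const_diag (fibre_pd P b) (enl_pi N I) Z'))
    (eval_at (fibre_pd P b) (enl_pi N I) n V') := exist _ g Hg'.
have Ic : is_iso (adj_unit A Z') := is_iso_arrow (eq_sym (Hc Z')) (@iso_idc _ _).
have [u [Hu U]] := adjunction_right_bijection A (g' ∘ adj_unit A Z').
have {}Hu := iso_epi Ic Hu.
exists ⌊u⌋; split.
  split; first by exists (@pd_map _ B (N I) dpt (bang _) b); exact: (proj2_sig u).
  exact: (f_equal (@proj1_sig _ _) Hu).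
move=> v [Vv Hv].
have Vv' := vertical_over PZ' Vv.
pose v' : Hom (const_diag (fibre_pd P b) (enl_pi N I) Z') V' := exist _ v Vv'.
have -> // : u = v'.
apply: U; congr comp; exact: fc_hom_eq.
Qed.
End EnlargementReflection.
End Reflection.

(** * Evaluation at a point preserves Cartesian arrows *)

Section InitialTranspose.
Context {Dia : DiagramCategory} (E : PreDerivator Dia).
Context (M : DiaOb Dia) (e : M).
Context (eps : NatTrans (pointF e ⊙ bang M) (idF M)).
Let q : Functor M (dpt (Dia := Dia)) := bang M.

Lemma init_counit_ob (T : E M) :
  @pd_map _ E M M (pointF e ⊙ bang M) T = pd_map E q (ev E e T).
Proof. by rewrite /ev pd_map_comp_ob. Qed.

(** When [e] is initial, evaluation at [e] is right adjoint to the formation of constant objects.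
    This counit comes from the 2-cell [eps] alone, hence exists in any pre-derivator, in particular
    in the base. *)
Definition init_counit (T : E M) : Hom (pd_map E q (ev E e T)) T :=
  hcast (init_counit_ob T) (pd_map_id_ob T) (@pd_2 _ E M M _ _ eps T).

Definition transpose (G : E dpt) (T : E M) (h : Hom G (ev E e T)) :
  Hom (pd_map E q G) T := init_counit T ∘ fmap (pd_map E q) h.

Lemma transpose_nat (V Z : E M) (xi : Hom V Z) (G : E dpt) (h : Hom G (ev E e V)) :
  xi ∘ transpose h = transpose (fmap (ev E e) xi ∘ h).
Proof.
rewrite /transpose fmap_comp [LHS]comp_assoc [RHS]comp_assoc; congr comp.
apply: arrow_inj; pose t := @pd_2 _ E M M _ _ eps.
have e1 := arrow_comp (hcast_arrow (init_counit_ob V) (pd_map_id_ob V) (t V))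
  (eq_sym (pd_map_id xi)).
have e2 := arrow_comp (@pd_map_comp _ E M dpt M (pointF e) q _ _ xi)
  (hcast_arrow (init_counit_ob Z) (pd_map_id_ob Z) (t Z)).
refine (eq_trans e1 (eq_trans _ (eq_sym e2))).
congr Arrow; exact: eq_sym (nt_nat t xi).
Qed.

Lemma ev_transpose (G : E dpt) (T : E M) (h : Hom G (ev E e T)) :
  is_identity (eps e) -> Arrow (fmap (ev E e) (transpose h)) = Arrow h.
Proof.
move=> He; rewrite fmap_comp identity_comp_l; last exact: ev_const.
apply: identity_fmap_hcast.
apply: (identity_arrow (eq_sym (ev_2 eps e T))); exact: tr_identity.
Qed.
End InitialTranspose.

Section CartesianAtPoint.
Context {Dia : DiagramCategory} {E B : PreDerivator Dia} (P : PDMor E B).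

Lemma pm_transpose (M : DiaOb Dia) (e : M)
    (eps : NatTrans (pointF e ⊙ bang M) (idF M)) (G : E dpt) (T : E M)
    (h : Hom G (ev E e T)) (G' : B dpt) (T' : B M) (h' : Hom G' (ev B e T')) :
  T' = P M T -> Arrow h' = Arrow (fmap (P dpt) h) ->
  Arrow (fmap (P M) (transpose eps h)) = Arrow (transpose eps h').
Proof.
move=> eT; subst T' => eh; rewrite /transpose fmap_comp; apply: arrow_comp.
- by rewrite pm_map (arrow_fmap _ eh).
- by rewrite (arrow_fmap _ (hcast_arrow _ _ _)) hcast_arrow pm_2.
Qed.

(** Transposition turns a lifting problem at [e] into one on [M] with constant source, upstairs and
    in the base simultaneously; the solution on [M] is then evaluated back at [e]. *)
Lemma initial_cart_arrow (M : DiaOb Dia) (e : M) (V Z : E M) (xi : Hom V Z) :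
  is_initial e -> cart_arrow (P M) xi -> cart_arrow (P dpt) (fmap (ev E e) xi).
Proof.
move=> He Hxi G w g Hw.
have ch (y : M) : {f : Hom e y | forall f' : Hom e y, f' = f}.
  have [f [_ U]] := constructive_indefinite_description _ (He y).
  by exists f => f'; rewrite (U f').
have nat (x y : M) (f : Hom x y) :
    proj1_sig (ch y) ∘ fmap (pointF e ⊙ bang M) f = fmap (idF M) f ∘ proj1_sig (ch x).
  by rewrite !(proj2_sig (ch y) (_ ∘ _)).
pose eps : NatTrans (pointF e ⊙ bang M) (idF M) :=
  @Build_NatTrans M M (pointF e ⊙ bang M) (idF M) (fun y => proj1_sig (ch y)) nat.
have Heps : is_identity (eps e).
  by rewrite /eps /= -(proj2_sig (ch e) (idc e)); apply: identity_idc.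
pose g' := hcast eq_refl (@pm_map_ob _ E B P dpt M (pointF e) V) g.
have g'E : Arrow g' = Arrow g := hcast_arrow _ _ _.
pose g2 := hcast (eq_sym (@pm_map_ob _ E B P M dpt (bang M) G)) eq_refl (transpose eps g').
have g2E : Arrow g2 = Arrow (transpose eps g') := hcast_arrow _ _ _.
have HW : fmap (P M) (transpose eps w) = fmap (P M) xi ∘ g2.
  apply: arrow_inj.
  rewrite (arrow_comp g2E (eq_refl (Arrow (fmap (P M) xi)))) transpose_nat.
  apply: pm_transpose => //; rewrite Hw; apply: arrow_comp => //.
  by rewrite [RHS]pm_map.
have [v [[Pv xv] U]] := Hxi _ _ _ HW.
pose h := hcast (@ev_const_ob _ E M (bang M) e G) eq_refl (fmap (ev E e) v).
have hE : Arrow h = Arrow (fmap (ev E e) v) := hcast_arrow _ _ _.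
exists h; split; [split|].
- apply: arrow_inj; rewrite (arrow_fmap _ hE) pm_map Pv (arrow_fmap _ g2E).
  by rewrite -g'E; apply: ev_transpose.
- apply: arrow_inj.
  rewrite (arrow_comp hE (eq_refl (Arrow (fmap (ev E e) xi)))) -fmap_comp xv.
  exact: ev_transpose.
- move=> h2 [h2P h2x]; apply: arrow_inj; rewrite hE (U (transpose eps h2)).
    split; last by rewrite transpose_nat h2x.
    apply: arrow_inj; rewrite g2E; apply: pm_transpose => //.
    by rewrite g'E h2P.
  exact: ev_transpose.
Qed.

Definition under_id_initial (K : DiaOb Dia) (k : K) : dunder (idF K) k :=
  @CommaOb PtCat K K (pointF k) (idF K) tt k (idc k).

Lemma under_id_is_initial (K : DiaOb Dia) (k : K) : is_initial (under_id_initial k).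
Proof.
move=> [[] k' h].
unshelve eexists; first by exists (tt, h); rewrite /= !comp_idr.
split=> // -[[[] h'] H'] _; apply: comma_hom_eq; rewrite /=.
by move: H'; rewrite /= !comp_idr => ->.
Qed.

Lemma under_id_opfibration (K : DiaOb Dia) (k : K) :
  opfibration (comma_snd (pointF k) (idF K)).
Proof.
move=> [[] k' h] k'' f.
exists (@CommaOb PtCat K K (pointF k) (idF K) tt k'' (f ∘ h)).
unshelve eexists; first by exists (tt, f); rewrite /= comp_idr.
split=> // -[[] k3 h3] [[[] w] Hw] g /= e.
unshelve eexists.
  exists (tt, g); rewrite /= comp_idr comp_assoc -e.
  by move: Hw; rewrite /= comp_idr.
split; first by split=> //; apply: comma_hom_eq; rewrite /= e.
by move=> [[[] v] Hv] [ev _]; apply: comma_hom_eq; rewrite /= -ev.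
Qed.

Lemma ev_cart_arrow (K : DiaOb Dia) (k : K) (V Z : E K) (xi : Hom V Z) :
  (forall (I : DiaOb Dia) (a : Functor I K),
     opfibration a -> cart_arrow (P I) (fmap (pd_map E a) xi)) ->
  cart_arrow (P dpt) (fmap (ev E k) xi).
Proof.
move=> H.
pose a : Functor (dunder (idF K) k) K := comma_snd (pointF k) (idF K).
apply: (cart_arrow_eq (ev_map a (under_id_initial k) xi)).
apply: initial_cart_arrow; first exact: under_id_is_initial.
apply: H => //; exact: under_id_opfibration.
Qed.
End CartesianAtPoint.

(** * Kan extensions at a point *)

Lemma cocartesian_und (C D : Multicategory) (p : MFunctor C D) (x y : C)
    (u : mhom [x] y) :
  cocartesian p u -> @cocartesian_arrow (und C) (und D) (undF p) x y u.
Proof.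
move=> Hu z w g e; have := Hu [] [] z g w; rewrite /= => H'.
have [|v [[v1 v2] U]] := H'; first by rewrite [LHS]e; apply: mcomp_cast'.
exists v; split; first by rewrite mcast_refl in v1.
by move=> v' [e1 e2]; apply: U; rewrite mcast_refl.
Qed.

Lemma cartesian_und (C D : Multicategory) (p : MFunctor C D) (x y : C)
    (u : mhom [x] y) :
  @cartesian C D p [] x [] y u -> @cart_arrow (und C) (und D) (undF p) x y u.
Proof.
move=> Hu z w g e; have [|v [[v1 v2] U]] := Hu [z] g w.
  by rewrite [LHS]e; apply: mcomp_cast'.
by exists v; split=> // v' [e1 e2]; apply: U.
Qed.

(** The shape of the equation displayed in [fder4_left]: once the other six arrows become
    invertible, so does the unit in the last place. *)
Lemma iso_fmap_last_factor (C D : Category) (F : Functor C D) (x1 x2 x3 x4 y1 y2 y3 : C)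
    (a : Hom x3 x4) (u : Hom x2 x3) (w : Hom x1 x2)
    (e1 : Hom y3 x4) (m : Hom y2 y3) (e2 : Hom y1 y2) (i : Hom x1 y1) :
  a ∘ u ∘ w = e1 ∘ m ∘ e2 ∘ i ->
  is_iso (fmap F a) -> is_iso (fmap F u) -> is_iso (fmap F w) ->
  is_iso (fmap F e1) -> is_iso (fmap F m) -> is_iso (fmap F e2) ->
  is_iso (fmap F i).
Proof.
move=> He Ha Hu Hw H1 Hm H2.
apply: (iso_cancel_l (g := fmap F (e1 ∘ m ∘ e2))).
  by rewrite !fmap_comp; apply: iso_comp H2; apply: iso_comp.
by rewrite -fmap_comp -He !fmap_comp; apply: iso_comp Hw; apply: iso_comp.
Qed.

Lemma iso_fmap_first_factor (C D : Category) (F : Functor C D) (x1 x2 x3 x4 y1 y2 y3 : C)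
    (w : Hom x3 x4) (u : Hom x2 x3) (a : Hom x1 x2)
    (i : Hom y3 x4) (e1 : Hom y2 y3) (m : Hom y1 y2) (e2 : Hom x1 y1) :
  w ∘ u ∘ a = i ∘ e1 ∘ m ∘ e2 ->
  is_iso (fmap F a) -> is_iso (fmap F u) -> is_iso (fmap F w) ->
  is_iso (fmap F e1) -> is_iso (fmap F m) -> is_iso (fmap F e2) ->
  is_iso (fmap F i).
Proof.
move=> He Ha Hu Hw H1 Hm H2.
apply: (iso_cancel_r (f := fmap F (e1 ∘ (m ∘ e2)))).
  by rewrite !fmap_comp; apply: iso_comp => //; apply: iso_comp.
rewrite -fmap_comp 2!comp_assoc -He !fmap_comp.
by apply: iso_comp Ha; apply: iso_comp.
Qed.

Section FibreReflection.
Context (C0 C1 B0 B1 : Category) (P0 : Functor C0 B0) (P1 : Functor C1 B1).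
Context (q : Functor C0 C1) (q' : Functor B0 B1) (sqq : P1 ⊙ q = q' ⊙ P0).
Context (k : Functor C1 C0) (k' : Functor B1 B0) (sqk : P0 ⊙ k = k' ⊙ P1).
Context (kq : k ⊙ q = idF C0) (kq' : k' ⊙ q' = idF B0).
Context (b0 : B0) (b1 : B1) (e : q' b0 = b1).
Let FQ : Functor (FibCat P0 b0) (FibCat P1 b1) := fib_map sqq e.
Let FK : Functor (FibCat P1 b1) (FibCat P0 (k' b1)) := fib_map sqk eq_refl.

Lemma fibre_section_fully_faithful : fully_faithful (FK ⊙ FQ).
Proof.
move=> Z Z' g.
have E (x : C0) : k (q x) = x := functor_arrow_ob x kq.
pose g' := hcast (E ⌊Z⌋) (E ⌊Z'⌋) ⌊g⌋.
have g'E : Arrow g' = Arrow ⌊g⌋ := hcast_arrow _ _ _.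
have Vg' : Arrow (fmap P0 g') = Arrow (idc b0).
  apply: (vertical_over (proj2_sig Z)).
  apply: (identity_arrow (arrow_fmap P0 (eq_sym g'E))); exact: fib_vertical g.
exists (exist _ g' Vg'); split.
- apply: fc_hom_eq; apply: arrow_inj; rewrite -g'E.
  exact: (fmap_arrow_eq g' kq).
- move=> f Hf; apply: fc_hom_eq; apply: arrow_inj; rewrite /= g'E -Hf.
  exact: (fmap_arrow_eq ⌊f⌋ kq).
Qed.

Lemma fibre_section_essentially_surjective : essentially_surjective (FK ⊙ FQ).
Proof.
move=> Y.
have eY : P0 ⌊Y⌋ = b0.
  by rewrite (proj2_sig Y) -e; apply: (functor_arrow_ob b0 kq').
exists (exist _ ⌊Y⌋ eY).
pose Z := (FK ⊙ FQ) (exist _ ⌊Y⌋ eY).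
have eZ : Z = Y by apply: fib_ob_eq; apply: (functor_arrow_ob ⌊Y⌋ kq).
rewrite -/Z eZ; exists (idc Y); exact: iso_idc.
Qed.

(** Constant objects form a section of evaluation on the fibres too. The hypothesis is spelled out
    through vertical morphisms of the total categories so that [colim_at] fits it. *)
Lemma fibre_unit_iso (L : Functor (FibCat P1 b1) (FibCat P0 b0))
    (adj : Adjunction L FQ) (X : FibCat P1 b1) :
  (forall Z, P0 Z = b0 ->
   forall g : Hom (k ⌊X⌋) (k (q Z)), is_identity (fmap P0 g) ->
   exists! u : Hom ⌊X⌋ (q Z), is_identity (fmap P1 u) /\ fmap k u = g) ->
  is_iso (fmap k ⌊adj_unit adj X⌋).
Proof.
move=> det.
have H : is_iso (fmap FK (adj_unit adj X)); last exact: (proj2 (fib_iso _) H).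
apply: unit_iso_of_reflection.
    exact: fibre_section_fully_faithful.
  exact: fibre_section_essentially_surjective.
move=> Z g.
have [u [[Vu Hu] U]] := det ⌊Z⌋ (proj2_sig Z) ⌊g⌋ (fib_vertical g).
exists (exist _ u (vertical_over (proj2_sig X) Vu)); split; first exact: fc_hom_eq.
move=> v Hv; apply: fc_hom_eq; apply: U; split; first exact: fib_vertical v.
by rewrite -Hv.
Qed.

Lemma fibre_counit_iso (R : Functor (FibCat P1 b1) (FibCat P0 b0))
    (adj : Adjunction FQ R) (X : FibCat P1 b1) :
  (forall Z, P0 Z = b0 ->
   forall g : Hom (k (q Z)) (k ⌊X⌋), is_identity (fmap P0 g) ->
   exists! u : Hom (q Z) ⌊X⌋, is_identity (fmap P1 u) /\ fmap k u = g) ->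
  is_iso (fmap k ⌊adj_counit adj X⌋).
Proof.
move=> det.
have H : is_iso (fmap FK (adj_counit adj X)); last exact: (proj2 (fib_iso _) H).
apply: counit_iso_of_reflection.
    exact: fibre_section_fully_faithful.
  exact: fibre_section_essentially_surjective.
move=> Z g.
have [u [[Vu Hu] U]] := det ⌊Z⌋ (proj2_sig Z) ⌊g⌋ (fib_vertical g).
have PZ := proj2_sig (FQ Z).
exists (exist _ u (vertical_over PZ Vu)); split; first exact: fc_hom_eq.
move=> v Hv; apply: fc_hom_eq; apply: U; split; first exact: fib_vertical v.
by rewrite -Hv.
Qed.
End FibreReflection.

Section KanPoint.
Context {Dia : DiagramCategory} {D S : PreMultiDerivator Dia} (p : MDMor D S).
Let E := underlying D.
Let B := underlying S.
Let P : PDMor E B := underlying_mor p.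

Lemma pull_adjoint_left (I J : DiaOb Dia) (a : Functor I J) (s : S J) (s' : S I)
    (e : md_map S a s = s') :
  fder3_left p -> exists L : Functor (Fib p s') (Fib p s),
    inhabited (Adjunction L (pull p e)).
Proof. by move=> H; subst s'; apply: H. Qed.

Lemma pull_adjoint_right (I J : DiaOb Dia) (a : Functor I J) (s : S J) (s' : S I)
    (e : md_map S a s = s') :
  fder3_right p -> exists R : Functor (Fib p s') (Fib p s),
    inhabited (Adjunction (pull p e) R).
Proof. by move=> H; subst s'; apply: H. Qed.

Lemma ev_const_id (A : PreDerivator Dia) (K : DiaOb Dia)
    (q : Functor K (dpt (Dia := Dia))) (k : K) :
  ev A k ⊙ pd_map A q = idF (A dpt).
Proof.
apply: functor_eq => [Z|Z Z' u]; [exact: ev_const_ob | exact: ev_const].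
Qed.

(** At [k] the 2-cell [mu] is an identity. Hence every arrow of the (FDer4 left) equation except the
    unit of [aA] becomes invertible there: the push-forward arrow because it is coCartesian over an
    identity, and the unit of [qA] by the colimit hypothesis. That hypothesis ranges over all
    candidates [V], as the push-forward is only chosen inside the proof. *)
Lemma fder4_left_unit_iso (I J : DiaOb Dia) (a : Functor I J) (j : J) (s : S J)
    (aL : Functor (Fib p (md_map S a s)) (Fib p s))
    (aA : Adjunction aL (pull0 p a s)) (X : Fib p (md_map S a s)) (k : dover a j) :
  fder0_left p -> fder3_left p -> fder4_left p -> is_identity (com_arr k) ->
  (forall V : E (dover a j),
     P _ V = @pd_map _ B (dover a j) J (pointF j ⊙ comma_snd a (pointF j)) s ->
     (exists c : Hom (@pd_map _ E (dover a j) I (comma_fst a (pointF j)) ⌊X⌋) V,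
        forall x, cocartesian_arrow (P dpt) (fmap (ev E x) c)) ->
     forall Z : E dpt, P _ Z = @pd_map _ B dpt J (pointF j) s ->
     colim_at P (comma_snd a (pointF j) : Functor (dover a j) dpt) k V Z) ->
  is_iso (fmap (ev E (com_l k)) (⌊adj_unit aA X⌋ : @Hom (und (D I)) _ _)).
Proof.
move=> [opf cocart] f3 f4 Hk det.
pose K := dover a j.
pose iota : Functor K I := comma_fst a (pointF j).
pose q : Functor K (@dpt Dia) := comma_snd a (pointF j).
pose jD : Functor (@dpt Dia) J := pointF j.
pose mu : @NatTrans K J (a ⊙ iota) (jD ⊙ q) := comma_nt a (pointF j).
have [qL [qA]] := pull_adjoint_left (eq_sym (@md_comp_ob _ S K dpt J jD q s)) f3.
have eX : map (p K) [md_map D iota ⌊X⌋] = [@md_map _ S K J (a ⊙ iota) s].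
  congr cons; rewrite [LHS](@pm_map_ob _ E B P K I iota) md_comp_ob.
  by congr (mfob _ _); apply: (proj2_sig X).
have [W] := opf K _ _ (@md_2 _ S K J _ _ mu s) _ eX.
have [phi [He Hphi]] := f4 I J a j s aL aA qL qA X W.
have Hc (x : K) : cocartesian_arrow (P dpt) (fmap (ev E x) (po_arr W : @Hom (und _) _ _)).
  refine (@cocartesian_und _ _ (p dpt) _ _ _
    (@cocart dpt K (pointF x) _ _ _ (@po_cocart _ _ _ _ _ _ _ W))).
have PW : P K ⌊po_ob W⌋ = @md_map _ S K J (jD ⊙ q) s := proj2_sig (po_ob W).
have Hu : is_iso (fmap (ev E k) (⌊adj_unit qA (po_ob W)⌋ : @Hom (und _) _ _)).
  apply: (fibre_unit_iso (k := ev E k) (k' := ev B k) (pm_nat P _)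
    (@ev_const_id E K q k) (@ev_const_id B K q k)) => Z PZ.
  exact (det ⌊po_ob W⌋ PW (ex_intro _ (po_arr W) Hc) Z PZ).
have Hmu : is_identity (fmap (ev E k)
    (@u2 _ D K J (a ⊙ iota) (jD ⊙ q) mu ⌊aL X⌋)).
  apply: (identity_arrow (eq_sym (@ev_2 _ E K J _ _ mu k ⌊aL X⌋))).
  exact: tr_identity.
have Hpo : is_iso (fmap (ev E k) (po_arr W : @Hom (und _) _ _)).
  apply: (cocartesian_arrow_over_iso (Hc k)); apply: identity_iso.
  apply: (identity_arrow (eq_sym (@pm_map _ E B P dpt K (pointF k) _ _ (po_arr W)))).
  apply: (identity_arrow (eq_sym (arrow_fmap (ev B k) (marrow_arrow (po_over W))))).
  apply: (identity_arrow (eq_sym (@ev_2 _ B K J _ _ mu k s))).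
  exact: tr_identity.
have Hphi' : is_iso (fmap (ev E k) (umap q ⌊phi⌋)).
  apply: iso_fmap; 
  apply: (@iso_fmap (und (D (@dpt Dia))) (und (D K)) (undF (md_map D q)) _ _ ⌊phi⌋).
  exact/fib_iso.
apply: (is_iso_arrow (@ev_map _ E K I iota k _ _ ⌊adj_unit aA X⌋)).
have Heq (X1 X2 : D K) (e : X1 = X2) : is_iso (fmap (ev E k) (ueq e)).
  by apply: iso_fmap; apply: identity_iso; apply: identity_eqhom.
exact (iso_fmap_last_factor He Hphi' Hu Hpo (Heq _ _ _) (identity_iso Hmu) (Heq _ _ _)).
Qed.

Lemma ev_cartesian (K : DiaOb Dia) (k : K) (V Z : D K) (xi : mhom [V] Z) :
  fder0_right p -> @cartesian _ _ (p K) [] V [] Z xi ->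
  cart_arrow (P dpt) (fmap (ev E k) (xi : @Hom (und (D K)) V Z)).
Proof.
move=> [_ cart] Hxi; apply: ev_cart_arrow => I a Ha.
have H := cart I K a Ha [] V [] Z xi Hxi.
rewrite mcast_refl in H; exact: (@cartesian_und _ _ (p I) _ _ _ H).
Qed.

Lemma fder4_right_counit_iso (I J : DiaOb Dia) (a : Functor I J) (j : J) (s : S J)
    (aR : Functor (Fib p (md_map S a s)) (Fib p s))
    (aA : Adjunction (pull0 p a s) aR) (X : Fib p (md_map S a s)) (k : dunder a j) :
  fder0_right p -> fder3_right p -> fder4_right p -> is_identity (com_arr k) ->
  (forall V : E (dunder a j),
     P _ V = @pd_map _ B (dunder a j) J (pointF j ⊙ comma_fst (pointF j) a) s ->
     (exists c : Hom V (@pd_map _ E (dunder a j) I (comma_snd (pointF j) a) ⌊X⌋),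
        forall x, cart_arrow (P dpt) (fmap (ev E x) c)) ->
     forall Z : E dpt, P _ Z = @pd_map _ B dpt J (pointF j) s ->
     lim_at P (comma_fst (pointF j) a : Functor (dunder a j) dpt) k V Z) ->
  is_iso (fmap (ev E (com_r k)) (⌊adj_counit aA X⌋ : @Hom (und (D I)) _ _)).
Proof.
move=> f0 f3 f4 Hk det.
pose K := dunder a j.
pose iota : Functor K I := comma_snd (pointF j) a.
pose q : Functor K (@dpt Dia) := comma_fst (pointF j) a.
pose jD : Functor (@dpt Dia) J := pointF j.
pose mu : @NatTrans K J (jD ⊙ q) (a ⊙ iota) := comma_nt (pointF j) a.
have [qR [qA]] := pull_adjoint_right (eq_sym (@md_comp_ob _ S K dpt J jD q s)) f3.
have h4 := f4 I J a j s aR aA qR qA X.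
(* The type of [W] is read off from [h4], so that its implicit arguments are those of (FDer4
   right). *)
have [W] : inhabited ltac:(match type of h4 with forall W : ?T, _ => exact T end).
  exact: (proj1 f0 K [] _ [] _ _ [] []).
destruct (h4 W) as [phi [He Hphi]].
pose w : @Hom (und (D K)) ⌊pb_ob W⌋ (md_map D iota ⌊X⌋) := pb_arr W.
have Hc (x : K) : cart_arrow (P dpt) (fmap (ev E x) w).
  by apply: ev_cartesian => //; refine (@pb_cart _ _ _ _ _ _ _ _ _ _ _ W).
have PW : P K ⌊pb_ob W⌋ = @md_map _ S K J (jD ⊙ q) s := proj2_sig (pb_ob W).
have Hu : is_iso (fmap (ev E k) (⌊adj_counit qA (pb_ob W)⌋ : @Hom (und _) _ _)).
  apply: (fibre_counit_iso (k := ev E k) (k' := ev B k) (pm_nat P _)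
    (@ev_const_id E K q k) (@ev_const_id B K q k)) => Z PZ.
  exact (det ⌊pb_ob W⌋ PW (ex_intro _ w Hc) Z PZ).
have Hmu : is_identity (fmap (ev E k)
    (@u2 _ D K J (jD ⊙ q) (a ⊙ iota) mu ⌊aR X⌋)).
  apply: (identity_arrow (eq_sym (@ev_2 _ E K J _ _ mu k ⌊aR X⌋))).
  exact: tr_identity.
have Hpo : is_iso (fmap (ev E k) w).
  apply: (cart_arrow_over_iso (Hc k)); apply: identity_iso.
  apply: (identity_arrow (eq_sym (@pm_map _ E B P dpt K (pointF k) _ _ w))).
  apply: (identity_arrow (eq_sym (arrow_fmap (ev B k) (marrow_arrow (pb_over W))))).
  apply: (identity_arrow (eq_sym (@ev_2 _ B K J _ _ mu k s))).
  exact: tr_identity.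
have Hphi' : is_iso (fmap (ev E k) (umap q ⌊phi⌋)).
  apply: iso_fmap.
  apply: (@iso_fmap (und (D (@dpt Dia))) (und (D K)) (undF (md_map D q)) _ _ ⌊phi⌋).
  exact/fib_iso.
apply: (is_iso_arrow (@ev_map _ E K I iota k _ _ ⌊adj_counit aA X⌋)).
have Heq (X1 X2 : D K) (e : X1 = X2) : is_iso (fmap (ev E k) (ueq e)).
  by apply: iso_fmap; apply: identity_iso; apply: identity_eqhom.
exact (iso_fmap_first_factor He Hphi' Hu Hpo (Heq _ _ _) (identity_iso Hmu) (Heq _ _ _)).
Qed.
End KanPoint.

(** * The correspondence between the two enlargements *)

Lemma comma_arrow (A B C : Category) (F : Functor A C) (G : Functor B C)
    (x y x' y' : Comma F G) (u : Hom x y) (u' : Hom x' y') :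
  x = x' -> y = y' -> Arrow (fst ⌊u⌋) = Arrow (fst ⌊u'⌋) ->
  Arrow (snd ⌊u⌋) = Arrow (snd ⌊u'⌋) -> Arrow u = Arrow u'.
Proof.
move=> ex ey; subst x' y' => /arrow_inj e1 /arrow_inj e2; congr Arrow.
by apply: comma_hom_eq; apply: injective_projections.
Qed.

Lemma comma_identity (A B C : Category) (F : Functor A C) (G : Functor B C)
    (x y : Comma F G) (u : Hom x y) :
  x = y -> is_identity (fst ⌊u⌋) -> is_identity (snd ⌊u⌋) -> is_identity u.
Proof.
move=> e; subst y => /identity_endo e1 /identity_endo e2.
exists x; congr Arrow; apply: comma_hom_eq; exact: injective_projections.
Qed.

Lemma mcomp_cancel (C : Multicategory) (x y : C) (u : mhom [x] y) (u' : mhom [y] x)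
    (Δ Γ : list C) (g : mhom Δ x) (e1 : [y] = [] ++ [y]) (e2 : Δ = [] ++ Γ ++ [])
    (e3 : [x] = [] ++ [x]) (e4 : Γ = [] ++ Δ ++ []) :
  @comp (und C) x y x u' u = mid x ->
  mcomp [] [] e1 e2 u' (mcomp [] [] e3 e4 u g) = g.
Proof.
move=> e.
have a4 : Δ = [] ++ Δ ++ [] by rewrite /= app_nil_r.
rewrite -(@mcomp_assoc C [] [] [y] [] [] [x] Δ [x] Γ Δ x y x u' u g e1 eq_refl
  eq_refl a4 e3 e4 e1 e2).
have -> : mcomp [] [] e1 eq_refl u' u = mid x by rewrite -e; apply: mcomp_cast'.
exact: mcomp_idl.
Qed.

Lemma iso_cartesian (C D : Multicategory) (p : MFunctor C D) (x y : C)
    (u : mhom [x] y) :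
  @is_iso (und C) x y u -> @cartesian C D p [] x [] y u.
Proof.
move=> [u' [e1 e2]] Gs g h Hh.
have eG : Gs = [] ++ (Gs ++ []) ++ [] by rewrite /= !app_nil_r.
have eG' : map p Gs = [] ++ map p (Gs ++ []) ++ [] by rewrite /= !app_nil_r.
exists (@mcomp C [] [] [y] (Gs ++ []) Gs y x eq_refl eG u' h); split; first split.
- rewrite (mfmap_comp eq_refl eG eq_refl eG') Hh.
  apply: mcomp_cancel.
  by have := @fmap_id (und C) (und D) (undF p) x; rewrite -e1 fmap_comp.
- exact: mcomp_cancel.
- by move=> h' [_ <-]; apply: mcomp_cancel.
Qed.

Section Enlargements.
Context {Dia' Dia : DiagramCategory} (H : sub_dia Dia' Dia).
Context (S : PreMultiDerivator Dia) (D : PreMultiDerivator Dia').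
Context (p : MDMor D (md_restrict H S)).
Let E := underlying D.
Let B := underlying (md_restrict H S).
Let P : PDMor E B := underlying_mor p.

(** [I] need not lie in [Dia'], so the pull-back is formed in [S] on the larger domain and only then
    regarded as an object of the restriction. *)
Definition base_pull (K : DiaOb Dia') (I : DiaOb Dia) (f : Functor K I) (s : S I) :
  B K := @md_map Dia S (dincl H K) I f s.

Lemma base_pull_comp (K L : DiaOb Dia') (I : DiaOb Dia) (f : Functor L I)
    (g : Functor K L) (s : S I) :
  pd_map B g (base_pull f s) = base_pull (f ⊙ g) s.
Proof. exact: eq_sym (@md_comp_ob _ S (dincl H K) (dincl H L) I f g s). Qed.

Lemma base_tr_arrow (K : DiaOb Dia') (I : DiaOb Dia) (f : Functor K I) (s : S I)
    (k k' : K) (m : Hom k k') :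
  Arrow (tr (E := B) m (base_pull f s)) =
  Arrow (@pd_2 Dia (underlying S) (dincl H dpt) I _ _ (pointNT (fmap f m)) s
         : @Hom (B dpt) _ _).
Proof.
have e := @pd_whiskL _ (underlying S) (dincl H dpt) (dincl H K) I f _ _
  (pointNT m) s.
rewrite -[LHS]e.
by apply: (@pd_2_eq _ (underlying S) (dincl H dpt) I); rewrite ?pointF_comp.
Qed.

Lemma base_tr_identity (K : DiaOb Dia') (I : DiaOb Dia) (f : Functor K I) (s : S I)
    (k k' : K) (m : Hom k k') :
  is_identity (fmap f m) -> is_identity (tr (E := B) m (base_pull f s)).
Proof.
move=> Hm; apply: (identity_arrow (eq_sym (base_tr_arrow f s m))).
exact: (@pd_2_identity _ (underlying S) (dincl H dpt) I).
Qed.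

(** The transition morphisms concerned lie over identities, where Cartesian and invertible agree.
    From here on [pd_cart] replaces [is_cart]. *)
Lemma is_cart_iso (K : DiaOb Dia') (I : DiaOb Dia) (f : Functor K I) (s : S I)
    (X : D K) :
  p K X = base_pull f s -> is_cart p f X <-> pd_cart (E := E) f X.
Proof.
move=> PX; split=> HX k k' m Hm; last by apply: iso_cartesian; exact: HX Hm.
apply: (cart_arrow_over_iso (cartesian_und (HX _ _ _ Hm))).
apply: identity_iso; apply: (identity_arrow (eq_sym (pm_tr P m X))).
by rewrite [P K X]PX; apply: base_tr_identity.
Qed.

(** A coCartesian lift of an isomorphism is an isomorphism. *)
Lemma und_isofibration : fder0_left p ->
  forall (K : DiaOb Dia') (X : E K) (s : B K) (f : Hom (P K X) s),
  is_iso f -> exists (Y : E K) (u : Hom X Y),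
    is_iso u /\ Arrow (fmap (P K) u) = Arrow f.
Proof.
move=> [opf _] K X s f Hf; have [W] := opf K _ _ f [X] eq_refl.
have Pu := marrow_arrow (po_over W).
exists ⌊po_ob W⌋, (po_arr W); split=> //.
apply: (cocartesian_arrow_over_iso (cocartesian_und (@po_cocart _ _ _ _ _ _ _ W))).
exact: is_iso_arrow (eq_sym Pu) Hf.
Qed.

Lemma ev_cocartesian (K : DiaOb Dia') (k : K) (V Z : D K) (xi : mhom [V] Z) :
  fder0_left p -> cocartesian (p K) xi ->
  cocartesian_arrow (P dpt) (fmap (ev E k) (xi : @Hom (und (D K)) V Z)).
Proof.
move=> [_ cocart] Hxi.
exact: (@cocartesian_und _ _ (p dpt) _ _ _ (@cocart dpt K (pointF k) _ _ _ Hxi)).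
Qed.

Context (N Nt : EnlFunctor Dia Dia').
Context (Hcomma : forall I : DiaOb Dia, Dia' (Comma (enl_pi N I) (enl_pi Nt I))).

Definition corr_dia (I : DiaOb Dia) : DiaOb Dia' := Build_DiaOb (Hcomma I).

Section FixedDiagram.
Context (I : DiaOb Dia).
Let Q : DiaOb Dia' := corr_dia I.
Let pr1 : Functor Q (N I) := comma_fst (enl_pi N I) (enl_pi Nt I).
Let pr2 : Functor Q (Nt I) := comma_snd (enl_pi N I) (enl_pi Nt I).

Definition corr_mu (s : S I) :
  @Hom (B Q) (base_pull (enl_pi N I ⊙ pr1) s) (base_pull (enl_pi Nt I ⊙ pr2) s) :=
  @md_2 Dia S (dincl H Q) I _ _ (comma_nt (enl_pi N I) (enl_pi Nt I)) s.

Definition over_mu (s : S I) (X : E (N I)) (Y : E (Nt I))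
    (xi : Hom (pd_map E pr1 X) (pd_map E pr2 Y)) : Prop :=
  Arrow (fmap (P Q) xi) = Arrow (corr_mu s).

(** At other points [xi] lies over a morphism of [S] that is not invertible in general, so
    invertibility can be asked only here. *)
Definition corr_good (X : E (N I)) (Y : E (Nt I))
    (xi : Hom (pd_map E pr1 X) (pd_map E pr2 Y)) : Prop :=
  forall q : Q, is_identity (com_arr q) -> is_iso (fmap (ev E q) xi).

Lemma ev_corr_mu (s : S I) (q : Q) :
  is_identity (com_arr q) -> is_identity (fmap (ev B q) (corr_mu s)).
Proof.
move=> Hq.
apply: (identity_arrow (@pd_whiskR _ (underlying S) (dincl H dpt) (dincl H Q) I _ _
  (comma_nt (enl_pi N I) (enl_pi Nt I)) (pointF q) s)).
exact: (@pd_2_identity _ (underlying S) (dincl H dpt) I).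
Qed.

Section Spread.
Context (X : E (N I)) (Y : E (Nt I)).
Context (xi : Hom (pd_map E pr1 X) (pd_map E pr2 Y)).

Lemma corr_iso_l (q q' : Q) (m : Hom q q') :
  is_iso (tr (E := E) (fst ⌊m⌋) X) -> is_iso (tr (E := E) (snd ⌊m⌋) Y) ->
  is_iso (fmap (ev E q) xi) <-> is_iso (fmap (ev E q') xi).
Proof.
move=> H1 H2.
have {}H1 := is_iso_arrow (eq_sym (@tr_map _ E Q (N I) pr1 _ _ m X)) H1.
have {}H2 := is_iso_arrow (eq_sym (@tr_map _ E Q (Nt I) pr2 _ _ m Y)) H2.
have e := tr_nat (E := E) m xi; split=> Hq.
- by apply: (iso_cancel_r H1); rewrite -e; apply: iso_comp.
- by apply: (iso_cancel_l H2); rewrite e; apply: iso_comp.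
Qed.

(** Choosing one [n] over the common image of [k] and [k'] gives two points of [Q] with identity
    arrows and a map between them that does not move [X]; the transition of [Y] along [m] then
    relates two invertible values of [xi]. *)
Lemma corr_cart_r : N3 N -> corr_good xi -> pd_cart (enl_pi Nt I) Y.
Proof.
move=> N_N3 Hg k k' m Hm.
have [n Hn] := proj1 (N_N3 I) (enl_pi Nt I k).
pose q : Q := @CommaOb _ _ _ (enl_pi N I) (enl_pi Nt I) n k (eqhom Hn).
pose q' : Q := @CommaOb _ _ _ (enl_pi N I) (enl_pi Nt I) n k'
  (fmap (enl_pi Nt I) m ∘ eqhom Hn).
have Hq : is_identity (com_arr q) := identity_eqhom Hn.
have Hq' : is_identity (com_arr q') by apply: identity_comp.
have HM : com_arr q' ∘ fmap (enl_pi N I) (idc n) = fmap (enl_pi Nt I) m ∘ com_arr q.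
  by rewrite fmap_id comp_idr.
pose M : Hom q q' := exist _ (idc n, m) HM.
have e := tr_nat (E := E) M xi.
have H1 : is_iso (tr (E := E) M (pd_map E pr1 X)).
  apply: identity_iso.
  apply: (identity_arrow (eq_sym (@tr_map _ E Q (N I) pr1 _ _ M X))).
  by apply: tr_identity; apply: identity_idc.
apply: (is_iso_arrow (@tr_map _ E Q (Nt I) pr2 _ _ M Y)).
by apply: (iso_cancel_r (Hg q Hq)); rewrite e; apply: iso_comp => //; apply: Hg.
Qed.

Lemma corr_cart_l : N3 Nt -> corr_good xi -> pd_cart (enl_pi N I) X.
Proof.
move=> Nt_N3 Hg k k' m Hm.
have [n Hn] := proj1 (Nt_N3 I) (enl_pi N I k').
pose q' : Q := @CommaOb _ _ _ (enl_pi N I) (enl_pi Nt I) k' n (eqhom (eq_sym Hn)).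
pose q : Q := @CommaOb _ _ _ (enl_pi N I) (enl_pi Nt I) k n
  (eqhom (eq_sym Hn) ∘ fmap (enl_pi N I) m).
have Hq' : is_identity (com_arr q') := identity_eqhom (eq_sym Hn).
have Hq : is_identity (com_arr q) by apply: identity_comp.
have HM : com_arr q' ∘ fmap (enl_pi N I) m = fmap (enl_pi Nt I) (idc n) ∘ com_arr q.
  by rewrite fmap_id comp_idl.
pose M : Hom q q' := exist _ (m, idc n) HM.
have e := tr_nat (E := E) M xi.
have H1 : is_iso (tr (E := E) M (pd_map E pr2 Y)).
  apply: identity_iso.
  apply: (identity_arrow (eq_sym (@tr_map _ E Q (Nt I) pr2 _ _ M Y))).
  by apply: tr_identity; apply: identity_idc.
apply: (is_iso_arrow (@tr_map _ E Q (N I) pr1 _ _ M X)).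
by apply: (iso_cancel_l (Hg q' Hq')); rewrite -e; apply: iso_comp => //; apply: Hg.
Qed.

(** For fixed [n], the points with identity arrow correspond to the fibre of [enl_pi N I] over the
    image of [n], which is connected by (N3). Along its morphisms invertibility passes in both
    directions since [X] is Cartesian. *)
Lemma corr_good_from_r : N3 N -> pd_cart (enl_pi N I) X ->
  (forall n : Nt I, exists q : Q, com_r q = n /\ is_identity (com_arr q) /\
     is_iso (fmap (ev E q) xi)) ->
  corr_good xi.
Proof.
move=> N_N3 HX Hex [n0 n f] /= Hf.
have [[n1 n' f1] [/= en [/= Hf1 Hi]]] := Hex n; subst n'.
pose T (x : FibCat (enl_pi N I) (enl_pi Nt I n)) : Prop :=
  forall g : Hom (enl_pi N I ⌊x⌋) (enl_pi Nt I n), is_identity g ->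
  is_iso (fmap (ev E (@CommaOb _ _ _ (enl_pi N I) (enl_pi Nt I) ⌊x⌋ n g : Q)) xi).
have step x y (u : Hom x y) : T x <-> T y.
  have Hu : is_identity (fmap (enl_pi N I) ⌊u⌋) := fib_vertical u.
  have st (g : Hom (enl_pi N I ⌊x⌋) (enl_pi Nt I n)) (g' : Hom (enl_pi N I ⌊y⌋) _) :
      is_identity g -> is_identity g' ->
      is_iso (fmap (ev E (@CommaOb _ _ _ (enl_pi N I) (enl_pi Nt I) ⌊x⌋ n g : Q)) xi)
      <->
      is_iso (fmap (ev E (@CommaOb _ _ _ (enl_pi N I) (enl_pi Nt I) ⌊y⌋ n g' : Q)) xi).
    move=> Hg Hg'.
    have HM : g' ∘ fmap (enl_pi N I) ⌊u⌋ = fmap (enl_pi Nt I) (idc n) ∘ g.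
      rewrite fmap_id comp_idl; apply: identity_uniq Hg; exact: identity_comp.
    pose q : Q := @CommaOb _ _ _ (enl_pi N I) (enl_pi Nt I) ⌊x⌋ n g.
    pose q' : Q := @CommaOb _ _ _ (enl_pi N I) (enl_pi Nt I) ⌊y⌋ n g'.
    pose M : Hom q q' := exist _ (⌊u⌋, idc n) HM.
    apply: (@corr_iso_l q q' M); first exact: HX.
    by apply: identity_iso; apply: tr_identity; apply: identity_idc.
  split=> HT g Hg.
    have Hg0 := identity_comp Hg Hu.
    exact (proj1 (st _ _ Hg0 Hg) (HT _ Hg0)).
  have Hg0 := identity_eqhom (proj2_sig y : enl_pi N I ⌊y⌋ = enl_pi Nt I n).
  exact (proj2 (st _ _ Hg Hg0) (HT _ Hg0)).
have conn := proj2 (proj2 (proj2 (N_N3 I)) (enl_pi Nt I n)).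
have all x y : T x -> T y.
  suff : T x <-> T y by move=> [].
  elim: (conn x y) => {x y} [x y [u]|x|x y _ IH|x y z _ IH1 _ IH2].
        exact: step u.
      by [].
    by symmetry.
  by rewrite IH1.
have T1 : T (exist _ n1 (identity_eq Hf1)).
  by move=> g Hg /=; rewrite (identity_uniq Hg Hf1).
exact: (all _ (exist _ n0 (identity_eq Hf)) T1).
Qed.

Lemma corr_good_from_l : N3 Nt -> pd_cart (enl_pi Nt I) Y ->
  (forall n : N I, exists q : Q, com_l q = n /\ is_identity (com_arr q) /\
     is_iso (fmap (ev E q) xi)) ->
  corr_good xi.
Proof.
move=> Nt_N3 HY Hex [n n0 f] /= Hf.
have [[n' n1 f1] [/= en [/= Hf1 Hi]]] := Hex n; subst n'.
pose T (x : FibCat (enl_pi Nt I) (enl_pi N I n)) : Prop :=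
  forall g : Hom (enl_pi N I n) (enl_pi Nt I ⌊x⌋), is_identity g ->
  is_iso (fmap (ev E (@CommaOb _ _ _ (enl_pi N I) (enl_pi Nt I) n ⌊x⌋ g : Q)) xi).
have step x y (u : Hom x y) : T x <-> T y.
  have Hu : is_identity (fmap (enl_pi Nt I) ⌊u⌋) := fib_vertical u.
  have st (g : Hom (enl_pi N I n) (enl_pi Nt I ⌊x⌋)) (g' : Hom _ (enl_pi Nt I ⌊y⌋)) :
      is_identity g -> is_identity g' ->
      is_iso (fmap (ev E (@CommaOb _ _ _ (enl_pi N I) (enl_pi Nt I) n ⌊x⌋ g : Q)) xi)
      <->
      is_iso (fmap (ev E (@CommaOb _ _ _ (enl_pi N I) (enl_pi Nt I) n ⌊y⌋ g' : Q)) xi).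
    move=> Hg Hg'.
    have HM : g' ∘ fmap (enl_pi N I) (idc n) = fmap (enl_pi Nt I) ⌊u⌋ ∘ g.
      rewrite fmap_id comp_idr; apply: identity_uniq Hg' _; exact: identity_comp.
    pose q : Q := @CommaOb _ _ _ (enl_pi N I) (enl_pi Nt I) n ⌊x⌋ g.
    pose q' : Q := @CommaOb _ _ _ (enl_pi N I) (enl_pi Nt I) n ⌊y⌋ g'.
    pose M : Hom q q' := exist _ (idc n, ⌊u⌋) HM.
    apply: (@corr_iso_l q q' M); last exact: HY.
    by apply: identity_iso; apply: tr_identity; apply: identity_idc.
  split=> HT g Hg.
    have Hg0 := identity_eqhom (eq_sym (proj2_sig x : _ = enl_pi N I n)).
    exact (proj1 (st _ _ Hg0 Hg) (HT _ Hg0)).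
  have Hg0 := identity_comp Hu Hg.
  exact (proj2 (st _ _ Hg Hg0) (HT _ Hg0)).
have conn := proj2 (proj2 (proj2 (Nt_N3 I)) (enl_pi N I n)).
have all x y : T x -> T y.
  suff : T x <-> T y by move=> [].
  elim: (conn x y) => {x y} [x y [u]|x|x y _ IH|x y z _ IH1 _ IH2].
        exact: step u.
      by [].
    by symmetry.
  by rewrite IH1.
have T1 : T (exist _ n1 (eq_sym (identity_eq Hf1))).
  by move=> g Hg /=; rewrite (identity_uniq Hg Hf1).
exact: (all _ (exist _ n0 (eq_sym (identity_eq Hf))) T1).
Qed.
End Spread.
End FixedDiagram.
End Enlargements.

(** * Slices of the comma category *)

Section OverRetract.
Context (A At C : Category) (pi : Functor A C) (pit : Functor At C) (n : At).
Let Q : Category := Comma pi pit.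
Let K : Category := Comma (comma_snd pi pit) (pointF n).
(** The composite with [idF C] is kept so that this is literally the target of [N4_left_functor] at
    an identity functor. *)
Let C0 : Category := Comma (idF C ⊙ pi) (pointF (pit n)).

Definition over_in_nt : NatTrans (pi ⊙ comma_fst (idF C ⊙ pi) (pointF (pit n)))
  (pit ⊙ (pointF n ⊙ bang C0)).
Proof.
refine (@Build_NatTrans C0 C (pi ⊙ comma_fst (idF C ⊙ pi) (pointF (pit n)))
  (pit ⊙ (pointF n ⊙ bang C0)) (fun x => com_arr x) _).
by move=> x y [u Hu] /=; rewrite fmap_id.
Defined.

Definition over_in_id_nt :
  NatTrans (comma_snd pi pit ⊙ comma_lift over_in_nt) (pointF n ⊙ bang C0).
Proof.
by refine (@Build_NatTrans C0 At (comma_snd pi pit ⊙ comma_lift over_in_nt)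
  (pointF n ⊙ bang C0) (fun x => idc n) _).
Defined.

(** [C0] sits in the slice as the objects whose morphism to [n] is an identity. [over_out] absorbs
    that morphism into the comma arrow and is left adjoint to this inclusion, with unit
    [over_eta]. *)
Definition over_in : Functor C0 K :=
  @comma_lift Q PtCat At (comma_snd pi pit) (pointF n) C0
    (comma_lift over_in_nt) (bang C0) over_in_id_nt.

Definition over_out_nt :
  NatTrans ((idF C ⊙ pi) ⊙ (comma_fst pi pit ⊙ comma_fst (comma_snd pi pit) (pointF n)))
    (pointF (pit n) ⊙ bang K).
Proof.
refine (@Build_NatTrans K C
  ((idF C ⊙ pi) ⊙ (comma_fst pi pit ⊙ comma_fst (comma_snd pi pit) (pointF n)))
  (pointF (pit n) ⊙ bang K)
  (fun x => fmap pit (com_arr x) ∘ com_arr (com_l x)) _).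
move=> x y [[[u Hu] t] Hut] /=; rewrite /= in Hu Hut.
by rewrite -comp_assoc Hu comp_assoc -fmap_comp Hut !comp_idl.
Defined.

Definition over_out : Functor K C0 := comma_lift over_out_nt.

Lemma over_out_in : over_out ⊙ over_in = idF C0.
Proof.
have e (x : C0) : (over_out ⊙ over_in) x = x.
  by case: x => a [] f /=; rewrite /= fmap_id comp_idl.
apply: functor_eq => // x y f.
apply: comma_arrow; [exact: e | exact: e | by [] |].
by case: f => [[f []] Hf] /=; case: (com_r x); case: (com_r y).
Qed.

Definition over_eta_hom (x : K) : Hom x (over_in (over_out x)).
Proof.
unshelve refine (exist _ (exist _ (idc (com_l (com_l x)), com_arr x) _, tt) _).
- by rewrite /= fmap_id comp_idr.
- by [].
Defined.

Definition over_eta : NatTrans (idF K) (over_in ⊙ over_out).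
Proof.
refine (@Build_NatTrans K K (idF K) (over_in ⊙ over_out) over_eta_hom _).
move=> x y [[[[u1 u2] Hu] t] Hut]; have Hut' := Hut; rewrite /= in Hut'.
apply: comma_hom_eq; apply: injective_projections; last by [].
apply: comma_hom_eq; apply: injective_projections => /=.
- by rewrite comp_idl comp_idr.
- by rewrite Hut'.
Defined.

Lemma over_eta_in (y : C0) : is_identity (over_eta (over_in y)).
Proof.
have e : over_in (over_out (over_in y)) = over_in y.
  exact: (f_equal (fobj over_in) (functor_arrow_ob y over_out_in)).
apply: comma_identity; [exact: eq_sym e | | exact: (identity_idc (C := PtCat))].
apply: comma_identity; last exact: (identity_idc (C := At)).
  exact: (f_equal (fun x : K => com_l x) (eq_sym e)).
exact: (identity_idc (C := A)).
Qed.
End OverRetract.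

Section UnderRetract.
Context (A At C : Category) (pi : Functor A C) (pit : Functor At C) (n : A).
Let Q : Category := Comma pi pit.
Let K : Category := Comma (pointF n) (comma_fst pi pit).
Let C0 : Category := Comma (pointF (pi n)) (idF C ⊙ pit).

Definition under_in_nt : NatTrans (pi ⊙ (pointF n ⊙ bang C0))
  (pit ⊙ comma_snd (pointF (pi n)) (idF C ⊙ pit)).
Proof.
refine (@Build_NatTrans C0 C (pi ⊙ (pointF n ⊙ bang C0))
  (pit ⊙ comma_snd (pointF (pi n)) (idF C ⊙ pit)) (fun x => com_arr x) _).
by move=> x y [u Hu] /=; rewrite fmap_id.
Defined.

Definition under_in_id_nt :
  NatTrans (pointF n ⊙ bang C0) (comma_fst pi pit ⊙ comma_lift under_in_nt).
Proof.
by refine (@Build_NatTrans C0 A (pointF n ⊙ bang C0)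
  (comma_fst pi pit ⊙ comma_lift under_in_nt) (fun x => idc n) _).
Defined.

Definition under_in : Functor C0 K :=
  @comma_lift PtCat Q A (pointF n) (comma_fst pi pit) C0
    (bang C0) (comma_lift under_in_nt) under_in_id_nt.

Definition under_out_nt :
  NatTrans (pointF (pi n) ⊙ bang K)
   ((idF C ⊙ pit) ⊙ (comma_snd pi pit ⊙ comma_snd (pointF n) (comma_fst pi pit))).
Proof.
refine (@Build_NatTrans K C (pointF (pi n) ⊙ bang K)
  ((idF C ⊙ pit) ⊙ (comma_snd pi pit ⊙ comma_snd (pointF n) (comma_fst pi pit)))
  (fun x => com_arr (com_r x) ∘ fmap pi (com_arr x)) _).
move=> x y [[t [u Hu]] Hut] /=; rewrite /= in Hu Hut.
by rewrite [RHS]comp_assoc -Hu -[RHS]comp_assoc -fmap_comp -Hut !comp_idr.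
Defined.

Definition under_out : Functor K C0 := comma_lift under_out_nt.

Lemma under_out_in : under_out ⊙ under_in = idF C0.
Proof.
have e (x : C0) : (under_out ⊙ under_in) x = x.
  by case: x => [[] a f] /=; rewrite /= fmap_id comp_idr.
apply: functor_eq => // x y f.
apply: comma_arrow; [exact: e | exact: e | | by []].
by case: f => [[[] f] Hf] /=; case: (com_l x); case: (com_l y).
Qed.

Definition under_eps_hom (x : K) : Hom (under_in (under_out x)) x.
Proof.
unshelve refine (exist _ (tt, exist _ (com_arr x, idc (com_r (com_r x))) _) _).
- by rewrite /= fmap_id comp_idl.
- by [].
Defined.

Definition under_eps : NatTrans (under_in ⊙ under_out) (idF K).
Proof.
refine (@Build_NatTrans K K (under_in ⊙ under_out) (idF K) under_eps_hom _).
move=> x y [[t [[u1 u2] Hu]] Hut]; have Hut' := Hut; rewrite /= in Hut'.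
apply: comma_hom_eq; apply: injective_projections; first by [].
apply: comma_hom_eq; apply: injective_projections => /=.
- by rewrite Hut'.
- by rewrite comp_idl comp_idr.
Defined.

Lemma under_eps_in (y : C0) : is_identity (under_eps (under_in y)).
Proof.
have e : under_in (under_out (under_in y)) = under_in y.
  exact: (f_equal (fobj under_in) (functor_arrow_ob y under_out_in)).
apply: comma_identity; [exact: e | exact: (identity_idc (C := PtCat)) |].
apply: comma_identity; last exact: (identity_idc (C := At)).
  exact: (f_equal (fun x : K => com_r x) e).
exact: (identity_idc (C := A)).
Qed.
End UnderRetract.

Lemma over_id_final (C : Category) (i : C) :
  is_final (@CommaOb C PtCat C (idF C) (pointF i) i tt (idc i)
            : Comma (idF C) (pointF i)).
Proof.
move=> [i' [] h].
unshelve eexists; first by exists (h, tt); rewrite /= !comp_idl.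
split=> // -[[h' []] H'] _; apply: comma_hom_eq; rewrite /=.
by move: H'; rewrite /= !comp_idl => ->.
Qed.

(** * Existence of good correspondences *)

Lemma compF_retract (K C M : Category) (G : Functor C M) (F : Functor K C)
    (F' : Functor C K) (G' : Functor M C) :
  F ⊙ F' = idF C -> G ⊙ G' = idF M -> (G ⊙ F) ⊙ (F' ⊙ G') = idF M.
Proof.
move=> e <-; transitivity (G ⊙ (F ⊙ F' ⊙ G')); first exact: functor_eq.
by rewrite e; apply: functor_eq.
Qed.

Lemma compF_inner_inverse (K C M : Category) (G : Functor C M) (F : Functor K C)
    (F' : Functor C K) (G' : Functor M C) :
  G' ⊙ G = idF C -> F' ⊙ F = (F' ⊙ G') ⊙ (G ⊙ F).
Proof.
move=> e; transitivity (F' ⊙ (G' ⊙ G) ⊙ F); last exact: functor_eq.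
by rewrite e; apply: functor_eq.
Qed.

Section Existence.
Context {Dia' Dia : DiagramCategory} (H : sub_dia Dia' Dia).
Context (S : PreMultiDerivator Dia) (D : PreMultiDerivator Dia').
Context (p : MDMor D (md_restrict H S)).
Let E := underlying D.
Let B := underlying (md_restrict H S).
Let P : PDMor E B := underlying_mor p.
Context (N Nt : EnlFunctor Dia Dia').
Context (Hcomma : forall I : DiaOb Dia, Dia' (Comma (enl_pi N I) (enl_pi Nt I))).
Context (fibre_der1 : forall b : B dpt, pd_der1 (fibre_pd P b)).
Context (fibre_der2 : forall b : B dpt, pd_der2 (fibre_pd P b)).
Context (I : DiaOb Dia).
Let Q : DiaOb Dia' := corr_dia Hcomma I.
Let pr1 : Functor Q (N I) := comma_fst (enl_pi N I) (enl_pi Nt I).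
Let pr2 : Functor Q (Nt I) := comma_snd (enl_pi N I) (enl_pi Nt I).

Lemma slice_colim_at (n : Nt I) (t : B (Nt I)) :
  N4_left N -> N5_left N ->
  exists k : dover pr2 n,
    is_identity (com_arr k) /\ is_identity (com_arr (com_l k)) /\
    forall X : E (N I), pd_cart (enl_pi N I) X ->
    forall V : E (dover pr2 n),
      P _ V = @pd_map _ B (dover pr2 n) (Nt I) (pointF n ⊙ comma_snd pr2 (pointF n)) t ->
      (exists c : Hom (@pd_map _ E (dover pr2 n) Q (comma_fst pr2 (pointF n))
                         (pd_map E pr1 X)) V,
         forall x, cocartesian_arrow (P dpt) (fmap (ev E x) c)) ->
      forall Z : E dpt, P _ Z = @pd_map _ B dpt (Nt I) (pointF n) t ->
      colim_at P (comma_snd pr2 (pointF n) : Functor (dover pr2 n) dpt) k V Z.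
Proof.
move=> N4 N5.
pose K := dover pr2 n.
pose i : I := enl_pi Nt I n.
pose Sl : DiaOb Dia := dover (idF I) i.
pose M : DiaOb Dia' := N Sl.
pose Phi : Functor M (Comma (idF I ⊙ enl_pi N I) (pointF i)) :=
  N4_left_functor N (idF I) i.
have [G [GP PG]] := N4 I I (idF I) i.
pose b : B dpt := @pd_map _ B dpt (Nt I) (pointF n) t.
have [n0 [Hn0 Hcol]] := N5_colim_at (@fibre_der1 b) (@fibre_der2 b) N5
  (@over_id_final I i : is_final (C := Sl) _).
pose rho : Functor M K := over_in (enl_pi N I) (enl_pi Nt I) n ⊙ Phi.
pose lam : Functor K M := G ⊙ over_out (enl_pi N I) (enl_pi Nt I) n.
have lr : lam ⊙ rho = idF M := compF_retract (@over_out_in _ _ _ _ _ n) GP.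
pose T : Functor K K := over_in (enl_pi N I) (enl_pi Nt I) n ⊙
  over_out (enl_pi N I) (enl_pi Nt I) n.
have TE : T = rho ⊙ lam := 
  compF_inner_inverse (over_out (enl_pi N I) (enl_pi Nt I) n)
    (over_in (enl_pi N I) (enl_pi Nt I) n) PG.
(* [n0] lies over the final object, whose arrow is an identity, and [over_in] adds a second
   identity; so both arrows of this point are identities. *)
exists (rho n0); split; first exact: identity_idc; split.
  rewrite /=; apply: identity_comp; last first.
    by apply: (identity_fmap (idF I)); apply: identity_eqhom.
  by rewrite Hn0; apply: identity_idc.
move=> X HX V PV [c Hc] Z PZ.
pose q : Functor K (@dpt Dia') := comma_snd pr2 (pointF n).
have PVq : P K V = pd_map B q (@pd_map _ B dpt (Nt I) (pointF n) t).
  by rewrite PV pd_map_comp_ob.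
apply: (colim_at_retract lr TE PVq (eta := over_eta (enl_pi N I) (enl_pi Nt I) n)).
  by move=> m; apply: over_eta_in.
apply: Hcol => //; first by rewrite pm_map_ob PVq pd_map_comp_ob.
(* It remains to see that [V] is Cartesian along [rho]. Through [c] its transition morphisms are
   compared with those of [X], which are invertible, and they lie over identities because the base
   of [V] is constant. *)
move=> x x' m Hm.
have e := tr_nat (E := E) (fmap rho m) c.
apply: (is_iso_arrow (eq_sym (@tr_map _ E M K rho _ _ m V))).
apply: (cocartesian_arrow_iso (Hc _) (Hc _) _ _ e).
- apply: (is_iso_arrow (eq_sym (@tr_map _ E K Q (comma_fst pr2 (pointF n)) _ _
    (fmap rho m) (pd_map E pr1 X)))).
  apply: (is_iso_arrow (eq_sym (@tr_map _ E Q (N I) pr1 _ _ _ X))).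
  apply: HX.
  apply: (identity_arrow (eq_sym (fmap_arrow_eq m
    (enl_pi_nat N (comma_fst (idF I) (pointF i) : Functor Sl I))))).
  exact: (identity_fmap (comma_fst (idF I) (pointF i)) Hm).
- apply: identity_iso; apply: (identity_arrow (eq_sym (pm_tr P _ _))).
  rewrite PV.
  apply: (identity_arrow (eq_sym (@tr_map _ B K (Nt I)
    (pointF n ⊙ comma_snd pr2 (pointF n)) _ _ _ t))).
  by apply: tr_identity; apply: identity_idc.
Qed.

Lemma over_mu_src (s : S I) (X : E (N I)) :
  P _ X = base_pull H (enl_pi N I) s ->
  P Q (pd_map E pr1 X) = base_pull H (enl_pi N I ⊙ pr1) s.
Proof. by move=> e; rewrite pm_map_ob e; apply: base_pull_comp. Qed.

Lemma over_mu_tgt (s : S I) (Y : E (Nt I)) :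
  P _ Y = base_pull H (enl_pi Nt I) s ->
  P Q (pd_map E pr2 Y) = base_pull H (enl_pi Nt I ⊙ pr2) s.
Proof. by move=> e; rewrite pm_map_ob e; apply: base_pull_comp. Qed.

(** The universal property holds against every [Y'], Cartesian or not, as it comes from a
    coCartesian arrow and an adjunction alone. *)
Lemma left_existence (s : S I) (X : E (N I)) :
  fder0_left p -> fder3_left p -> fder4_left p -> N3 N -> N4_left N -> N5_left N ->
  P _ X = base_pull H (enl_pi N I) s -> pd_cart (enl_pi N I) X ->
  exists (Y : E (Nt I)) (xi : Hom (pd_map E pr1 X) (pd_map E pr2 Y)),
    P _ Y = base_pull H (enl_pi Nt I) s /\ over_mu (Hcomma := Hcomma) p s xi /\
    corr_good (Hcomma := Hcomma) xi /\
    forall (Y' : E (Nt I)) (xi' : Hom (pd_map E pr1 X) (pd_map E pr2 Y')),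
      P _ Y' = base_pull H (enl_pi Nt I) s -> over_mu (Hcomma := Hcomma) p s xi' ->
      exists! v : Hom Y Y', vertical P v /\ fmap (pd_map E pr2) v ∘ xi = xi'.
Proof.
move=> f0 f3 f4 n3 n4 n5 PX HX.
pose t : B (Nt I) := base_pull H (enl_pi Nt I) s.
have [W] := proj1 f0 Q _ _ (corr_mu H Hcomma s) [pd_map E pr1 X]
  (f_equal (fun x => [x]) (over_mu_src PX)).
pose w : @Hom (E Q) (pd_map E pr1 X) ⌊po_ob W⌋ := po_arr W.
have Pw : Arrow (fmap (P Q) w) = Arrow (corr_mu H Hcomma s) :=
  marrow_arrow (po_over W).
have Cw : cocartesian (p Q) (po_arr W) := @po_cocart _ _ _ _ _ _ _ W.
have eW : P Q ⌊po_ob W⌋ = pd_map B pr2 t.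
  by rewrite [LHS](arrow_tgt Pw) base_pull_comp.
pose X1 : Fib p (@md_map _ (md_restrict H S) Q (Nt I) pr2 t) := exist _ ⌊po_ob W⌋ eW.
have [aL [aA]] := f3 Q (Nt I) pr2 t.
pose Y := aL X1.
pose eta : @Hom (E Q) ⌊po_ob W⌋ (pd_map E pr2 ⌊Y⌋) := ⌊adj_unit aA X1⌋.
exists ⌊Y⌋, (eta ∘ w).
have Veta : is_identity (fmap (P Q) eta) := fib_vertical (adj_unit aA X1).
split; first exact: proj2_sig Y.
split; first by rewrite /over_mu fmap_comp identity_comp_l.
split.
  apply: corr_good_from_r => // n.
  have [k [Hk [Hk' det]]] := slice_colim_at n t n4 n5.
  exists (com_l k); split; first exact: identity_eq Hk.
  split=> //; rewrite fmap_comp; apply: iso_comp.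
    apply: (fder4_left_unit_iso aA f0 f3 f4 Hk) => V PV [c Hc] Z PZ.
    apply: (det X HX V PV _ Z PZ).
    (* [c] starts at the push-forward; composed with [w] it starts at the restriction of the
       Cartesian object [X], as [slice_colim_at] demands. *)
    exists (c ∘ fmap (@pd_map _ E (dover pr2 n) Q (comma_fst pr2 (pointF n))) w) => x.
    rewrite fmap_comp; apply: cocartesian_arrow_comp (Hc x).
    apply: (cocartesian_arrow_eq (eq_sym (@ev_map _ E _ Q _ x _ _ w))).
    exact: (ev_cocartesian (k := _) f0 Cw).
  apply: (cocartesian_arrow_over_iso (ev_cocartesian (k := com_l k) f0 Cw)).
  apply: identity_iso; apply: (identity_arrow (eq_sym (@pm_map _ E B P dpt Q _ _ _ w))).
  apply: (identity_arrow (eq_sym (arrow_fmap (ev B (com_l k)) Pw))).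
  exact: ev_corr_mu.
move=> Y' xi' PY' Hxi'.
have PY2 := over_mu_tgt PY'.
(* Both [xi'] and [w] lie over [corr_mu], so the factorization is taken over an equality of objects
   and is vertical. *)
pose g : Hom (P Q ⌊po_ob W⌋) (P Q (pd_map E pr2 Y')) :=
  eqhom (eq_trans eW (eq_trans (base_pull_comp H _ _ _) (eq_sym PY2))).
have Hg : fmap (P Q) xi' = g ∘ fmap (P Q) w.
  by apply: arrow_inj; rewrite (identity_comp_l _ (identity_eqhom _)) Pw.
have [u [[Pu uw] U]] := cocartesian_und Cw Hg.
have Vu : is_identity (fmap (P Q) u) by rewrite Pu; apply: identity_eqhom.
pose Y1 : Fib p (t : md_restrict H S (Nt I)) := exist _ Y' PY'.
pose u1 : Hom X1 (pull0 p pr2 t Y1) := exist _ u (vertical_over eW Vu).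
have [v [Hv V]] := adjunction_right_bijection aA u1.
have Hv' : fmap (pd_map E pr2) ⌊v⌋ ∘ eta = u.
  by have := f_equal (@proj1_sig _ _) Hv; rewrite fib_comp.
exists ⌊v⌋; split.
  by split; [exact: fib_vertical v | rewrite comp_assoc Hv'].
move=> v' [Vv' Hv2].
pose v1 : Hom Y Y1 := exist _ v' (vertical_over (proj2_sig Y) Vv').
have -> // : v = v1.
apply: V; apply: fc_hom_eq; rewrite fib_comp.
have Vc : is_identity (fmap (P Q) (fmap (pd_map E pr2) v' ∘ eta)).
  by apply: vertical_comp => //; apply: vertical_map.
symmetry; apply: U; split; last by rewrite -comp_assoc.
by apply: identity_uniq Vc _; apply: identity_eqhom.
Qed.
End Existence.

(** * The dual construction with Cartesian arrows and right Kan extensions *)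

Section ExistenceRight.
Context {Dia' Dia : DiagramCategory} (H : sub_dia Dia' Dia).
Context (S : PreMultiDerivator Dia) (D : PreMultiDerivator Dia').
Context (p : MDMor D (md_restrict H S)).
Let E := underlying D.
Let B := underlying (md_restrict H S).
Let P : PDMor E B := underlying_mor p.
Context (N Nt : EnlFunctor Dia Dia').
Context (Hcomma : forall I : DiaOb Dia, Dia' (Comma (enl_pi N I) (enl_pi Nt I))).
Context (fibre_der1 : forall b : B dpt, pd_der1 (fibre_pd P b)).
Context (fibre_der2 : forall b : B dpt, pd_der2 (fibre_pd P b)).
Context (I : DiaOb Dia).
Let Q : DiaOb Dia' := corr_dia Hcomma I.
Let pr1 : Functor Q (N I) := comma_fst (enl_pi N I) (enl_pi Nt I).
Let pr2 : Functor Q (Nt I) := comma_snd (enl_pi N I) (enl_pi Nt I).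

Lemma slice_lim_at (n : N I) (t : B (N I)) :
  N4_right Nt -> N5_right Nt ->
  exists k : dunder pr1 n,
    is_identity (com_arr k) /\ is_identity (com_arr (com_r k)) /\
    forall Y : E (Nt I), pd_cart (enl_pi Nt I) Y ->
    forall V : E (dunder pr1 n),
      P _ V = @pd_map _ B (dunder pr1 n) (N I) (pointF n ⊙ comma_fst (pointF n) pr1) t ->
      (exists c : Hom V (@pd_map _ E (dunder pr1 n) Q (comma_snd (pointF n) pr1)
                         (pd_map E pr2 Y)),
         forall x, cart_arrow (P dpt) (fmap (ev E x) c)) ->
      forall Z : E dpt, P _ Z = @pd_map _ B dpt (N I) (pointF n) t ->
      lim_at P (comma_fst (pointF n) pr1 : Functor (dunder pr1 n) dpt) k V Z.
Proof.
move=> N4 N5.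
pose K := dunder pr1 n.
pose i : I := enl_pi N I n.
pose Sl : DiaOb Dia := dunder (idF I) i.
pose M : DiaOb Dia' := Nt Sl.
pose Phi : Functor M (Comma (pointF i) (idF I ⊙ enl_pi Nt I)) :=
  N4_right_functor Nt (idF I) i.
have [G [GP PG]] := N4 I I (idF I) i.
pose b : B dpt := @pd_map _ B dpt (N I) (pointF n) t.
have [n0 [Hn0 Hlim]] := N5_lim_at (@fibre_der1 b) (@fibre_der2 b) N5
  (@under_id_is_initial Dia I i).
pose rho : Functor M K := under_in (enl_pi N I) (enl_pi Nt I) n ⊙ Phi.
pose lam : Functor K M := G ⊙ under_out (enl_pi N I) (enl_pi Nt I) n.
have lr : lam ⊙ rho = idF M := compF_retract (@under_out_in _ _ _ _ _ n) GP.
pose T : Functor K K := under_in (enl_pi N I) (enl_pi Nt I) n ⊙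
  under_out (enl_pi N I) (enl_pi Nt I) n.
have TE : T = rho ⊙ lam :=
  compF_inner_inverse (under_out (enl_pi N I) (enl_pi Nt I) n)
    (under_in (enl_pi N I) (enl_pi Nt I) n) PG.
exists (rho n0); split; first exact: identity_idc; split.
  rewrite /=; apply: identity_comp.
    by apply: (identity_fmap (idF I)); apply: identity_eqhom.
  by rewrite Hn0; apply: identity_idc.
move=> Y HY V PV [c Hc] Z PZ.
pose q : Functor K (@dpt Dia') := comma_fst (pointF n) pr1.
have PVq : P K V = pd_map B q (@pd_map _ B dpt (N I) (pointF n) t).
  by rewrite PV pd_map_comp_ob.
apply: (lim_at_retract lr TE PVq (eps := under_eps (enl_pi N I) (enl_pi Nt I) n)).
  by move=> m; apply: under_eps_in.
apply: Hlim => //; first by rewrite pm_map_ob PVq pd_map_comp_ob.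
move=> x x' m Hm.
have e := eq_sym (tr_nat (E := E) (fmap rho m) c).
apply: (is_iso_arrow (eq_sym (@tr_map _ E M K rho _ _ m V))).
apply: (cart_arrow_iso (Hc _) (Hc _) _ _ e).
- apply: (is_iso_arrow (eq_sym (@tr_map _ E K Q (comma_snd (pointF n) pr1) _ _
    (fmap rho m) (pd_map E pr2 Y)))).
  apply: (is_iso_arrow (eq_sym (@tr_map _ E Q (Nt I) pr2 _ _ _ Y))).
  apply: HY.
  apply: (identity_arrow (eq_sym (fmap_arrow_eq m
    (enl_pi_nat Nt (comma_snd (pointF i) (idF I) : Functor Sl I))))).
  exact: (identity_fmap (comma_snd (pointF i) (idF I)) Hm).
- apply: identity_iso; apply: (identity_arrow (eq_sym (pm_tr P _ _))).
  rewrite PV.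
  apply: (identity_arrow (eq_sym (@tr_map _ B K (N I)
    (pointF n ⊙ comma_fst (pointF n) pr1) _ _ _ t))).
  by apply: tr_identity; apply: identity_idc.
Qed.

(** Cartesian arrows are preserved by evaluation at points, through [ev_cartesian], though not by
    arbitrary pull-backs. Pointwise preservation suffices, since invertibility is tested at points;
    this is why [slice_lim_at] asks of [c] only that its values be Cartesian. *)
Lemma right_existence (s : S I) (Y : E (Nt I)) :
  fder0_left p -> fder0_right p -> fder3_right p -> fder4_right p ->
  N3 Nt -> N4_right Nt -> N5_right Nt ->
  P _ Y = base_pull H (enl_pi Nt I) s -> pd_cart (enl_pi Nt I) Y ->
  exists (X : E (N I)) (xi : Hom (pd_map E pr1 X) (pd_map E pr2 Y)),
    P _ X = base_pull H (enl_pi N I) s /\ over_mu (Hcomma := Hcomma) p s xi /\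
    corr_good (Hcomma := Hcomma) xi /\
    forall (X' : E (N I)) (xi' : Hom (pd_map E pr1 X') (pd_map E pr2 Y)),
      P _ X' = base_pull H (enl_pi N I) s -> over_mu (Hcomma := Hcomma) p s xi' ->
      exists! u : Hom X' X, vertical P u /\ xi ∘ fmap (pd_map E pr1) u = xi'.
Proof.
move=> fl f0 f3 f4 n3 n4 n5 PY HY.
pose t : B (N I) := base_pull H (enl_pi N I) s.
have PY2 : P Q (pd_map E pr2 Y) = base_pull H (enl_pi Nt I ⊙ pr2) s.
  by rewrite pm_map_ob PY; apply: base_pull_comp.
pose Y2 : Fib p (base_pull H (enl_pi Nt I ⊙ pr2) s : md_restrict H S Q) :=
  exist _ (pd_map E pr2 Y) PY2.
have [W] := proj1 f0 Q [] _ [] _ (corr_mu H Hcomma s) [] [] Y2 eq_refl eq_refl.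
pose w : @Hom (E Q) ⌊pb_ob W⌋ (pd_map E pr2 Y) := pb_arr W.
have Pw : Arrow (fmap (P Q) w) = Arrow (corr_mu H Hcomma s) :=
  marrow_arrow (pb_over W).
have Cw : @cartesian _ _ (p Q) [] _ [] _ (pb_arr W) := @pb_cart _ _ _ _ _ _ _ _ _ _ _ W.
have Cw' : cart_arrow (P Q) w := cartesian_und Cw.
have eW : P Q ⌊pb_ob W⌋ = pd_map B pr1 t.
  by rewrite [LHS](arrow_src Pw) base_pull_comp.
pose X1 : Fib p (@md_map _ (md_restrict H S) Q (N I) pr1 t) := exist _ ⌊pb_ob W⌋ eW.
have [aR [aA]] := f3 Q (N I) pr1 t.
pose X := aR X1.
pose eps : @Hom (E Q) (pd_map E pr1 ⌊X⌋) ⌊pb_ob W⌋ := ⌊adj_counit aA X1⌋.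
exists ⌊X⌋, (w ∘ eps).
have Veps : is_identity (fmap (P Q) eps) := fib_vertical (adj_counit aA X1).
split; first exact: proj2_sig X.
split; first by rewrite /over_mu fmap_comp identity_comp_r.
have Hwc (q : Q) : cart_arrow (P dpt) (fmap (ev E q) w) := ev_cartesian f0 Cw.
split.
  apply: corr_good_from_l => // n.
  have [k [Hk [Hk' det]]] := slice_lim_at n t n4 n5.
  exists (com_r k); split; first exact: eq_sym (identity_eq Hk).
  split=> //; rewrite fmap_comp; apply: iso_comp; last first.
    apply: (fder4_right_counit_iso aA f0 f3 f4 Hk) => V PV [c Hc] Z PZ.
    apply: (det Y HY V PV _ Z PZ).
    exists (fmap (@pd_map _ E (dunder pr1 n) Q (comma_snd (pointF n) pr1)) w ∘ c) => x.
    rewrite fmap_comp; apply: (cart_arrow_comp (Hc x)).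
    exact: (cart_arrow_eq (eq_sym (@ev_map _ E _ Q _ x _ _ w)) (Hwc _)).
  apply: (cart_arrow_over_iso (Hwc (com_r k))).
  apply: identity_iso; apply: (identity_arrow (eq_sym (@pm_map _ E B P dpt Q _ _ _ w))).
  apply: (identity_arrow (eq_sym (arrow_fmap (ev B (com_r k)) Pw))).
  exact: ev_corr_mu.
move=> X' xi' PX' Hxi'.
have PX2 : P Q (pd_map E pr1 X') = base_pull H (enl_pi N I ⊙ pr1) s.
  by rewrite pm_map_ob PX'; apply: base_pull_comp.
pose g : Hom (P Q (pd_map E pr1 X')) (P Q ⌊pb_ob W⌋) :=
  eqhom (eq_trans PX2 (eq_trans (eq_sym (base_pull_comp H _ _ _)) (eq_sym eW))).
have Hg : fmap (P Q) xi' = fmap (P Q) w ∘ g.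
  by apply: arrow_inj; rewrite (identity_comp_r _ (identity_eqhom _)) Pw.
destruct (Cw' (pd_map E pr1 X') xi' g Hg) as [u [[Pu uw] U]].
have Vu : is_identity (fmap (P Q) u) by rewrite Pu; apply: identity_eqhom.
pose X3 : Fib p (t : md_restrict H S (N I)) := exist _ X' PX'.
have PX3 := proj2_sig (pull0 p pr1 t X3).
pose u1 : Hom (pull0 p pr1 t X3) X1 := exist _ u (vertical_over PX3 Vu).
have [v [Hv V]] := adjunction_left_bijection aA u1.
have Hv' : eps ∘ fmap (pd_map E pr1) ⌊v⌋ = u.
  by have := f_equal (@proj1_sig _ _) Hv; rewrite fib_comp.
exists ⌊v⌋; split.
  by split; [exact: fib_vertical v | rewrite -comp_assoc Hv'].
move=> v' [Vv' Hv2].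
pose v1 : Hom X3 X := exist _ v' (vertical_over PX' Vv').
have -> // : v = v1.
apply: V; apply: fc_hom_eq; rewrite fib_comp.
have Vc : is_identity (fmap (P Q) (eps ∘ fmap (pd_map E pr1) v')).
  by apply: vertical_comp => //; apply: vertical_map.
symmetry; apply: U; split; last by rewrite comp_assoc.
by apply: identity_uniq Vc _; apply: identity_eqhom.
Qed.
End ExistenceRight.

(** * Equivalences from bimodules representable on both sides *)

Section Bimodule.
Context (A B C : Category) (FA : Functor A C) (FB : Functor B C).
Context (R : forall X Y, Hom (FA X) (FB Y) -> Prop).
Context (G : forall X Y, Hom (FA X) (FB Y) -> Prop).
Context (R_l : forall X X' Y (xi : Hom (FA X) (FB Y)) (u : Hom X' X),
  R xi -> R (xi ∘ fmap FA u)).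
Context (R_r : forall X Y Y' (xi : Hom (FA X) (FB Y)) (v : Hom Y Y'),
  R xi -> R (fmap FB v ∘ xi)).
Context (ex_l : forall X, exists Y (xi : Hom (FA X) (FB Y)), R xi /\ G xi).
Context (ex_r : forall Y, exists X (xi : Hom (FA X) (FB Y)), R xi /\ G xi).
Context (univ_l : forall X Y (xi : Hom (FA X) (FB Y)), R xi -> G xi ->
  forall Y' (xi' : Hom (FA X) (FB Y')), R xi' -> exists! v, fmap FB v ∘ xi = xi').
Context (univ_r : forall X Y (xi : Hom (FA X) (FB Y)), R xi -> G xi ->
  forall X' (xi' : Hom (FA X') (FB Y)), R xi' -> exists! u, xi ∘ fmap FA u = xi').

Lemma bimodule_iso (X : A) (Y Y' : B) (xi : Hom (FA X) (FB Y))
    (xi' : Hom (FA X) (FB Y')) (v : Hom Y Y') :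
  R xi -> G xi -> R xi' -> G xi' -> fmap FB v ∘ xi = xi' -> is_iso v.
Proof.
move=> r g r' g' e.
have [w [Hw _]] := univ_l r' g' r.
exists w; split.
- apply: (unique_eq (univ_l r g r)); last by rewrite fmap_id comp_idl.
  by rewrite fmap_comp -comp_assoc e.
- apply: (unique_eq (univ_l r' g' r')); last by rewrite fmap_id comp_idl.
  by rewrite fmap_comp -comp_assoc Hw.
Qed.

(** Universality in the second variable makes the choice of [Y] functorial; universality in the
    first makes the functor fully faithful, and existence for each [Y] makes it essentially
    surjective. [R] is stable under both actions while [G] need not be, so the elements tested
    against satisfy only [R]. *)
Lemma bimodule_equivalence :
  exists (F : Functor A B) (xi : forall X, Hom (FA X) (FB (F X))),
    is_equivalence F /\ (forall X, R (xi X) /\ G (xi X)) /\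
    forall X X' (u : Hom X X'), fmap FB (fmap F u) ∘ xi X = xi X' ∘ fmap FA u.
Proof.
have ch X : {Y : B & {xi : Hom (FA X) (FB Y) | R xi /\ G xi}}.
  have [Y HY] := constructive_indefinite_description _ (ex_l X).
  have [xi Hxi] := constructive_indefinite_description _ HY.
  by exists Y, xi.
pose Fo X := projT1 (ch X).
pose xi X : Hom (FA X) (FB (Fo X)) := proj1_sig (projT2 (ch X)).
have xr X : R (xi X) := proj1 (proj2_sig (projT2 (ch X))).
have xg X : G (xi X) := proj2 (proj2_sig (projT2 (ch X))).
have chm X X' (u : Hom X X') :
    {v : Hom (Fo X) (Fo X') | fmap FB v ∘ xi X = xi X' ∘ fmap FA u}.
  have [v [Hv _]] := constructive_indefinite_description _
    (univ_l (xr X) (xg X) (R_l u (xr X'))).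
  by exists v.
pose Fm X X' (u : Hom X X') := proj1_sig (chm X X' u).
have FmE X X' (u : Hom X X') : fmap FB (Fm X X' u) ∘ xi X = xi X' ∘ fmap FA u :=
  proj2_sig (chm X X' u).
have inj X Y (v v' : Hom (Fo X) Y) :
    fmap FB v ∘ xi X = fmap FB v' ∘ xi X -> v = v'.
  by move=> e; apply: (unique_eq (univ_l (xr X) (xg X) (R_r v' (xr X)))).
have Fid X : Fm X X (idc X) = idc (Fo X).
  by apply: inj; rewrite FmE !fmap_id comp_idl comp_idr.
have Fcomp X Y Z (g : Hom Y Z) (f : Hom X Y) : Fm X Z (g ∘ f) = Fm Y Z g ∘ Fm X Y f.
  apply: inj; rewrite FmE !fmap_comp -comp_assoc FmE !comp_assoc.
  by rewrite FmE.
pose F := Build_Functor Fid Fcomp.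
exists F, xi; split; last by split=> [X|X X' u]; [split | exact: FmE].
apply: fully_faithful_equivalence.
- move=> X X' v.
  have [u [Hu U]] := univ_r (xr X') (xg X') (R_r v (xr X)).
  exists u; split; first by apply: inj; rewrite [LHS]FmE.
  by move=> u' Hu'; apply: U; rewrite -FmE -Hu'.
- move=> Y; have [X [z [zr zg]]] := ex_r Y.
  have [v [Hv _]] := univ_l (xr X) (xg X) zr.
  exists X, v; exact: bimodule_iso (xr X) (xg X) zr zg Hv.
Qed.

(** A natural family of elements in [R] and [G] determines the second functor up to isomorphism.
    Both compatibilities of the theorem are instances. *)
Lemma bimodule_nat_iso (T : Category) (K : Functor T A) (F : Functor A B)
    (F2 : Functor T B) (x : forall X, Hom (FA X) (FB (F X)))
    (x2 : forall t, Hom (FA (K t)) (FB (F2 t))) :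
  (forall X, R (x X) /\ G (x X)) ->
  (forall X X' (u : Hom X X'), fmap FB (fmap F u) ∘ x X = x X' ∘ fmap FA u) ->
  (forall t, R (x2 t) /\ G (x2 t)) ->
  (forall t t' (u : Hom t t'),
     fmap FB (fmap F2 u) ∘ x2 t = x2 t' ∘ fmap FA (fmap K u)) ->
  nat_iso (F ⊙ K) F2.
Proof.
move=> H1 n1 H2 n2.
have ch t : {v : Hom (F (K t)) (F2 t) | fmap FB v ∘ x (K t) = x2 t}.
  have [v [Hv _]] := constructive_indefinite_description _
    (univ_l (proj1 (H1 (K t))) (proj2 (H1 (K t))) (proj1 (H2 t))).
  by exists v.
unshelve eexists (@Build_NatTrans T B (F ⊙ K) F2 (fun t => proj1_sig (ch t)) _).
- move=> t t' u.
  apply: (unique_eq (univ_l (proj1 (H1 (K t))) (proj2 (H1 (K t)))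
    (R_r (fmap F2 u) (proj1 (H2 t))))); rewrite fmap_comp -comp_assoc.
  + by rewrite n1 comp_assoc (proj2_sig (ch t')) n2.
  + by rewrite (proj2_sig (ch t)).
- move=> t; exact: bimodule_iso (proj1 (H1 _)) (proj2 (H1 _)) (proj1 (H2 t))
    (proj2 (H2 t)) (proj2_sig (ch t)).
Qed.
End Bimodule.

(** * The bimodule of an enlargement pair *)

Section EnlBimodule.
Context {Dia' Dia : DiagramCategory} (H : sub_dia Dia' Dia).
Context (S : PreMultiDerivator Dia) (D : PreMultiDerivator Dia').
Context (p : MDMor D (md_restrict H S)).
Let E := underlying D.
Let B := underlying (md_restrict H S).
Let P : PDMor E B := underlying_mor p.
Context (N Nt : EnlFunctor Dia Dia').
Context (Hcomma : forall I : DiaOb Dia, Dia' (Comma (enl_pi N I) (enl_pi Nt I))).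
Context (p_left : left_fibered_multiderivator p).
Context (p_right : right_fibered_multiderivator p).
Context (N_N3 : N3 N) (N_N4 : N4_left N) (N_N5 : N5_left N).
Context (Nt_N3 : N3 Nt) (Nt_N4 : N4_right Nt) (Nt_N5 : N5_right Nt).
Context (I : DiaOb Dia) (s : S I).
Let Q : DiaOb Dia' := corr_dia Hcomma I.
Let pr1 : Functor Q (N I) := comma_fst (enl_pi N I) (enl_pi Nt I).
Let pr2 : Functor Q (Nt I) := comma_snd (enl_pi N I) (enl_pi Nt I).

(** Over-ness and Cartesianness are dropped together, so that the elements of the bimodule are plain
    morphisms in [E Q]. *)
Definition enl_forget (M : EnlFunctor Dia Dia') : Functor (EnlFib M p s) (E (M I)).
Proof.
refine (@Build_Functor (EnlFib M p s) (E (M I)) (fun X => ⌊⌊X⌋⌋) (fun _ _ u => ⌊u⌋) _ _).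
- by move=> [[X PX] HX].
- by move=> X Y Z v u; apply: fib_comp.
Defined.

Definition corr_l : Functor (EnlFib N p s) (E Q) := pd_map E pr1 ⊙ enl_forget N.
Definition corr_r : Functor (EnlFib Nt p s) (E Q) := pd_map E pr2 ⊙ enl_forget Nt.

Lemma fibre_der1 (b : B dpt) : pd_der1 (fibre_pd P b).
Proof.
apply: fibre_pd_der1.
- by apply: und_isofibration; apply: lf_fder0.
- exact: der1_underlying (lf_der1D p_left).
- exact: der1_underlying (lf_der1S p_left).
Qed.

Lemma fibre_der2 (b : B dpt) : pd_der2 (fibre_pd P b).
Proof. exact: fibre_pd_der2 (lf_der2D p_left). Qed.

Lemma enl_over (M : EnlFunctor Dia Dia') (X : EnlFib M p s) :
  P (M I) (enl_forget M X) = base_pull H (enl_pi M I) s.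
Proof. exact: (proj2_sig ⌊X⌋). Qed.

Lemma enl_cart (M : EnlFunctor Dia Dia') (X : EnlFib M p s) :
  pd_cart (E := E) (enl_pi M I) (enl_forget M X).
Proof. exact: (proj1 (is_cart_iso (enl_over X)) (proj2_sig X)). Qed.

Lemma enl_vertical (M : EnlFunctor Dia Dia') (X Y : EnlFib M p s) (u : Hom X Y) :
  vertical P (fmap (enl_forget M) u).
Proof. by exists (pi_star H M S I s : B (M I)); apply: (proj2_sig u). Qed.

Lemma enl_faithful (M : EnlFunctor Dia Dia') (X Y : EnlFib M p s) (u v : Hom X Y) :
  fmap (enl_forget M) u = fmap (enl_forget M) v -> u = v.
Proof. exact: fc_hom_eq. Qed.

Lemma enl_hom_lift (M : EnlFunctor Dia Dia') (X Y : EnlFib M p s)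
    (w : Hom (enl_forget M X) (enl_forget M Y)) :
  vertical P w -> exists u : Hom X Y, fmap (enl_forget M) u = w.
Proof. by move=> Hw; exists (exist _ w (vertical_over (enl_over X) Hw)). Qed.

Lemma enl_ob_lift (M : EnlFunctor Dia Dia') (X : E (M I)) :
  P (M I) X = base_pull H (enl_pi M I) s -> pd_cart (enl_pi M I) X ->
  exists X' : EnlFib M p s, enl_forget M X' = X.
Proof.
move=> PX HX.
by exists (exist _ (exist _ X PX) (proj2 (is_cart_iso (p := p) PX) HX)).
Qed.

Definition corr_rel (X : EnlFib N p s) (Y : EnlFib Nt p s)
    (xi : Hom (corr_l X) (corr_r Y)) : Prop :=
  over_mu (Hcomma := Hcomma) (X := enl_forget N X) (Y := enl_forget Nt Y) p s xi.

Definition corr_equiv (X : EnlFib N p s) (Y : EnlFib Nt p s)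
    (xi : Hom (corr_l X) (corr_r Y)) : Prop :=
  corr_good (Hcomma := Hcomma) (X := enl_forget N X) (Y := enl_forget Nt Y) xi.

Lemma over_mu_comp_l (X X' : E (N I)) (Y : E (Nt I))
    (xi : Hom (pd_map E pr1 X) (pd_map E pr2 Y)) (u : Hom X' X) :
  vertical P u -> over_mu (Hcomma := Hcomma) p s xi ->
  over_mu (Hcomma := Hcomma) p s (xi ∘ fmap (pd_map E pr1) u).
Proof.
move=> Hu; rewrite /over_mu fmap_comp identity_comp_r //; exact: vertical_map.
Qed.

Lemma over_mu_comp_r (X : E (N I)) (Y Y' : E (Nt I))
    (xi : Hom (pd_map E pr1 X) (pd_map E pr2 Y)) (v : Hom Y Y') :
  vertical P v -> over_mu (Hcomma := Hcomma) p s xi ->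
  over_mu (Hcomma := Hcomma) p s (fmap (pd_map E pr2) v ∘ xi).
Proof.
move=> Hv; rewrite /over_mu fmap_comp identity_comp_l //; exact: vertical_map.
Qed.

Lemma corr_rel_l (X X' : EnlFib N p s) (Y : EnlFib Nt p s)
    (xi : Hom (corr_l X) (corr_r Y)) (u : Hom X' X) :
  corr_rel xi -> corr_rel (xi ∘ fmap corr_l u).
Proof. exact (over_mu_comp_l (enl_vertical u)). Qed.

Lemma corr_rel_r (X : EnlFib N p s) (Y Y' : EnlFib Nt p s)
    (xi : Hom (corr_l X) (corr_r Y)) (v : Hom Y Y') :
  corr_rel xi -> corr_rel (fmap corr_r v ∘ xi).
Proof. exact (over_mu_comp_r (enl_vertical v)). Qed.

(** The Kan extension is Cartesian because [xi] is invertible at the identity points, by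
    [corr_cart_r]. *)
Lemma corr_left_existence (X : EnlFib N p s) :
  exists (Y : EnlFib Nt p s) (xi : Hom (corr_l X) (corr_r Y)),
    corr_rel xi /\ corr_equiv xi.
Proof.
have [Y [xi [PY [Hr [Hg _]]]]] := left_existence Hcomma fibre_der1 fibre_der2
  (lf_fder0 p_left) (lf_fder3 p_left) (lf_fder4 p_left) N_N3 N_N4 N_N5
  (enl_over X) (enl_cart X).
have [Y' e] := enl_ob_lift PY (corr_cart_r N_N3 Hg).
by subst Y; exists Y', xi.
Qed.

Lemma corr_right_existence (Y : EnlFib Nt p s) :
  exists (X : EnlFib N p s) (xi : Hom (corr_l X) (corr_r Y)),
    corr_rel xi /\ corr_equiv xi.
Proof.
have [X [xi [PX [Hr [Hg _]]]]] := right_existence Hcomma fibre_der1 fibre_der2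
  (lf_fder0 p_left) (rf_fder0 p_right) (rf_fder3 p_right) (rf_fder4 p_right)
  Nt_N3 Nt_N4 Nt_N5 (enl_over Y) (enl_cart Y).
have [X' e] := enl_ob_lift PX (corr_cart_l Nt_N3 Hg).
by subst X; exists X', xi.
Qed.

(** [xi] is compared with the universal element constructed from the same [X]. The comparison [w] is
    invertible at every point [n], because some point of [Q] with identity arrow lies over [n] and
    both elements are invertible there. *)
Lemma corr_left_universal (X : EnlFib N p s) (Y : EnlFib Nt p s)
    (xi : Hom (corr_l X) (corr_r Y)) :
  corr_rel xi -> corr_equiv xi ->
  forall (Y' : EnlFib Nt p s) (xi' : Hom (corr_l X) (corr_r Y')), corr_rel xi' ->
  exists! v : Hom Y Y', fmap corr_r v ∘ xi = xi'.
Proof.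
move=> Hr Hg Y' xi' Hr'.
have [Y0 [x0 [PY0 [r0 [g0 U0]]]]] := left_existence Hcomma fibre_der1 fibre_der2
  (lf_fder0 p_left) (lf_fder3 p_left) (lf_fder4 p_left) N_N3 N_N4 N_N5
  (enl_over X) (enl_cart X).
have [w [[Vw Hw] _]] := U0 _ _ (enl_over Y) Hr.
have Iw : is_iso w.
  apply: (der2_iso (lf_der2D p_left)) => n.
  have [m Hm] := proj1 (N_N3 I) (enl_pi Nt I n).
  pose q : Q := @CommaOb _ _ _ (enl_pi N I) (enl_pi Nt I) m n (eqhom Hm).
  apply: (is_iso_arrow (@ev_map _ E Q (Nt I) pr2 q _ _ w)).
  have Hq : is_identity (com_arr q) := identity_eqhom Hm.
  apply: (iso_cancel_r (g0 q Hq)); rewrite -fmap_comp Hw; exact: Hg Hq.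
have [v [[Vv Hv] V]] := U0 _ _ (enl_over Y') Hr'.
have [w' [w1 w2]] := Iw.
have Vw' : vertical P w'.
  by apply: (identity_inv _ Vw); rewrite -fmap_comp w1 fmap_id.
have Vvw : vertical P (v ∘ w') := vertical_comp Vv Vw'.
have [vw Hvw] := enl_hom_lift Vvw.
exists vw; split.
  change (fmap (pd_map E pr2) (fmap (enl_forget Nt) vw) ∘ xi = xi').
  rewrite Hvw -Hw fmap_comp -comp_assoc [X in _ ∘ X]comp_assoc -fmap_comp w1 fmap_id.
  by rewrite comp_idl.
move=> v' Hv'; apply: enl_faithful; rewrite Hvw.
have Vv' := enl_vertical v'.
move: (fmap (enl_forget Nt) v') Vv' (Hv' : fmap (pd_map E pr2) _ ∘ xi = xi') => f Hf e.
have -> : v = f ∘ w.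
  apply: V; split; first exact: vertical_comp.
  by rewrite fmap_comp -comp_assoc Hw.
by rewrite -comp_assoc w2 comp_idr.
Qed.

Lemma corr_right_universal (X : EnlFib N p s) (Y : EnlFib Nt p s)
    (xi : Hom (corr_l X) (corr_r Y)) :
  corr_rel xi -> corr_equiv xi ->
  forall (X' : EnlFib N p s) (xi' : Hom (corr_l X') (corr_r Y)), corr_rel xi' ->
  exists! u : Hom X' X, xi ∘ fmap corr_l u = xi'.
Proof.
move=> Hr Hg X' xi' Hr'.
have [X0 [x0 [PX0 [r0 [g0 U0]]]]] := right_existence Hcomma fibre_der1 fibre_der2
  (lf_fder0 p_left) (rf_fder0 p_right) (rf_fder3 p_right) (rf_fder4 p_right)
  Nt_N3 Nt_N4 Nt_N5 (enl_over Y) (enl_cart Y).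
have [w [[Vw Hw] _]] := U0 _ _ (enl_over X) Hr.
have Iw : is_iso w.
  apply: (der2_iso (lf_der2D p_left)) => n.
  have [m Hm] := proj1 (Nt_N3 I) (enl_pi N I n).
  pose q : Q := @CommaOb _ _ _ (enl_pi N I) (enl_pi Nt I) n m (eqhom (eq_sym Hm)).
  apply: (is_iso_arrow (@ev_map _ E Q (N I) pr1 q _ _ w)).
  have Hq : is_identity (com_arr q) := identity_eqhom (eq_sym Hm).
  apply: (iso_cancel_l (g0 q Hq)); rewrite -fmap_comp Hw; exact: Hg Hq.
have [v [[Vv Hv] V]] := U0 _ _ (enl_over X') Hr'.
have [w' [w1 w2]] := Iw.
have Vw' : vertical P w'.
  by apply: (identity_inv _ Vw); rewrite -fmap_comp w1 fmap_id.
have Vvw : vertical P (w' ∘ v) := vertical_comp Vw' Vv.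
have [vw Hvw] := enl_hom_lift Vvw.
exists vw; split.
  change (xi ∘ fmap (pd_map E pr1) (fmap (enl_forget N) vw) = xi').
  rewrite Hvw -Hw fmap_comp comp_assoc -[X in X ∘ _]comp_assoc -fmap_comp w2 fmap_id.
  by rewrite comp_idr.
move=> v' Hv'; apply: enl_faithful; rewrite Hvw.
have Vv' := enl_vertical v'.
move: (fmap (enl_forget N) v') Vv' (Hv' : xi ∘ fmap (pd_map E pr1) _ = xi') => f Hf e.
have -> : v = w ∘ f.
  apply: V; split; first exact: vertical_comp.
  by rewrite fmap_comp comp_assoc Hw.
by rewrite comp_assoc w1 comp_idl.
Qed.
End EnlBimodule.

(** * Precomposition of multimorphisms with unary morphisms *)

Section Precomposition.
Context (C : Multicategory).

Fixpoint mhoms_id (xs : list C) : mhoms xs xs :=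
  match xs return mhoms xs xs with
  | [] => tt
  | x :: xs' => (mid x, mhoms_id xs')
  end.

Fixpoint mhoms_comp (xs ys zs : list C) :
  mhoms ys zs -> mhoms xs ys -> mhoms xs zs :=
  match xs, ys, zs return mhoms ys zs -> mhoms xs ys -> mhoms xs zs with
  | [], [], [] => fun _ _ => tt
  | x :: xs', y :: ys', z :: zs' => fun v u =>
      (@comp (und C) x y z (fst v) (fst u), @mhoms_comp xs' ys' zs' (snd v) (snd u))
  | [], [], _ :: _ => fun v _ => match v with end
  | [], _ :: _, _ => fun _ u => match u with end
  | _ :: _, [], _ => fun _ u => match u with end
  | _ :: _, _ :: _, [] => fun v _ => match v with end
  end.

(** For lists of different lengths [mhoms] is empty, so the value in the last two cases is
    immaterial. *)
Fixpoint mhoms_iso (xs ys : list C) : mhoms xs ys -> Prop :=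
  match xs, ys return mhoms xs ys -> Prop with
  | [], [] => fun _ => True
  | x :: xs', y :: ys' => fun u =>
      @is_iso (und C) x y (fst u) /\ @mhoms_iso xs' ys' (snd u)
  | [], _ :: _ => fun _ => True
  | _ :: _, [] => fun _ => True
  end.

Lemma mhoms_iso_inv (xs ys : list C) (u : mhoms xs ys) :
  mhoms_iso u -> exists v : mhoms ys xs,
    mhoms_comp v u = mhoms_id xs /\ mhoms_comp u v = mhoms_id ys.
Proof.
elim: xs ys u => [|x xs IH] [|y ys] //=.
move=> [u us] /= [[v [e1 e2]] /IH [vs [e3 e4]]].
by exists (v, vs); split; congr pair.
Qed.

Lemma mpost_mpost (Γ : list C) (x y z : C) (h : mhom [y] z) (g : mhom [x] y)
    (f : mhom Γ x) : mpost h (mpost g f) = mpost (@comp (und C) x y z h g) f.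
Proof. by symmetry; apply: (@mcomp_assoc C [] [] [y] [] []). Qed.

Lemma mpost_id (Γ : list C) (x : C) (f : mhom Γ x) : mpost (mid x) f = f.
Proof. exact: mcomp_idl. Qed.

Lemma mpost_mcomp (Γ1 Γ2 Γ Δ Γ' : list C) (x y z : C) (g : mhom [y] z)
    (f : mhom Γ y) (u : mhom Δ x) (e : Γ = Γ1 ++ x :: Γ2) (e' : Γ' = Γ1 ++ Δ ++ Γ2) :
  mpost g (mcomp Γ1 Γ2 e e' f u) = mcomp Γ1 Γ2 e e' (mpost g f) u.
Proof.
have e3 : Γ = ([] ++ Γ1) ++ x :: (Γ2 ++ []) by rewrite /= app_nil_r.
have e4 : Γ' = ([] ++ Γ1) ++ Δ ++ (Γ2 ++ []) by rewrite /= app_nil_r.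
rewrite [RHS](@mcomp_cast' C Γ1 Γ2 Γ Δ Γ' ([] ++ Γ1) (Γ2 ++ []) x z e e' _ u eq_refl
  (eq_sym (app_nil_r Γ2)) e3 e4).
symmetry; exact: mcomp_assoc.
Qed.

Lemma mpre_aux_irr (z : C) (xs ys : list C) (u : mhoms xs ys)
    (Γ0 Γ0' Γ Γ' : list C) (e : Γ = Γ0 ++ ys) (e' : Γ' = Γ0 ++ xs)
    (a : Γ = Γ0' ++ ys) (a' : Γ' = Γ0' ++ xs) (f : mhom Γ z) :
  Γ0 = Γ0' -> mpre_aux u e e' f = mpre_aux u a a' f.
Proof.
by move=> h; subst Γ0'; rewrite (proof_irrelevance _ a e) (proof_irrelevance _ a' e').
Qed.

Lemma mpost_mpre_aux (z z' : C) (g : mhom [z] z') (xs ys : list C)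
    (u : mhoms xs ys) (Γ0 Γ Γ' : list C) (e : Γ = Γ0 ++ ys) (e' : Γ' = Γ0 ++ xs)
    (f : mhom Γ z) :
  mpost g (mpre_aux u e e' f) = mpre_aux u e e' (mpost g f).
Proof.
elim: xs ys u Γ0 Γ Γ' e e' f => [|x xs IH] [|y ys] //= u Γ0 Γ Γ' e e' f.
- by subst Γ Γ'; rewrite !mcast_refl.
- by rewrite IH mpost_mcomp.
Qed.

Lemma mpost_mpre (z z' : C) (g : mhom [z] z') (xs ys : list C) (u : mhoms xs ys)
    (f : mhom ys z) : mpost g (mpre f u) = mpre (mpost g f) u.
Proof. exact: mpost_mpre_aux. Qed.

Lemma mpre_aux_id (z : C) (xs Γ0 Γ Γ' : list C) (e : Γ = Γ0 ++ xs)
    (e' : Γ' = Γ0 ++ xs) (f : mhom Γ z) (h : Γ = Γ') :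
  mpre_aux (mhoms_id xs) e e' f = mcast h f.
Proof.
elim: xs Γ0 Γ Γ' e e' f h => [|x xs IH] Γ0 Γ Γ' e e' f h /=.
  by congr mcast; apply: proof_irrelevance.
subst Γ' Γ; refine (eq_trans (IH _ _ _ _ _ _ eq_refl) _).
rewrite !mcast_refl; exact: mcomp_idr.
Qed.

Lemma mpre_id (z : C) (xs : list C) (f : mhom xs z) : mpre f (mhoms_id xs) = f.
Proof. exact: (@mpre_aux_id z xs [] xs xs eq_refl eq_refl f eq_refl). Qed.

(** Iterated [mcomp_swap]: plugging into one slot commutes with plugging into all later ones. [Γm]
    collects the slots that the induction has already passed. *)
Lemma mcomp_mpre_aux (z : C) (xs ys : list C) (us : mhoms xs ys)
    (w x : C) (v : mhom [w] x) (Γ0 Γm Γ Γa Γb Γc : list C)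
    (a1 : Γ = (Γ0 ++ x :: Γm) ++ ys) (a2 : Γa = (Γ0 ++ x :: Γm) ++ xs)
    (e1 : Γa = Γ0 ++ x :: (Γm ++ xs)) (e2 : Γc = Γ0 ++ [w] ++ (Γm ++ xs))
    (c1 : Γ = Γ0 ++ x :: (Γm ++ ys)) (c2 : Γb = Γ0 ++ [w] ++ (Γm ++ ys))
    (b1 : Γb = (Γ0 ++ w :: Γm) ++ ys) (b2 : Γc = (Γ0 ++ w :: Γm) ++ xs)
    (g : mhom Γ z) :
  mcomp Γ0 (Γm ++ xs) e1 e2 (mpre_aux us a1 a2 g) v =
  mpre_aux us b1 b2 (mcomp Γ0 (Γm ++ ys) c1 c2 g v).
Proof.
elim: xs ys us Γm Γ Γa Γb Γc a1 a2 e1 e2 c1 c2 b1 b2 g => [|a xs IH] [|b ys] //=.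
  move=> us Γm Γ Γa Γb Γc a1 a2 e1 e2 c1 c2 b1 b2 g.
  symmetry.
  refine (@mcomp_cast C Γ0 (Γm ++ []) Γ [w] Γb Γ0 (Γm ++ []) Γa [w] Γc x z c1 c2 g v
    eq_refl eq_refl _ eq_refl _ e1 e2).
move=> [u us] Γm Γ Γa Γb Γc a1 a2 e1 e2 c1 c2 b1 b2 g /=.
(* The lists are reassociated so that the slot just filled moves into [Γm]. *)
have h1 : (Γ0 ++ x :: Γm) ++ [a] = Γ0 ++ x :: (Γm ++ [a]) by rewrite -app_assoc.
have h2 : Γm ++ a :: xs = (Γm ++ [a]) ++ xs by rewrite -app_assoc.
have h3 : (Γ0 ++ w :: Γm) ++ [a] = Γ0 ++ w :: (Γm ++ [a]) by rewrite -app_assoc.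
set G1 := (Γ0 ++ x :: Γm) ++ [a] ++ ys.
set G2 := (Γ0 ++ w :: Γm) ++ [a] ++ ys.
have f1 : G1 = (Γ0 ++ x :: (Γm ++ [a])) ++ ys by rewrite /G1 app_assoc h1.
have f2 : Γa = (Γ0 ++ x :: (Γm ++ [a])) ++ xs by rewrite a2 -h1 -!app_assoc.
have f3 : Γa = Γ0 ++ x :: ((Γm ++ [a]) ++ xs) by rewrite e1 h2.
have f4 : Γc = Γ0 ++ [w] ++ ((Γm ++ [a]) ++ xs) by rewrite e2 h2.
have f5 : G1 = Γ0 ++ x :: ((Γm ++ [a]) ++ ys) by rewrite /G1 -!app_assoc.
have f6 : G2 = Γ0 ++ [w] ++ ((Γm ++ [a]) ++ ys) by rewrite /G2 /= -!app_assoc.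
have f7 : G2 = (Γ0 ++ w :: (Γm ++ [a])) ++ ys by rewrite /G2 app_assoc h3.
have f8 : Γc = (Γ0 ++ w :: (Γm ++ [a])) ++ xs by rewrite b2 -h3 -!app_assoc.
rewrite (mpre_aux_irr us _ _ f1 f2 _ h1) (mpre_aux_irr us _ _ f7 f8 _ h3).
rewrite (@mcomp_cast' C Γ0 (Γm ++ a :: xs) Γa [w] Γc Γ0 ((Γm ++ [a]) ++ xs) x z
  e1 e2 _ v eq_refl h2 f3 f4).
rewrite (IH _ us _ _ _ _ _ f1 f2 f3 f4 f5 f6 f7 f8).
congr (mpre_aux _ _ _ _).
have h4 : (Γm ++ [a]) ++ ys = Γm ++ [a] ++ ys by rewrite -app_assoc.
have g5 : G1 = Γ0 ++ x :: (Γm ++ [a] ++ ys) by rewrite f5 h4.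
have g6 : G2 = Γ0 ++ [w] ++ (Γm ++ [a] ++ ys) by rewrite f6 h4.
rewrite (@mcomp_cast' C Γ0 ((Γm ++ [a]) ++ ys) G1 [w] G2 Γ0 (Γm ++ [a] ++ ys) x z
  f5 f6 _ v eq_refl h4 g5 g6).
symmetry.
refine (@mcomp_swap C Γ0 Γm ys Γ [w] [a] Γb G1 G2 x b z g v u c1 c2 b1 _ a1 _ g5 g6).
Qed.

Lemma mpre_aux_comp (z : C) (ws xs ys : list C) (us : mhoms xs ys)
    (vs : mhoms ws xs) (Γ0 Γ Γ' Γ'' : list C) (e : Γ = Γ0 ++ ys)
    (e' : Γ' = Γ0 ++ xs) (a : Γ' = Γ0 ++ xs) (a' : Γ'' = Γ0 ++ ws) (f : mhom Γ z) :
  mpre_aux vs a a' (mpre_aux us e e' f) = mpre_aux (mhoms_comp us vs) e a' f.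
Proof.
elim: ws xs ys us vs Γ0 Γ Γ' Γ'' e e' a a' f => [|w ws IH] [|x xs] [|y ys] //=.
  by move=> us vs Γ0 Γ Γ' Γ'' e e' a a' f; apply: marrow_inj; rewrite !mcast_arrow.
move=> [u us] [v vs] Γ0 Γ Γ' Γ'' e e' a a' f /=.
have b1 : Γ0 ++ [w] ++ ys = (Γ0 ++ w :: []) ++ ys by rewrite -app_assoc.
have b2 : Γ0 ++ [w] ++ xs = (Γ0 ++ w :: []) ++ xs by rewrite -app_assoc.
rewrite (mcomp_mpre_aux us v (Γm := []) _ _ a eq_refl eq_refl eq_refl b1 b2).
rewrite IH.
set g1 := mcomp _ _ _ _ (mcomp _ _ _ _ f u) v.
set g2 := mcomp _ _ _ _ f _.
have -> : g1 = g2.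
  rewrite /g1 /g2.
  have h1 : Γ0 ++ [x] ++ ys = (Γ0 ++ []) ++ x :: ([] ++ ys) by rewrite app_nil_r.
  have h2 : Γ0 ++ [w] ++ ys = (Γ0 ++ []) ++ [w] ++ ([] ++ ys) by rewrite app_nil_r.
  rewrite (@mcomp_cast' C Γ0 ys _ _ _ (Γ0 ++ []) ([] ++ ys) _ _ _ _ _ v
    (eq_sym (app_nil_r Γ0)) eq_refl h1 h2).
  exact: mcomp_assoc.
exact: mpre_aux_irr.
Qed.

Lemma mpre_mpre (z : C) (ws xs ys : list C) (us : mhoms xs ys) (vs : mhoms ws xs)
    (f : mhom ys z) : mpre (mpre f us) vs = mpre f (mhoms_comp us vs).
Proof. exact: mpre_aux_comp. Qed.

(** The counterpart of [arrow] for lists of unary morphisms whose end points agree only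
    propositionally. *)
Record mharrow := MHArrow { mh_src : list C; mh_tgt : list C; mh_homs : mhoms mh_src mh_tgt }.

Lemma mharrow_cons (x y x' y' : C) (xs ys xs' ys' : list C) (u : mhom [x] y)
    (u' : mhom [x'] y') (us : mhoms xs ys) (us' : mhoms xs' ys') :
  MArrow u = MArrow u' -> MHArrow us = MHArrow us' ->
  @MHArrow (x :: xs) (y :: ys) (u, us) = @MHArrow (x' :: xs') (y' :: ys') (u', us').
Proof.
move=> /marrow_arrow e1 e2.
refine (@arrow_elim (und C) x y u (fun x' y' u' =>
  @MHArrow (x :: xs) (y :: ys) (u, us) = @MHArrow (x' :: xs') (y' :: ys') (u', us'))
  _ x' y' u' e1).
exact (f_equal (fun a => @MHArrow (x :: mh_src a) (y :: mh_tgt a) (u, mh_homs a)) e2).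
Qed.

Lemma mpre_arrow (xs ys xs' ys' : list C) (z z' : C) (us : mhoms xs ys)
    (us' : mhoms xs' ys') (f : mhom ys z) (f' : mhom ys' z') :
  MArrow f = MArrow f' -> MHArrow us = MHArrow us' ->
  MArrow (mpre f us) = MArrow (mpre f' us').
Proof.
move=> ef e; move: f' ef.
refine (match e in _ = a return forall f' : mhom (mh_tgt a) z',
  MArrow f = MArrow f' -> MArrow (mpre f us) = MArrow (mpre f' (mh_homs a))
  with eq_refl => _ end) => /= f' ef.
have ez := f_equal (@mtgt C) ef; rewrite /= in ez; subst z'.
by rewrite (marrow_inj ef).
Qed.

Lemma mpost_arrow (xs xs' : list C) (y z y' z' : C) (f : mhom xs y)
    (f' : mhom xs' y') (g : mhom [y] z) (g' : mhom [y'] z') :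
  MArrow f = MArrow f' -> MArrow g = MArrow g' ->
  MArrow (mpost g f) = MArrow (mpost g' f').
Proof.
move=> ef /marrow_arrow eg; move: xs' f' ef; move: y' z' g' eg.
apply: (@arrow_elim (und C)) => xs' f' ef.
have ex := f_equal (@msrc C) ef; rewrite /= in ex; subst xs'.
by rewrite (marrow_inj ef).
Qed.
End Precomposition.

Section FunctorPrecomposition.
Context (C D : Multicategory) (F : MFunctor C D).

Fixpoint mhoms_map (xs ys : list C) : mhoms xs ys -> mhoms (map F xs) (map F ys) :=
  match xs, ys return mhoms xs ys -> mhoms (map F xs) (map F ys) with
  | [], [] => fun _ => tt
  | x :: xs', y :: ys' => fun u => (mfmap F (fst u), @mhoms_map xs' ys' (snd u))
  | [], _ :: _ => fun u => match u with end
  | _ :: _, [] => fun u => match u with end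
  end.

Lemma mfmap_mcast (Γ Γ' : list C) (z : C) (e : Γ = Γ') (e' : map F Γ = map F Γ')
    (f : mhom Γ z) : mfmap F (mcast e f) = mcast e' (mfmap F f).
Proof. by subst Γ'; rewrite !mcast_refl. Qed.

Lemma mfmap_mpost (Γ : list C) (y z : C) (g : mhom [y] z) (f : mhom Γ y) :
  mfmap F (mpost g f) = mpost (mfmap F g) (mfmap F f).
Proof. exact: mfmap_comp. Qed.

Lemma mfmap_mpre_aux (z : C) (xs ys : list C) (u : mhoms xs ys)
    (Γ0 Γ Γ' : list C) (e : Γ = Γ0 ++ ys) (e' : Γ' = Γ0 ++ xs)
    (a : map F Γ = map F Γ0 ++ map F ys) (a' : map F Γ' = map F Γ0 ++ map F xs)
    (f : mhom Γ z) :
  mfmap F (mpre_aux u e e' f) = mpre_aux (mhoms_map u) a a' (mfmap F f).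
Proof.
elim: xs ys u Γ0 Γ Γ' e e' a a' f => [|x xs IH] [|y ys] //= u Γ0 Γ Γ' e e' a a' f.
  by apply: mfmap_mcast.
have h : map F (Γ0 ++ [x]) = map F Γ0 ++ [F x] by rewrite map_app.
have b : map F (Γ0 ++ [x] ++ ys) = map F (Γ0 ++ [x]) ++ map F ys.
  by rewrite -map_app -app_assoc.
have b' : map F Γ' = map F (Γ0 ++ [x]) ++ map F xs by rewrite a' h -app_assoc.
rewrite (IH _ _ _ _ _ _ _ b b').
have c : map F (Γ0 ++ [x] ++ ys) = map F Γ0 ++ [F x] ++ map F ys by rewrite map_app.
rewrite (mfmap_comp e eq_refl a c).
move: (map F (Γ0 ++ [x] ++ ys)) c b => Γx c; subst Γx => b.
exact: mpre_aux_irr h.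
Qed.

Lemma mfmap_mpre (z : C) (xs ys : list C) (u : mhoms xs ys) (f : mhom ys z) :
  mfmap F (mpre f u) = mpre (mfmap F f) (mhoms_map u).
Proof. exact: mfmap_mpre_aux. Qed.

End FunctorPrecomposition.

(** * CoCartesian multimorphisms and unary factorizations *)

Section MultiCocartesian.
Context (C B : Multicategory) (p : MFunctor C B).

(** The case of empty surrounding lists; the casts absorb the trailing empty list in the
    definition. *)
Lemma cocartesian_lift (Es : list C) (F G : C) (xi : mhom Es F) (h : mhom Es G)
    (g : mhom [p F] (p G)) :
  cocartesian p xi -> mfmap p h = mpost g (mfmap p xi) ->
  exists! h' : mhom [F] G, mfmap p h' = g /\ mpost h' xi = h.
Proof.
move=> Hxi e.
have E0 := app_nil_r Es.
have [|h' [[h1 h2] U]] := Hxi [] [] G g (mcast (eq_sym E0) h).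
  have E1 : map p Es = map p ([] ++ Es ++ []) by rewrite /= app_nil_r.
  rewrite (mfmap_mcast (eq_sym E0) E1) e /mpost.
  exact: (mcomp_cast _ _ _ _ eq_refl eq_refl eq_refl eq_refl E1).
have key (k : mhom [F] G) : mcomp [] [] eq_refl eq_refl k xi = mcast (eq_sym E0) (mpost k xi).
  symmetry; exact: (mcomp_cast _ _ _ _ eq_refl eq_refl eq_refl eq_refl (eq_sym E0)).
have inj (k k' : mhom Es G) : mcast (eq_sym E0) k = mcast (eq_sym E0) k' -> k = k'.
  by move=> ek; apply: marrow_inj; rewrite -(mcast_arrow (eq_sym E0) k) ek mcast_arrow.
exists h'; split.
  split; first by rewrite mcast_refl in h1.
  by apply: inj; rewrite -key.
move=> k [k1 k2]; apply: U; split; first by rewrite mcast_refl.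
by rewrite key k2.
Qed.

Lemma cocartesian_inj (Es : list C) (F G : C) (xi : mhom Es F) (h h' : mhom [F] G) :
  cocartesian p xi -> mfmap p h = mfmap p h' -> mpost h xi = mpost h' xi -> h = h'.
Proof.
move=> Hxi e1 e2.
by apply: (unique_eq (cocartesian_lift (h := mpost h xi) Hxi (mfmap_mpost p h xi))).
Qed.

(** As in [cocartesian_arrow_iso], with [ws] inverted entry by entry: the inverse of [v] is the
    factorization of [mpre u vs] through [u']. *)
Lemma cocartesian_mpre_iso (xs xs' : list C) (y y' : C) (u : mhom xs y)
    (u' : mhom xs' y') (ws : mhoms xs xs') (v : mhom [y] y') :
  cocartesian p u -> cocartesian p u' -> mhoms_iso ws ->
  @is_iso (und B) (p y) (p y') (mfmap p v) -> mpost v u = mpre u' ws ->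
  @is_iso (und C) y y' v.
Proof.
move=> Hu Hu' /mhoms_iso_inv [vs [w1 w2]] [g [g1 g2]] e.
have Ev : mpost v (mpre u vs) = u' by rewrite mpost_mpre e mpre_mpre w2 mpre_id.
have Eg : mfmap p (mpre u vs) = mpost g (mfmap p u').
  rewrite -Ev mfmap_mpost mpost_mpost.
  by rewrite [@comp _ _ _ _ g _]g1 mpost_id.
have [v' [[v1 v2] _]] := cocartesian_lift Hu' Eg.
exists v'; split.
- apply: (cocartesian_inj Hu); last first.
    rewrite -mpost_mpost e mpost_mpre v2 mpre_mpre w1 mpre_id.
    by symmetry; apply: mpost_id.
  rewrite [LHS](@fmap_comp _ _ (undF p) _ _ _ v' v) /= v1 [LHS]g1.
  by symmetry; apply: mfmap_id.
- apply: (cocartesian_inj Hu'); last first.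
    by rewrite -mpost_mpost v2 Ev; symmetry; apply: mpost_id.
  rewrite [LHS](@fmap_comp _ _ (undF p) _ _ _ v v') /= v1 [LHS]g2.
  by symmetry; apply: mfmap_id.
Qed.
End MultiCocartesian.

(** * Compatibility with pull-back *)

Lemma comma_lift_fst (A B C X : Category) (F : Functor A C) (G : Functor B C)
    (a : Functor X A) (b : Functor X B) (t : NatTrans (F ⊙ a) (G ⊙ b)) :
  comma_fst F G ⊙ comma_lift t = a.
Proof. exact: functor_eq. Qed.

Lemma comma_lift_snd (A B C X : Category) (F : Functor A C) (G : Functor B C)
    (a : Functor X A) (b : Functor X B) (t : NatTrans (F ⊙ a) (G ⊙ b)) :
  comma_snd F G ⊙ comma_lift t = b.
Proof. exact: functor_eq. Qed.

Lemma compF_square (A A' B B' C C' : Category) (F : Functor A B) (F' : Functor A' B')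
    (G : Functor B C) (G' : Functor B' C') (a : Functor A A') (b : Functor B B')
    (c : Functor C C') :
  F' ⊙ a = b ⊙ F -> G' ⊙ b = c ⊙ G -> G' ⊙ F' ⊙ a = c ⊙ (G ⊙ F).
Proof.
move=> e1 e2; transitivity (G' ⊙ (F' ⊙ a)); first exact: functor_eq.
rewrite e1; transitivity (G' ⊙ b ⊙ F); first exact: functor_eq.
by rewrite e2; apply: functor_eq.
Qed.

Section PullCompatibility.
Context {Dia' Dia : DiagramCategory} (H : sub_dia Dia' Dia).
Context (S : PreMultiDerivator Dia) (D : PreMultiDerivator Dia').
Context (p : MDMor D (md_restrict H S)).
Let E := underlying D.
Let B := underlying (md_restrict H S).
Let P : PDMor E B := underlying_mor p.
Context (N Nt : EnlFunctor Dia Dia').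
Context (Hcomma : forall I : DiaOb Dia, Dia' (Comma (enl_pi N I) (enl_pi Nt I))).
Let Q (I : DiaOb Dia) : DiaOb Dia' := corr_dia Hcomma I.
Let pr1 (I : DiaOb Dia) : Functor (Q I) (N I) := comma_fst (enl_pi N I) (enl_pi Nt I).
Let pr2 (I : DiaOb Dia) : Functor (Q I) (Nt I) := comma_snd (enl_pi N I) (enl_pi Nt I).
Context (I J : DiaOb Dia) (a : Functor I J).

(** The functor [a] carries the comma arrows into [J]; the outer [eqhom] are there because
    [enl_pi_nat] is not definitional. *)
Definition corr_dia_map_nt :
  NatTrans (enl_pi N J ⊙ (enl_map N a ⊙ pr1 I)) (enl_pi Nt J ⊙ (enl_map Nt a ⊙ pr2 I)).
Proof.
refine (@Build_NatTrans (Q I) J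
  (enl_pi N J ⊙ (enl_map N a ⊙ pr1 I)) (enl_pi Nt J ⊙ (enl_map Nt a ⊙ pr2 I))
  (fun q => eqhom (eq_sym (enl_pi_ob a (com_r q))) ∘
            (fmap a (com_arr q) ∘ eqhom (enl_pi_ob a (com_l q)))) _).
move=> q q' [[u v] Huv] /=; rewrite /= in Huv.
have e1 := eqhom_fmap (enl_pi_nat N a) u
  (enl_pi_ob a (com_l q)) (enl_pi_ob a (com_l q')).
have e2 := eqhom_fmap (eq_sym (enl_pi_nat Nt a)) v
  (eq_sym (enl_pi_ob a (com_r q))) (eq_sym (enl_pi_ob a (com_r q'))).
rewrite /= in e1 e2; rewrite -!comp_assoc e1.
rewrite (comp_assoc (fmap a (com_arr q'))) -fmap_comp Huv fmap_comp.
by rewrite -!comp_assoc [LHS]comp_assoc e2 -!comp_assoc.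
Defined.

Definition corr_dia_map : Functor (Q I) (Q J) :=
  @comma_lift _ _ _ (enl_pi N J) (enl_pi Nt J) (Q I)
    (enl_map N a ⊙ pr1 I) (enl_map Nt a ⊙ pr2 I) corr_dia_map_nt.

Lemma corr_dia_map_arr (q : Q I) :
  Arrow (com_arr (corr_dia_map q)) = Arrow (fmap a (com_arr q)).
Proof.
rewrite /=; have H1 := identity_eqhom (eq_sym (@enl_pi_ob _ _ Nt _ _ a (com_r q))).
have H2 := identity_eqhom (@enl_pi_ob _ _ N _ _ a (com_l q)).
by rewrite (identity_comp_l _ H1) (identity_comp_r _ H2).
Qed.

Lemma corr_map_l (X Y : E (N J)) (u : Hom X Y) :
  Arrow (fmap (pd_map E corr_dia_map) (fmap (pd_map E (pr1 J)) u)) =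
  Arrow (fmap (pd_map E (pr1 I)) (fmap (pd_map E (enl_map N a)) u)).
Proof.
rewrite !pd_map_comp; apply: fmap_arrow_eq; congr (pd_map E _).
exact: comma_lift_fst.
Qed.

Lemma corr_map_r (X Y : E (Nt J)) (u : Hom X Y) :
  Arrow (fmap (pd_map E corr_dia_map) (fmap (pd_map E (pr2 J)) u)) =
  Arrow (fmap (pd_map E (pr2 I)) (fmap (pd_map E (enl_map Nt a)) u)).
Proof.
rewrite !pd_map_comp; apply: fmap_arrow_eq; congr (pd_map E _).
exact: comma_lift_snd.
Qed.

Section PullArrow.
Context (X : E (N J)) (Y : E (Nt J)).

(** The end points are corrected along equalities of objects read off from [corr_map_l] and
    [corr_map_r] at identity morphisms. *)
Definition corr_pull (xi : Hom (pd_map E (pr1 J) X) (pd_map E (pr2 J) Y)) :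
  Hom (pd_map E (pr1 I) (pd_map E (enl_map N a) X))
      (pd_map E (pr2 I) (pd_map E (enl_map Nt a) Y)) :=
  hcast (arrow_src (corr_map_l (idc X))) (arrow_src (corr_map_r (idc Y)))
    (fmap (pd_map E corr_dia_map) xi).

Context (xi : Hom (pd_map E (pr1 J) X) (pd_map E (pr2 J) Y)).

Lemma corr_pull_arrow :
  Arrow (corr_pull xi) = Arrow (fmap (pd_map E corr_dia_map) xi).
Proof. exact: hcast_arrow. Qed.

Lemma corr_pull_good : corr_good (Hcomma := Hcomma) xi ->
  corr_good (Hcomma := Hcomma) (corr_pull xi).
Proof.
move=> Hg q Hq.
apply: (is_iso_arrow (eq_sym (arrow_fmap (ev E q) corr_pull_arrow))).
apply: (is_iso_arrow (eq_sym (@ev_map _ E (Q I) (Q J) corr_dia_map q _ _ xi))).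
apply: Hg; apply: (identity_arrow (eq_sym (corr_dia_map_arr q))).
exact: identity_fmap.
Qed.

(** The canonical 2-cell of [J] whiskered with [corr_dia_map] equals that of [I] whiskered with [a];
    the two whiskering axioms of [S] evaluate the two sides. *)
Lemma corr_pull_over (s : S J) : over_mu (Hcomma := Hcomma) p s xi ->
  over_mu (Hcomma := Hcomma) p (md_map S a s) (corr_pull xi).
Proof.
move=> Hr; rewrite /over_mu (arrow_fmap (P (Q I)) corr_pull_arrow).
rewrite (pm_map P corr_dia_map xi) (arrow_fmap (pd_map B corr_dia_map) Hr).
pose A := underlying S.
have e1 := @pd_whiskR _ A (dincl H (Q I)) (dincl H (Q J)) J _ _
  (comma_nt (enl_pi N J) (enl_pi Nt J)) corr_dia_map s.
have e2 := @pd_whiskL _ A (dincl H (Q I)) I J a _ _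
  (comma_nt (enl_pi N I) (enl_pi Nt I)) s.
refine (eq_trans (eq_sym e1) (eq_trans _ e2)).
apply: (@pd_2_eq _ A (dincl H (Q I)) J).
- exact: compF_square (comma_lift_fst corr_dia_map_nt) (enl_pi_nat N a).
- exact: compF_square (comma_lift_snd corr_dia_map_nt) (enl_pi_nat Nt a).
- exact: corr_dia_map_arr.
Qed.
End PullArrow.

Lemma corr_pull_nat (X X' : E (N J)) (Y Y' : E (Nt J))
    (xi : Hom (pd_map E (pr1 J) X) (pd_map E (pr2 J) Y))
    (xi' : Hom (pd_map E (pr1 J) X') (pd_map E (pr2 J) Y'))
    (u : Hom X X') (v : Hom Y Y') :
  fmap (pd_map E (pr2 J)) v ∘ xi = xi' ∘ fmap (pd_map E (pr1 J)) u ->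
  fmap (pd_map E (pr2 I)) (fmap (pd_map E (enl_map Nt a)) v) ∘ corr_pull xi =
  corr_pull xi' ∘ fmap (pd_map E (pr1 I)) (fmap (pd_map E (enl_map N a)) u).
Proof.
move=> e; apply: arrow_inj.
rewrite (arrow_comp (corr_pull_arrow xi) (eq_sym (corr_map_r v))).
rewrite (arrow_comp (eq_sym (corr_map_l u)) (corr_pull_arrow xi')).
by rewrite -!fmap_comp e.
Qed.
End PullCompatibility.

(** * Compatibility with push-forward *)

Lemma mfmap_arrow (C D : Multicategory) (F : MFunctor C D) (Γ Γ' : list C) (z z' : C)
    (f : mhom Γ z) (f' : mhom Γ' z') :
  MArrow f = MArrow f' -> MArrow (mfmap F f) = MArrow (mfmap F f').
Proof. by move=> e; move: Γ' z' f' e; apply: marrow_elim. Qed.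

Lemma mfmap_compM_arrow (C D E : Multicategory) (G : MFunctor D E) (F : MFunctor C D)
    (K : MFunctor C E) (Γ : list C) (z : C) (f : mhom Γ z) :
  K = G ⊚ F -> MArrow (mfmap G (mfmap F f)) = MArrow (mfmap K f).
Proof. by move=> ->; rewrite /= mcast_arrow. Qed.

Section PushCompatibility.
Context {Dia' Dia : DiagramCategory} (H : sub_dia Dia' Dia).
Context (S : PreMultiDerivator Dia) (D : PreMultiDerivator Dia').
Context (p : MDMor D (md_restrict H S)).
Let E := underlying D.
Let B := underlying (md_restrict H S).
Let P : PDMor E B := underlying_mor p.
Context (f0 : fder0_left p).
Context (I : DiaOb Dia).

Lemma enl_components_iso (M : EnlFunctor Dia Dia') (k k' : M I) (m : Hom k k')
    (ss : list (S I)) (X : ProdFam (@EnlFib _ _ H M S D p I) ss) :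
  is_identity (fmap (enl_pi M I) m) ->
  mhoms_iso (mcomponents (@md_2 _ D dpt (M I) _ _ (pointNT m))
    (fib_obs (enl_incl M p ss X))).
Proof.
move=> Hm; elim: ss X => [|s ss IH]; first by [].
by move=> [X Xs]; refine (conj (enl_cart X Hm) (IH Xs)).
Qed.

(** Naturality of the 2-cell of [m] at the push-forward arrow relates the transition morphism of the
    push-forward to those of its arguments. The arrows at [k] and [k'] are coCartesian, the
    arguments have invertible transitions, and the base transition is an identity. *)
Lemma push_cart (M : EnlFunctor Dia Dia') (ss : list (S I)) (t : S I) (f : mhom ss t)
    (W : PushFun (p (M I)) (mfmap (pi_star H M S I) f)) : push_preserves_cart W.
Proof.
move=> X; set Z := W (enl_incl M p ss X).
have PZ : p (M I) ⌊Z⌋ = base_pull H (enl_pi M I) t := proj2_sig Z.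
apply/(is_cart_iso PZ) => k k' m Hm.
have Hc (n : M I) : cocartesian (p dpt)
    (mfmap (@md_map _ D dpt (M I) (pointF n)) (pf_arr W (enl_incl M p ss X))).
  exact: (proj2 f0 dpt (M I) (pointF n) _ _ _ (@pf_cocart _ _ _ _ _ _ W (enl_incl M p ss X))).
refine (cocartesian_mpre_iso (Hc k) (Hc k') (enl_components_iso X Hm) _
  (mnt_nat (@md_2 _ D dpt (M I) _ _ (pointNT m)) (pf_arr W (enl_incl M p ss X)))).
apply: identity_iso; apply: (identity_arrow (eq_sym (pm_tr P m ⌊Z⌋))).
by rewrite [P _ ⌊Z⌋]PZ; apply: base_tr_identity.
Qed.

Context (N Nt : EnlFunctor Dia Dia').
Context (Hcomma : forall I : DiaOb Dia, Dia' (Comma (enl_pi N I) (enl_pi Nt I))).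
Let Q : DiaOb Dia' := corr_dia Hcomma I.
Let pr1 : Functor Q (N I) := comma_fst (enl_pi N I) (enl_pi Nt I).
Let pr2 : Functor Q (Nt I) := comma_snd (enl_pi N I) (enl_pi Nt I).
Context (F : forall s : S I, Functor (EnlFib N p s) (EnlFib Nt p s)).
Context (xi : forall (s : S I) (X : EnlFib N p s),
  Hom (corr_l p Hcomma s X) (corr_r p Hcomma s (F s X))).
Context (xi_rel : forall s X, corr_rel (@xi s X)).
Context (xi_equiv : forall s X, corr_equiv (@xi s X)).
Context (xi_nat : forall s X X' (u : Hom X X'),
  fmap (corr_r p Hcomma s) (fmap (F s) u) ∘ xi X = xi X' ∘ fmap (corr_l p Hcomma s) u).

Fixpoint fam_xi (ss : list (S I)) : forall X : ProdFam (@EnlFib _ _ H N S D p I) ss,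
    mhoms (map (md_map D pr1) (fib_obs (enl_incl N p ss X)))
          (map (md_map D pr2) (fib_obs (enl_incl Nt p ss (prodF F ss X)))) :=
  match ss return forall X : ProdFam (@EnlFib _ _ H N S D p I) ss,
    mhoms (map (md_map D pr1) (fib_obs (enl_incl N p ss X)))
          (map (md_map D pr2) (fib_obs (enl_incl Nt p ss (prodF F ss X)))) with
  | [] => fun _ => tt
  | s :: ss' => fun X => (xi (fst X), fam_xi (snd X))
  end.

Let muN := @md_2 Dia S (dincl H Q) I _ _ (comma_nt (enl_pi N I) (enl_pi Nt I)).

Lemma fam_xi_over (ss : list (S I)) (X : ProdFam (@EnlFib _ _ H N S D p I) ss) :
  MHArrow (mhoms_map (p Q) (fam_xi X)) = MHArrow (mcomponents muN ss).
Proof.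
elim: ss X => [|s ss IH]; first by [].
by move=> [X Xs]; refine (mharrow_cons (arrow_marrow (@xi_rel s X)) (IH Xs)).
Qed.

Lemma fam_xi_iso (q : Q) (ss : list (S I)) (X : ProdFam (@EnlFib _ _ H N S D p I) ss) :
  is_identity (com_arr q) ->
  mhoms_iso (mhoms_map (@md_map _ D dpt Q (pointF q)) (fam_xi X)).
Proof.
move=> Hq; elim: ss X => [|s ss IH]; first by [].
by move=> [X Xs]; refine (conj (@xi_equiv s X q Hq) (IH Xs)).
Qed.

Lemma fam_xi_nat (ss : list (S I)) (X X' : ProdFam (@EnlFib _ _ H N S D p I) ss)
    (u : Hom X X') :
  mhoms_comp (mhoms_map (md_map D pr2)
      (fib_homs (fmap (enl_incl Nt p ss) (fmap (prodF F ss) u)))) (fam_xi X) =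
  mhoms_comp (fam_xi X') (mhoms_map (md_map D pr1) (fib_homs (fmap (enl_incl N p ss) u))).
Proof.
elim: ss X X' u => [|s ss IH]; first by [].
move=> [X Xs] [X' Xs'] [u us].
by refine (f_equal2 pair (xi_nat u) (IH Xs Xs' us)).
Qed.

Context (ss : list (S I)) (t : S I) (f : mhom ss t).
Context (W : PushFun (p (N I)) (mfmap (pi_star H N S I) f)).
Context (Wt : PushFun (p (Nt I)) (mfmap (pi_star H Nt S I) f)).

Section AtObject.
Context (X : ProdFam (@EnlFib _ _ H N S D p I) ss).
Let WX : E (N I) := ⌊W (enl_incl N p ss X)⌋.
Let WtX : E (Nt I) := ⌊Wt (enl_incl Nt p ss (prodF F ss X))⌋.

Definition push_l : mhom (map (md_map D pr1) (fib_obs (enl_incl N p ss X))) (md_map D pr1 WX) :=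
  mfmap (md_map D pr1) (pf_arr W (enl_incl N p ss X)).

Definition push_r :
  mhom (map (md_map D pr2) (fib_obs (enl_incl Nt p ss (prodF F ss X)))) (md_map D pr2 WtX) :=
  mfmap (md_map D pr2) (pf_arr Wt (enl_incl Nt p ss (prodF F ss X))).

Lemma push_l_cocart : cocartesian (p Q) push_l.
Proof.
exact: (proj2 f0 Q (N I) pr1 _ _ _ (@pf_cocart _ _ _ _ _ _ W (enl_incl N p ss X))).
Qed.

Lemma push_r_cocart : cocartesian (p Q) push_r.
Proof.
exact: (proj2 f0 Q (Nt I) pr2 _ _ _
  (@pf_cocart _ _ _ _ _ _ Wt (enl_incl Nt p ss (prodF F ss X)))).
Qed.

Lemma push_l_over : MArrow (mfmap (p Q) push_l) =
  MArrow (mfmap (@md_map Dia S (dincl H Q) I (enl_pi N I ⊙ pr1)) f).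
Proof.
rewrite /push_l.
refine (eq_trans (mfmap_compM_arrow _ (eq_sym (mm_nat p pr1))) _); rewrite /= mcast_arrow.
refine (eq_trans (mfmap_arrow _ (pf_over W (enl_incl N p ss X))) _).
exact: mfmap_compM_arrow (@md_comp _ S (dincl H Q) (dincl H (N I)) I _ pr1).
Qed.

Lemma push_r_over : MArrow (mfmap (p Q) push_r) =
  MArrow (mfmap (@md_map Dia S (dincl H Q) I (enl_pi Nt I ⊙ pr2)) f).
Proof.
rewrite /push_r.
refine (eq_trans (mfmap_compM_arrow _ (eq_sym (mm_nat p pr2))) _); rewrite /= mcast_arrow.
refine (eq_trans (mfmap_arrow _ (pf_over Wt (enl_incl Nt p ss (prodF F ss X)))) _).
exact: mfmap_compM_arrow (@md_comp _ S (dincl H Q) (dincl H (Nt I)) I _ pr2).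
Qed.

(** CoCartesianity of [push_l] provides the arrow once the two sides agree in [S], and there they
    agree by naturality of the canonical 2-cell at [f]. *)
Lemma push_corr_exists :
  exists x : @Hom (E Q) (pd_map E pr1 WX) (pd_map E pr2 WtX),
    over_mu (Hcomma := Hcomma) p t x /\ mpost x push_l = mpre push_r (fam_xi X).
Proof.
have el : P Q (pd_map E pr1 WX) = base_pull H (enl_pi N I ⊙ pr1) t :=
  f_equal (@mtgt _) push_l_over.
have er : P Q (pd_map E pr2 WtX) = base_pull H (enl_pi Nt I ⊙ pr2) t :=
  f_equal (@mtgt _) push_r_over.
pose g : @Hom (B Q) (P Q (pd_map E pr1 WX)) (P Q (pd_map E pr2 WtX)) :=
  hcast (eq_sym el) (eq_sym er) (corr_mu H Hcomma t).
have gE : Arrow g = Arrow (corr_mu H Hcomma t) := hcast_arrow _ _ _.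
have e : mfmap (p Q) (mpre push_r (fam_xi X)) = mpost g (mfmap (p Q) push_l).
  apply: marrow_inj; rewrite mfmap_mpre.
  refine (eq_trans (mpre_arrow push_r_over (fam_xi_over X)) _).
  refine (eq_trans (f_equal (fun h => MArrow h) (eq_sym (mnt_nat muN f))) _).
  apply: mpost_arrow; first exact: eq_sym push_l_over.
  exact: arrow_marrow (eq_sym gE).
destruct (cocartesian_lift push_l_cocart e) as [x [[x1 x2] _]].
exists x; split=> //; rewrite /over_mu -gE; congr Arrow; exact: x1.
Qed.
End AtObject.

Definition push_corr (X : ProdFam (@EnlFib _ _ H N S D p I) ss) :
  @Hom (E Q) (pd_map E pr1 ⌊W (enl_incl N p ss X)⌋)
    (pd_map E pr2 ⌊Wt (enl_incl Nt p ss (prodF F ss X))⌋) :=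
  proj1_sig (constructive_indefinite_description _ (push_corr_exists X)).

Lemma push_corr_over (X : ProdFam (@EnlFib _ _ H N S D p I) ss) :
  over_mu (Hcomma := Hcomma) p t (push_corr X).
Proof.
exact (proj1 (proj2_sig (constructive_indefinite_description _ (push_corr_exists X)))).
Qed.

Lemma push_corrE (X : ProdFam (@EnlFib _ _ H N S D p I) ss) :
  mpost (push_corr X) (push_l X) = mpre (push_r X) (fam_xi X).
Proof.
exact (proj2 (proj2_sig (constructive_indefinite_description _ (push_corr_exists X)))).
Qed.

(** Evaluated at a point with identity arrow, the square [push_corrE] has coCartesian sides and
    invertible arguments, and [push_corr] lies over an identity. *)
Lemma push_corr_good (X : ProdFam (@EnlFib _ _ H N S D p I) ss) :
  corr_good (Hcomma := Hcomma) (push_corr X).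
Proof.
move=> q Hq.
pose evq := @md_map _ D dpt Q (pointF q).
have Hl : cocartesian (p dpt) (mfmap evq (push_l X)).
  exact: (proj2 f0 dpt Q (pointF q) _ _ _ (@push_l_cocart X)).
have Hr : cocartesian (p dpt) (mfmap evq (push_r X)).
  exact: (proj2 f0 dpt Q (pointF q) _ _ _ (@push_r_cocart X)).
refine (cocartesian_mpre_iso (v := mfmap evq (push_corr X)) Hl Hr
  (fam_xi_iso X Hq) _ _); last by rewrite -mfmap_mpost push_corrE mfmap_mpre.
apply: identity_iso.
apply: (identity_arrow (eq_sym (@pm_map _ E B P dpt Q (pointF q) _ _ (push_corr X)))).
apply: (identity_arrow (eq_sym (arrow_fmap (ev B q) (push_corr_over X)))).
exact: ev_corr_mu.
Qed.

(** Both composites lie over the same morphism of [S], so they may be compared after [push_l], where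
    [push_corrE] and functoriality of the push-forwards apply. *)
Lemma push_corr_nat (X X' : ProdFam (@EnlFib _ _ H N S D p I) ss) (u : Hom X X') :
  fmap (pd_map E pr2)
    (⌊fmap Wt (fmap (enl_incl Nt p ss) (fmap (prodF F ss) u))⌋ : @Hom (E (Nt I)) _ _)
    ∘ push_corr X =
  push_corr X' ∘ fmap (pd_map E pr1)
    (⌊fmap W (fmap (enl_incl N p ss) u)⌋ : @Hom (E (N I)) _ _).
Proof.
apply: (cocartesian_inj (@push_l_cocart X)).
- apply: (@arrow_inj (B Q)).
  refine (eq_trans (over_mu_comp_r _ (push_corr_over X)) (eq_sym
    (over_mu_comp_l _ (push_corr_over X')))).
  + exact: (fib_vertical (fmap Wt (fmap (enl_incl Nt p ss) (fmap (prodF F ss) u)))).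
  + exact: (fib_vertical (fmap W (fmap (enl_incl N p ss) u))).
- rewrite -!mpost_mpost push_corrE mpost_mpre.
  rewrite /push_r -(mfmap_mpost (md_map D pr2)) pf_nat mfmap_mpre mpre_mpre fam_xi_nat.
  rewrite /push_l -(mfmap_mpost (md_map D pr1)) pf_nat mfmap_mpre mpost_mpre.
  by rewrite [mpost _ _](push_corrE X') mpre_mpre.
Qed.
End PushCompatibility.

(** * Assembling the equivalence and its compatibilities *)

Theorem proposition4p10
  (Dia' Dia : DiagramCategory) (H : sub_dia Dia' Dia)
  (N : EnlFunctor Dia Dia')
  (N_N1 : N1 N) (N_N2 : N2 N) (N_N3 : N3 N)
  (N_N4 : N4_left N) (N_N5 : N5_left N)
  (Nt : EnlFunctor Dia Dia')
  (Nt_N1 : N1 Nt) (Nt_N2 : N2 Nt) (Nt_N3 : N3 Nt)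
  (Nt_N4 : N4_right Nt) (Nt_N5 : N5_right Nt)
  (N_Nt_comma : forall I : DiaOb Dia, Dia' (Comma (enl_pi N I) (enl_pi Nt I)))
  (S : PreMultiDerivator Dia) (S_der1 : der1 S) (S_der2 : der2 S)
  (D : PreMultiDerivator Dia') (p : MDMor D (md_restrict H S))
  (p_left : left_fibered_multiderivator p)
  (p_right : right_fibered_multiderivator p) :
  exists F : forall (I : DiaOb Dia) (s : S I),
      Functor (EnlFib N p s) (EnlFib Nt p s),
    (forall (I : DiaOb Dia) (s : S I), is_equivalence (F I s)) /\
    (forall (I J : DiaOb Dia) (a : Functor I J) (s : S J),
       nat_iso (F I (md_map S a s) ⊙ enl_pull N p a s)
               (enl_pull Nt p a s ⊙ F J s)) /\
    (forall (I : DiaOb Dia) (ss : list (S I)) (t : S I) (f : mhom ss t)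
       (P : PushFun (p (N I)) (mfmap (pi_star H N S I) f))
       (Pt : PushFun (p (Nt I)) (mfmap (pi_star H Nt S I) f)),
       exists (h : push_preserves_cart P) (ht : push_preserves_cart Pt),
         nat_iso (F I t ⊙ enl_push h)
                 (enl_push ht ⊙ prodF (F I) ss)).
Proof.
pose cl (I : DiaOb Dia) (s : S I) := corr_l p N_Nt_comma s.
pose cr (I : DiaOb Dia) (s : S I) := corr_r p N_Nt_comma s.
have bim (I : DiaOb Dia) (s : S I) := bimodule_equivalence
  (@corr_rel_l _ _ H S D p N Nt N_Nt_comma I s)
  (@corr_rel_r _ _ H S D p N Nt N_Nt_comma I s)
  (corr_left_existence N_Nt_comma p_left N_N3 N_N4 N_N5 (s := s))
  (corr_right_existence N_Nt_comma p_left p_right Nt_N3 Nt_N4 Nt_N5 (s := s))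
  (@corr_left_universal _ _ H S D p N Nt N_Nt_comma p_left N_N3 N_N4 N_N5 I s)
  (@corr_right_universal _ _ H S D p N Nt N_Nt_comma p_left p_right
     Nt_N3 Nt_N4 Nt_N5 I s).
(* Each equivalence is chosen together with its family [xi], through which the functors in the two
   compatibilities are compared. *)
have ch (I : DiaOb Dia) (s : S I) : {F : Functor (EnlFib N p s) (EnlFib Nt p s) &
    {xi : forall X, Hom (cl I s X) (cr I s (F X)) |
      is_equivalence F /\ (forall X, corr_rel (xi X) /\ corr_equiv (xi X)) /\
      forall X X' (u : Hom X X'),
        fmap (cr I s) (fmap F u) ∘ xi X = xi X' ∘ fmap (cl I s) u}}.
  destruct (constructive_indefinite_description _ (bim I s)) as [F HF].
  destruct (constructive_indefinite_description _ HF) as [xi Hxi].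
  exact (existT _ F (exist _ xi Hxi)).
pose F (I : DiaOb Dia) (s : S I) := projT1 (ch I s).
pose xi (I : DiaOb Dia) (s : S I) : forall X, Hom (cl I s X) (cr I s (F I s X)) :=
  proj1_sig (projT2 (ch I s)).
have xi_good (I : DiaOb Dia) (s : S I) X :
    corr_rel (xi I s X) /\ corr_equiv (xi I s X) :=
  proj1 (proj2 (proj2_sig (projT2 (ch I s)))) X.
have xi_nat (I : DiaOb Dia) (s : S I) X X' (u : Hom X X') :
    fmap (cr I s) (fmap (F I s) u) ∘ xi I s X = xi I s X' ∘ fmap (cl I s) u :=
  proj2 (proj2 (proj2_sig (projT2 (ch I s)))) X X' u.
exists F; split; last split.
- move=> I s; exact (proj1 (proj2_sig (projT2 (ch I s)))).
- move=> I J a s.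
  (* The elements attached to the second composite are those of [J], restricted along
     [corr_dia_map]. *)
  refine (bimodule_nat_iso (FA := cl I (md_map S a s)) (FB := cr I (md_map S a s))
    (@corr_rel_r _ _ H S D p N Nt N_Nt_comma I (md_map S a s))
    (@corr_left_universal _ _ H S D p N Nt N_Nt_comma p_left N_N3 N_N4 N_N5 I
       (md_map S a s))
    (K := enl_pull N p a s)
    (F2 := enl_pull Nt p a s ⊙ F J s)
    (x2 := fun X => corr_pull (Hcomma := N_Nt_comma) a (xi J s X))
    (xi_good I (md_map S a s)) (xi_nat I (md_map S a s)) _ _).
  + move=> X; split.
    * exact (corr_pull_over a (proj1 (xi_good J s X))).
    * exact (corr_pull_good a (proj2 (xi_good J s X))).
  + move=> X X' u; exact (corr_pull_nat a (xi_nat J s X X' u)).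
- move=> I ss t f W Wt.
  have h : push_preserves_cart W := @push_cart _ _ H S D p (lf_fder0 p_left) I N _ _ _ W.
  have ht : push_preserves_cart Wt :=
    @push_cart _ _ H S D p (lf_fder0 p_left) I Nt _ _ _ Wt.
  have Hrel (s : S I) X : corr_rel (xi I s X) := proj1 (xi_good I s X).
  have Heq (s : S I) X : corr_equiv (xi I s X) := proj2 (xi_good I s X).
  exists h, ht.
  refine (bimodule_nat_iso (FA := cl I t) (FB := cr I t)
    (@corr_rel_r _ _ H S D p N Nt N_Nt_comma I t)
    (@corr_left_universal _ _ H S D p N Nt N_Nt_comma p_left N_N3 N_N4 N_N5 I t)
    (K := enl_push h) (F2 := enl_push ht ⊙ prodF (F I) ss)
    (x2 := fun X => push_corr (lf_fder0 p_left) Hrel W Wt X)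
    (xi_good I t) (xi_nat I t) _ _).
  + move=> X; split.
    * exact (push_corr_over (lf_fder0 p_left) Hrel W Wt X).
    * exact (push_corr_good (lf_fder0 p_left) Hrel Heq W Wt X).
  + move=> X X' u; exact (push_corr_nat (lf_fder0 p_left) Hrel (xi_nat I) W Wt u).
Qed.
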